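(* Let $K,A>0$ be fixed and let the data $\overline a,\Phi_1,\Phi_2,f,g,W_1,W_2,l_1,l_2$ and the approximations $l_j^{(\varepsilon_l)}$ ($j=1,2$) satisfy the assumptions listed in the context, with constants $\alpha,\beta,\eta$ as there. Let $W_1^{(\varepsilon_W)}\approx W_1$, $W_2^{(\varepsilon_W)}\approx W_2$ be the approximations of the Gaussian random fields on discrete grids described in the context. Let $1\le t\le s<\eta-1$ and $0<\gamma<\min(1,\beta/(2\alpha))$ be such that $s\gamma\ge2$. Then $$\|a_{K,A}-a_{K,A}^{(\varepsilon_W,\varepsilon_l)}\|_{L^s(\Omega;L^t([0,D]^2))}\le C\big(\varepsilon_W^\gamma+\varepsilon_l^{1/s}\big),$$ with a constant $C$ which does not depend on the discretization parameters $\varepsilon_W$ and $\varepsilon_l$. Here $$a_{K,A}(x,y)=\chi_A\Big(\overline a(x,y)+\Phi_1(W_1(x,y))+\Phi_2\big(W_2(\chi_K(l_1(x)),\chi_K(l_2(y)))\big)\Big),$$ $$a_{K,A}^{(\varepsilon_W,\varepsilon_l)}(x,y)=\chi_A\Big(\overline a(x,y)+\Phi_1(W_1^{(\varepsilon_W)}(x,y))+\Phi_2\big(W_2^{(\varepsilon_W)}(\chi_K(l_1^{(\varepsilon_l)}(x)),\chi_K(l_2^{(\varepsilon_l)}(y)))\big)\Big)$$ for $(x,y)\in\mathcal D=(0,D)^2$, and $\chi_B(z)=\min(z,B)$ for $z\in[0,+\infty)$, $B>0$.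
   Context: $(\Omega,\mathcal F,\mathbb P)$ is a complete probability space, $0<D<+\infty$, $\mathcal D=(0,D)^2$, $H=L^2(\mathcal D)$, and $\partial\mathcal D=\Gamma_1\cup\Gamma_2$ is a disjoint decomposition into two $1$-dimensional manifolds such that the exterior normal derivative on $\Gamma_2$ is well-defined for every $u\in C^1(\overline{\mathcal D})$. For a Banach space $B$, $\|Z\|_{L^p(\Omega;B)}=\mathbb E(\|Z\|_B^p)^{1/p}$, $p\in[1,+\infty)$. Assumptions: (i) $W_1$ is a zero-mean Gaussian random field on $[0,D]^2$ and $W_2$ is a zero-mean Gaussian random field on $[0,K]^2$, both with $\mathbb P$-a.s. continuous paths. Let $q_1,q_2$ be their covariance functions, $Q_j\phi=\int_{[0,z_j]^2}q_j(\cdot,(x',y'))\phi(x',y')\,d(x',y')$ ($z=(D,K)$, $\phi\in L^2([0,z_j]^2)$, $j=1,2$) the covariance operators and $(\lambda_i^{(j)},e_i^{(j)},\ i\in\mathbb N)$ their eigenpairs, where $(e_i^{(1)})_i$, $(e_i^{(2)})_i$ are orthonormal bases of $L^2([0,D]^2)$, $L^2([0,K]^2)$. The eigenfunctions are continuously differentiable and there are $\alpha,\beta,C_e,C_\lambda>0$ with, for all $i\in\mathbb N$, $\|e_i^{(1)}\|_{L^\infty([0,D]^2)},\|e_i^{(2)}\|_{L^\infty([0,K]^2)}\le C_e$, $\|\nabla e_i^{(1)}\|_{L^\infty([0,D]^2)},\|\nabla e_i^{(2)}\|_{L^\infty([0,K]^2)}\le C_e i^\alpha$, and $\sum_{i=1}^\infty(\lambda_i^{(1)}+\lambda_i^{(2)})i^\beta\le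 C_\lambda<+\infty$. (ii) $\Phi_1,\Phi_2:\mathbb R\to[0,+\infty)$ are continuous, $\Phi_1\in C^1(\mathbb R)$, and there are $\phi,\psi,C_{lip}>0$ with $|\Phi_1'(x)|\le\phi\exp(\psi|x|)$ and $|\Phi_2(x)-\Phi_2(y)|\le C_{lip}|x-y|$ for $x,y\in\mathbb R$. (iii) $f\in L^q(\Omega;H)$ and $g\in L^q(\Omega;L^2(\Gamma_2))$ for some $q\in(1,+\infty)$ ($f$ and $g$ are the source term and the Neumann data of the associated elliptic problem). (iv) $\overline a:\mathcal D\to(0,+\infty)$ is deterministic, continuous, and there are constants $\overline a_+,\overline a_->0$ with $\overline a_-\le\overline a(x,y)\le\overline a_+$ for $(x,y)\in\mathcal D$. (v) $l_1,l_2$ are Lévy subordinators on $[0,D]$ ($\mathbb P$-a.s. non-decreasing real-valued Lévy processes) with Lévy triplets $(\gamma_1,0,\nu_1)$ and $(\gamma_2,0,\nu_2)$, which are independent of the Gaussian random fields $W_1$ and $W_2$. There are approximations $l_1^{(\varepsilon_l)},l_2^{(\varepsilon_l)}$ of these processes and constants $\eta,C_l>0$ such that for every $s\in[1,\eta-1)$ $$\mathbb E(|l_j(x)-l_j^{(\varepsilon_l)}(x)|^s)\le C_l\varepsilon_l\qquad\text{for }\varepsilon_l>0,\ x\in[0,D],\ j=1,2.$$ Approximation of the Gaussian fields: $W_1^{(\varepsilon_W)}$ (resp. $W_2^{(\varepsilon_W)}$) is constructed by point evaluation of $W_1$ (resp. $W_2$) on the tensor product grid built from an equidistant grid on $[0,D]$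 (resp. $[0,K]$) with maximum step size $\varepsilon_W$, and (bi-)linear interpolation between the grid points.
   Formalization: The approximations of l_1, l_2 are additionally assumed to be, together with l_1, l_2, independent of (W_1, W_2) for each ε_l (without this the claim can fail), as well as jointly measurable and a.s. nonnegative on [0,D], so that the norm and χ_K are well defined. *)

(* Defs.v *)
From HB Require Import structures.
From mathcomp Require Import all_boot all_order all_algebra.
From mathcomp Require Import all_classical all_reals all_analysis.

Set Implicit Arguments.
Unset Strict Implicit.
Unset Printing Implicit Defensive.

Import Order.TTheory GRing.Theory Num.Theory.
Import numFieldNormedType.Exports.

Local Open Scope classical_set_scope.
Local Open Scope ring_scope.

(* Functions on a square [0, L]^2 and processes indexed by [0, L] are total
   functions on R * R and R; their values off the domain are never used. *)

Section squares.
Context {R : realType}.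

Definition csquare (L : R) : set (R * R) :=
  [set p | 0 <= p.1 <= L /\ 0 <= p.2 <= L].

Definition osquare (L : R) : set (R * R) :=
  [set p | 0 < p.1 < L /\ 0 < p.2 < L].

Definition square_boundary (L : R) : set (R * R) := csquare L `\` osquare L.

Definition leb2 :
    {measure set (measurableTypeR R * measurableTypeR R) -> \bar R} :=
  (@lebesgue_measure R \x @lebesgue_measure R)%E.

(* u is C^1 on [0, L]^2: du is the gradient of u on (0, L)^2 and extends
   continuously up to the boundary. *)
Definition C1_gradient (L : R) (u : R * R -> R) (du : R * R -> R * R) : Prop :=
  [/\ {within csquare L, continuous u},
      {within csquare L, continuous du} &
      forall p, osquare L p ->
        is_derive p.1 1 (fun x => u (x, p.2)) (du p).1 /\
        is_derive p.2 1 (fun y => u (p.1, y)) (du p).2].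

Definition euclid (v : R * R) : R := Num.sqrt (v.1 ^+ 2 + v.2 ^+ 2).

End squares.

Section function_spaces.
Context {R : realType} {d : measure_display} {X : measurableType d}.
Variables (mu : {measure set X -> \bar R}) (S : set X).

Definition Lp_norm (p : \bar R) (h : X -> R) : \bar R :=
  Lnorm mu p (EFin \o (h \_ S)).

Definition in_Lp (p : \bar R) (h : X -> R) : Prop :=
  measurable_fun S h /\ (Lp_norm p h < +oo)%E.

Definition inner (h k : X -> R) : R := \int[mu]_(x in S) (h x * k x).

Definition orthonormal_basis (e : nat -> X -> R) : Prop :=
  [/\ forall i, in_Lp 2%:E (e i),
      forall i j, inner (e i) (e j) = (i == j)%:R &
      forall h, in_Lp 2%:E h ->
        Lp_norm 2%:E (fun x => h x - \sum_(i < n) inner h (e i) * e i x)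
          @[n --> \oo] --> 0%E].

Context {d' : measure_display} {T : measurableType d'} (P : probability T R).

(* norm of L^q(Omega; L^p(S)) *)
Definition bochner_norm (q p : \bar R) (F : T -> X -> R) : \bar R :=
  Lnorm P q (fun w => Lp_norm p (F w)).

(* F is a.s. the limit in L^p(S) of simple L^p(S)-valued functions. *)
Definition strongly_measurable (p : \bar R) (F : T -> X -> R) : Prop :=
  exists s : nat -> T -> X -> R,
    (forall n, [/\ finite_set (range (s n)),
                   forall h, measurable (s n @^-1` [set h]) &
                   forall w, in_Lp p (s n w)]) /\
    {ae P, forall w,
       Lp_norm p (fun x => F w x - s n w x) @[n --> \oo] --> 0%E}.

Definition in_bochner (q p : \bar R) (F : T -> X -> R) : Prop :=
  [/\ forall w, in_Lp p (F w),
      strongly_measurable p F &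
      (bochner_norm q p F < +oo)%E].

End function_spaces.

Section boundary.
Context {R : realType}.
Local Notation RT := (measurableTypeR R).

Definition edge (D : R) (k : 'I_4) (t : RT) : RT * RT :=
  match val k with
  | 0%N => (t, 0)
  | 1%N => (t, D)
  | 2%N => (0, t)
  | _ => (D, t)
  end.

Lemma measurable_edge (D : R) (k : 'I_4) : measurable_fun setT (edge D k).
Proof.
rewrite /edge; case: (val k) => [|[|[|n]]]; exact: measurable_fun_pair.
Qed.

Definition edge_measure (D : R) (k : nat) :
    {measure set (RT * RT) -> \bar R} :=
  measure_function_pushforward__canonical__measure_function_Measure
    (mrestr (@lebesgue_measure R) (measurable_itv `[0, D]))
    (measurable_edge D (inord k)).

(* arc length on the boundary of the square of side D *)
Definition boundary_measure (D : R) : {measure set (RT * RT) -> \bar R} :=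
  msum (edge_measure D) 4.

(* one-dimensional topological manifold, possibly with boundary: every point
   has a relatively open neighbourhood homeomorphic to a relatively open subset
   of [0, +oo) *)
Definition one_manifold (G : set (R * R)) : Prop :=
  forall p, G p ->
    exists (U : set (R * R)) (V : set R) (h : R * R -> R) (k : R -> R * R),
      [/\ open U, U p & open V] /\
      let GU := G `&` U in
      let HV := [set t | 0 <= t] `&` V in
      [/\ {within GU, continuous h}, {within HV, continuous k},
          forall x, GU x -> HV (h x) /\ k (h x) = x &
          forall t, HV t -> GU (k t) /\ h (k t) = t].

(* n is the exterior unit normal at p of a side of the square containing p;
   a corner belongs to two sides. *)
Definition exterior_normal (D : R) (p n : R * R) : Prop :=
  square_boundary D p /\
  [\/ p.1 = 0 /\ n = (-1, 0), p.1 = D /\ n = (1, 0),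
      p.2 = 0 /\ n = (0, -1) | p.2 = D /\ n = (0, 1)].

Definition normal_derivative_defined (D : R) (G : set (R * R)) : Prop :=
  forall u du, C1_gradient D u du -> forall p, G p ->
    exists v : R, forall n, exterior_normal D p n ->
      v = (du p).1 * n.1 + (du p).2 * n.2.

End boundary.

Section random_objects.
Context {R : realType} {d : measure_display} {T : measurableType d}.
Variable P : probability T R.

(* [normal_prob m 0] is not the Dirac mass at m, hence the case distinction. *)
Definition gaussian (X : T -> R) : Prop :=
  exists m sigma : R, forall B : set R, measurable B ->
    P (X @^-1` B) = if sigma == 0 then \d_m B else normal_prob m sigma B.

(* All finite-dimensional marginals are (possibly degenerate) multivariate
   Gaussian, i.e. all their linear combinations are Gaussian. *)
Definition gaussian_field (S : set (R * R))
    (W : R * R -> {RV P >-> R}) : Prop :=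
  forall (n : nat) (z : 'I_n -> R * R) (c : 'I_n -> R),
    (forall i, S (z i)) -> gaussian (fun w => \sum_(i < n) c i * W (z i) w).

Definition covariance_function (W : R * R -> {RV P >-> R}) (p p' : R * R) : R :=
  fine (covariance P (W p) (W p')).

Definition covariance_operator (L : R) (W : R * R -> {RV P >-> R})
    (h : R * R -> R) (p : R * R) : R :=
  \int[leb2]_(p' in csquare L) (covariance_function W p p' * h p').

Definition eigenpairs (L : R) (W : R * R -> {RV P >-> R})
    (lam : nat -> R) (e : nat -> R * R -> R) : Prop :=
  orthonormal_basis leb2 (csquare L) e /\
  forall i, {ae leb2, forall p, csquare L p ->
    covariance_operator L W (e i) p = lam i * e i p}.

(* The i-th eigenfunction of the text (i >= 1) is [e i.-1]. *)
Definition eigenfunction_bounds (L : R) (e : nat -> R * R -> R)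
    (alpha Ce : R) : Prop :=
  forall i,
    (Lp_norm leb2 (csquare L) +oo (e i) <= Ce%:E)%E /\
    exists2 de, C1_gradient L (e i) de &
      (Lp_norm leb2 (csquare L) +oo (fun p => euclid (de p))
         <= (Ce * i.+1%:R `^ alpha)%:E)%E.

Definition levy_process (D : R) (l : R -> {RV P >-> R}) : Prop :=
  [/\ {ae P, forall w, l 0 w = 0},
      (forall (n : nat) (t : nat -> R) (B : nat -> set R),
         (forall i, (i <= n)%N -> 0 <= t i <= D) ->
         (forall i, (i < n)%N -> t i <= t i.+1) ->
         (forall i, measurable (B i)) ->
         P [set w | forall i, (i < n)%N -> B i (l (t i.+1) w - l (t i) w)] =
         (\prod_(i < n) P [set w | B i (l (t i.+1) w - l (t i) w)%R])%E),
      (forall (s t : R) (B : set R), 0 <= s -> s <= t -> t <= D -> measurable B ->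
         P [set w | B (l t w - l s w)] = P [set w | B (l (t - s) w)]) &
      (forall t eps : R, 0 <= t <= D -> 0 < eps ->
         P [set w | eps < `|l s w - l t w|]
           @[s --> within `[0, D] (nbhs t)] --> 0%E)].

Definition levy_measure
    (nu : {measure set (measurableTypeR R) -> \bar R}) : Prop :=
  nu [set 0] = 0%E /\
  (\int[nu]_y (Num.min 1 (y ^+ 2))%:E < +oo)%E.

(* Levy-Khintchine formula E exp(i u l(t)) = exp(t psi(u)), where
   psi(u) = i g u - b u^2 / 2
            + \int (exp(i u y) - 1 - i u y 1_{|y| <= 1}) nu(dy),
   split into real and imaginary parts *)
Definition levy_triplet (D : R) (l : R -> {RV P >-> R}) (g b : R)
    (nu : {measure set (measurableTypeR R) -> \bar R}) : Prop :=
  levy_measure nu /\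
  forall t u : R, 0 <= t <= D ->
    let re := - (b * u ^+ 2) / 2 + \int[nu]_y (cos (u * y) - 1) in
    let im := g * u + \int[nu]_y (sin (u * y) - u * y * \1_`[-1, 1] y) in
    ('E_P[fun w => cos (u * l t w)] = (expR (t * re) * cos (t * im))%:E)%E /\
    ('E_P[fun w => sin (u * l t w)] = (expR (t * re) * sin (t * im))%:E)%E.

Definition levy_subordinator (D : R) (l : R -> {RV P >-> R}) (g : R)
    (nu : {measure set (measurableTypeR R) -> \bar R}) : Prop :=
  [/\ levy_process D l, levy_triplet D l g 0 nu &
      {ae P, forall w (x y : R), 0 <= x -> x <= y -> y <= D ->
         l x w <= l y w}].

(* events {X i in B}, i in I; they generate the sigma-algebra of the process *)
Definition process_events {I : Type} (J : set I) (X : I -> T -> R) :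
    set (set T) :=
  \bigcup_(i in J) preimage_set_system setT (X i) measurable.

Definition independent_families (G H : set (set T)) : Prop :=
  forall A B, <<s G >> A -> <<s H >> B -> P (A `&` B) = (P A * P B)%E.

End random_objects.

Section discretization.
Context {R : realType}.

(* index i of the cell [i L / n, (i + 1) L / n] containing x *)
Definition cell (L : R) (n : nat) (x : R) : nat :=
  minn (Num.truncn (x * n%:R / L)) n.-1.

Definition node (L : R) (n i : nat) : R := i%:R * L / n%:R.

(* bilinear interpolation of w on the tensor grid {i L / n | i <= n}^2 *)
Definition bilinear_interp (L : R) (n : nat) (w : R * R -> R) (p : R * R) : R :=
  let i := cell L n p.1 in
  let j := cell L n p.2 in
  let u := p.1 * n%:R / L - i%:R in
  let v := p.2 * n%:R / L - j%:R in
  (1 - u) * (1 - v) * w (node L n i, node L n j)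
  + u * (1 - v) * w (node L n i.+1, node L n j)
  + (1 - u) * v * w (node L n i, node L n j.+1)
  + u * v * w (node L n i.+1, node L n j.+1).

(* N eps is the number of cells per direction of the equidistant grid on [0, L]
   with maximum step size eps. *)
Definition grid_sizes (L : R) (N : R -> nat) : Prop :=
  forall eps : R, 0 < eps -> (0 < N eps)%N /\ L / (N eps)%:R <= eps.

Definition chi (B z : R) : R := Num.min z B.

(* the coefficient a_{K,A} built from fields w1, w2 and processes l1, l2 *)
Definition coefficient (K A : R) (abar : R * R -> R) (Phi1 Phi2 : R -> R)
    (w1 w2 : R * R -> R) (l1 l2 : R -> R) (p : R * R) : R :=
  chi A (abar p + Phi1 (w1 p) + Phi2 (w2 (chi K (l1 p.1), chi K (l2 p.2)))).

End discretization.

(* Main.v *)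
Require Import Defs.
From HB Require Import structures.
From mathcomp Require Import all_boot all_order all_algebra.
From mathcomp Require Import all_classical all_reals all_analysis.
From mathcomp Require Import measurable_realfun ess_sup_inf.
From mathcomp Require Import ring lra.
Set Implicit Arguments.
Unset Strict Implicit.
Unset Printing Implicit Defensive.
Import Order.TTheory GRing.Theory Num.Theory.
Import numFieldNormedType.Exports.
Local Open Scope classical_set_scope.
Local Open Scope ring_scope.

(** The coefficient is a 1-Lipschitz function of
    abar + Phi1(W1) + Phi2(W2(l1, l2)) and the square has finite measure, so the
    L^s(Omega; L^t) norm is controlled by the s-th moments of the error at single
    points ([bochner_norm_le]): it is enough to bound, uniformly in p,
    E|Phi1(W1(p)) - Phi1(interpolant of W1 at p)|^s and the s-th moment of
    W2 at the true random point minus its interpolant at the approximate one, by a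
    multiple of eW^(s gamma) + el.

    Both bounds rest on the Hoelder estimate
    E|W(p) - W(p')|^b <= C |p - p'|^(b gamma) for a centred Gaussian field with the
    given eigenpairs ([field_increment_moment]).
    In mean square it is the Karhunen-Loeve expansion in weak form.  Pairing the
    field with the difference h of the normalized indicators of two small squares
    near p and p' gives a random variable close to W(p) - W(p'), and
    E<W, h>^2 <= sup_n sum_(i < n) lam_i <h, e_i>^2 ([pairing_sq_le]).  The bounds on
    e_i and on its gradient give |<h, e_i>| <= C min(1, i^alpha |p - p'|), hence
    <h, e_i>^2 <= C i^(2 alpha gamma) |p - p'|^(2 gamma), which is summable against
    lam_i since 2 alpha gamma <= beta ([field_increment_sq_le]).  Moments of other
    orders follow because for a Gaussian variable P(|X| <= M) >= 3/4 already forces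
    the mean and the standard deviation to be at most of order M, and so bounds
    every exponential moment ([gaussian_expR_le]); Chebyshev's inequality provides such
    an M from the second moment.  Almost sure continuity provides a common M for
    all the W(p) ([field_tight]), and the resulting exponential moments absorb the
    growth of Phi1' in [field_transform_error].

    The evaluation points of W2 are random but independent of W2.  Moving them to
    the nodes of a grid, they select one of finitely many increments of W2, and the
    selection is independent of these increments; Fatou's lemma then removes the
    grid ([random_increment_moment]).  This turns the s-th moment of an increment of
    W2 into the moment of order s gamma of the distance of the points, which the
    error assumption on the subordinators bounds by a multiple of el, because
    1 <= s gamma < eta - 1.

    The exchange of the integrals over the square and over Omega needs functions
    measurable in both variables.  The fields are replaced by [version], a limit of
    fields constant on grid cells, and a subordinator by a supremum of its values at
    grid points below ([subordinator_sandwich]), which by monotonicity and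
    stochastic continuity is a.s. the right value at each time. *)

(** * Moments of Gaussian variables *)

Section density.
Context d (T : measurableType d) (R : realType).
Local Open Scope ereal_scope.
Variables (mu nu : {measure set T -> \bar R}) (g : T -> R).
Hypotheses (mg : measurable_fun setT g) (g0 : forall x, (0 <= g x)%R).
Hypothesis nuE : forall A, measurable A -> nu A = \int[mu]_(x in A) (g x)%:E.

Import HBNNSimple.

(** True for indicators by hypothesis, then for simple functions by linearity and
    for all nonnegative functions by monotone convergence. *)
Lemma ge0_integral_density (f : T -> \bar R) :
  measurable_fun setT f -> (forall x, 0 <= f x) ->
  \int[nu]_x f x = \int[mu]_x (f x * (g x)%:E).
Proof.
move=> mf f0; pose f_ := nnsfun_approx measurableT mf.
transitivity (limn (fun n => \int[nu]_x (f_ n x)%:E)).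
  rewrite -monotone_convergence//=.
  - apply: eq_integral => x _; apply/esym/cvg_lim => //=.
    exact: cvg_nnsfun_approx.
  - by move=> n; apply/measurable_EFinP.
  - by move=> n x _; rewrite lee_fin.
  - by move=> x _ a b ab; rewrite lee_fin//; exact/lefP/nd_nnsfun_approx.
rewrite (_ : \int[mu]_x (f x * (g x)%:E) =
    limn (fun n => \int[mu]_x ((f_ n x)%:E * (g x)%:E))); last first.
  rewrite -monotone_convergence//=.
  - apply: eq_integral => x _; apply/esym/cvg_lim => //.
    by apply: cvgeZr => //; exact: cvg_nnsfun_approx.
  - by move=> n; apply: emeasurable_funM; exact/measurable_EFinP.
  - by move=> n x _; rewrite mule_ge0// lee_fin.
  - move=> x _ a b ab; rewrite lee_wpmul2r ?lee_fin//.
    exact/lefP/nd_nnsfun_approx.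
congr (limn _); apply/funext => n.
under eq_integral do rewrite fimfunE -fsumEFin//.
rewrite ge0_integral_fsum//; last 2 first.
  - by move=> r; exact/measurable_EFinP/measurableT_comp.
  - by move=> m x _; rewrite EFinM nnfun_muleindic_ge0.
under [RHS]eq_integral.
  move=> x _; rewrite fimfunE -fsumEFin// muleC ge0_mule_fsumr; last first.
    by move=> r; rewrite EFinM nnfun_muleindic_ge0.
  over.
rewrite [RHS]ge0_integral_fsum//; last 2 first.
  - move=> r; apply: emeasurable_funM; first exact/measurable_EFinP.
    by apply/measurable_EFinP; apply/measurableT_comp => //.
  - by move=> m x _; rewrite mule_ge0// ?EFinM ?nnfun_muleindic_ge0 ?lee_fin.
apply: eq_fsbigr => r /[!inE] -[y _ <-].
rewrite integralZl_indic_nnsfun// integral_indic//= setIT nuE//.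
rewrite [in LHS]integral_mkcond -ge0_integralZl//; last first.
- by rewrite lee_fin.
- by move=> x _; rewrite patchE; case: ifPn => // _; rewrite lee_fin.
- by apply/(measurable_restrictT _ _).1 => //; apply/measurable_EFinP/measurable_funTS.
apply: eq_integral => x _; rewrite patchE indicE.
case: ifPn => _; first by rewrite mulr1 muleC.
by rewrite mulr0 !mule0.
Qed.
End density.

Section gaussian_moments.
Context {R : realType}.
Local Notation RT := (measurableTypeR R).
Local Notation leb := (@lebesgue_measure R).

(** Completing the square: an exponential factor only shifts the mean. *)
Lemma normal_pdf_tilt (m s k x : R) : s != 0 ->
  expR (k * x) * normal_pdf m s x =
  expR (k * m + k ^+ 2 * s ^+ 2 / 2) * normal_pdf (m + k * s ^+ 2) s x.
Proof.
move=> s0; rewrite /normal_pdf (negbTE s0) /normal_fun.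
rewrite mulrCA [RHS]mulrCA -!expRD; congr (_ * expR _).
by rewrite -mulr_natr; field.
Qed.

Lemma normal_mgf (m s k : R) : s != 0 ->
  (\int[normal_prob m s]_x (expR (k * x))%:E =
   (expR (k * m + k ^+ 2 * s ^+ 2 / 2))%:E)%E.
Proof.
move=> s0.
rewrite (@ge0_integral_density _ _ R leb (normal_prob m s) (normal_pdf m s)).
- under eq_integral do rewrite -EFinM normal_pdf_tilt// EFinM.
  rewrite ge0_integralZl//.
  + by rewrite integral_normal_pdf mule1.
  + by apply/measurable_EFinP; exact: measurable_normal_pdf.
  + by move=> x _; rewrite lee_fin normal_pdf_ge0.
- exact: measurable_normal_pdf.
- by move=> x; exact: normal_pdf_ge0.
- by [].
- apply/measurable_EFinP; apply: measurableT_comp => //.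
- by move=> x; rewrite lee_fin expR_ge0.
Qed.

Lemma normal_prob_itv_le (m s M : R) : s != 0 -> 0 < M ->
  (normal_prob m s `[(- M)%R, M%R] <= (normal_peak s * (2 * M))%:E)%E.
Proof.
move=> s0 M0; rewrite /normal_prob.
apply: (@le_trans _ _ (\int[leb]_(x in `[(- M)%R, M%R]) (normal_peak s)%:E)%E).
  apply: ge0_le_integral => //.
  - by move=> x _; rewrite lee_fin normal_pdf_ge0.
  - by apply/measurable_EFinP/measurable_funTS; exact: measurable_normal_pdf.
  - by move=> x _; rewrite lee_fin normal_pdf_ub.
rewrite integral_cst//= lebesgue_measure_itv/= lte_fin gtrN// -EFinD -EFinM.
by rewrite lee_fin opprK mulr2n mulrDl mul1r.
Qed.

(** The density is at most its peak, of order 1/s, so an interval of length 2M can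
    carry the mass 3/4 only if s is at most of order M. *)
Lemma normal_sd_le (m s M : R) : s != 0 -> 0 < M ->
  ((3 / 4)%:E <= normal_prob m s `[(- M)%R, M%R])%E -> s ^+ 2 <= 2 * M ^+ 2.
Proof.
move=> s0 M0 /le_trans/(_ (normal_prob_itv_le _ s0 M0)); rewrite lee_fin.
rewrite /normal_peak; set q := Num.sqrt _.
have q2 : q ^+ 2 = s ^+ 2 * pi *+ 2.
  by rewrite sqr_sqrtr// mulrn_wge0// mulr_ge0 ?sqr_ge0// pi_ge0.
have q0 : 0 < q.
  by rewrite sqrtr_gt0 mulrn_wgt0// mulr_gt0 ?pi_gt0// exprn_even_gt0.
rewrite [q^-1 * _]mulrC ler_pdivlMr// => qM.
have {}qM : q <= 8 / 3 * M by lra.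
have : q ^+ 2 <= (8 / 3 * M) ^+ 2 by rewrite ler_pXn2r// nnegrE; lra.
have pi2 : s ^+ 2 * 2 <= s ^+ 2 * pi by rewrite ler_wpM2l ?sqr_ge0// pi_ge2.
have M2 := sqr_ge0 M.
rewrite q2 exprMn -mulr_natr; lra.
Qed.

(** Chernoff's bound: on the interval, 1 <= e^(|k|M + kx) for every real k. *)
Lemma normal_prob_le_mgf (m s M k : R) : s != 0 ->
  (normal_prob m s `[(- M)%R, M%R] <=
   (expR (`|k| * M + k * m + k ^+ 2 * s ^+ 2 / 2))%:E)%E.
Proof.
move=> s0; rewrite -addrA expRD EFinM -(normal_mgf _ _ s0) -ge0_integralZl//.
- rewrite -[leLHS]mul1e -integral_cst//= integral_mkcond.
  apply: ge0_le_integral => //=.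
  + by move=> x _; rewrite patchE; case: ifPn.
  + by apply/(measurable_restrictT _ _).1 => //.
  + apply/measurable_EFinP; apply: measurable_funM => //.
    by apply: measurableT_comp.
  + move=> x _; rewrite patchE; case: ifPn => [|_]; last first.
      by rewrite lee_fin mulr_ge0// expR_ge0.
    rewrite inE/= in_itv/= -ler_norml => xM.
    rewrite -EFinM lee_fin -expRD -expR0 ler_expR.
    have : - (k * x) <= `|k| * M.
      by rewrite (le_trans (ler_norm _))// normrN normrM ler_wpM2l.
    lra.
by apply/measurable_EFinP; apply: measurableT_comp.
Qed.

(** Chernoff's bound with |k| = 1/M and the sign opposite to that of m: if |m| were
    larger than 3M, the interval would have mass below 1/e. *)
Lemma normal_mean_le (m s M : R) : s != 0 -> 0 < M ->
  ((3 / 4)%:E <= normal_prob m s `[(- M)%R, M%R])%E -> `|m| <= 3 * M.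
Proof.
move=> s0 M0 PM; have s2 := normal_sd_le s0 M0 PM.
have key k : `|k| = M^-1 -> k * m = - (M^-1 * `|m|) -> `|m| <= 3 * M.
  move=> kM km.
  have := le_trans PM (normal_prob_le_mgf m M k s0).
  rewrite lee_fin kM km mulVf ?gt_eqF// => h.
  have k2 : k ^+ 2 = M ^- 2 by rewrite -(real_normK (num_real k)) kM exprVn.
  have : expR (1 - M^-1 * `|m| + k ^+ 2 * s ^+ 2 / 2) <= expR (2 - M^-1 * `|m|).
    rewrite ler_expR.
    have : k ^+ 2 * s ^+ 2 <= 2.
      by rewrite k2 mulrC ler_pdivrMr// exprn_gt0.
    lra.
  move=> /(le_trans h){}h.
  rewrite leNgt; apply/negP => mM.
  have : 2 - M^-1 * `|m| < - 1.
    have : 3 < M^-1 * `|m| by rewrite ltr_pdivlMl// mulrC.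
    lra.
  rewrite -ltr_expR => /(le_lt_trans h); rewrite expRN.
  (* 3/4 <= e^(-1) would contradict e >= 2 *)
  have e1 := expR_ge1Dx (1 : R).
  have : (expR (1 : R))^-1 <= 2^-1 by rewrite lef_pV2 ?posrE ?expR_gt0.
  lra.
have [m0|m0] := leP 0 m.
- apply: (key (- M^-1)); last by rewrite ger0_norm// mulNr.
  by rewrite normrN gtr0_norm// invr_gt0.
- apply: (key M^-1); first by rewrite gtr0_norm// invr_gt0.
  by rewrite ltr0_norm// mulrN opprK.
Qed.

(** A lower bound on the mass of one interval controls all exponential moments,
    uniformly in the Gaussian law; the law may be degenerate. *)
Lemma gaussian_expR_le d (T : measurableType d) (P : probability T R)
    (X : T -> R) (M k : R) :
  measurable_fun setT X -> gaussian P X -> 0 < M -> 0 <= k ->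
  ((3 / 4)%:E <= P [set w | `|X w|%R <= M]%R)%E ->
  (\int[P]_w (expR (k * `|X w|))%:E <=
   (2 * expR (3 * M * k + k ^+ 2 * M ^+ 2))%:E)%E.
Proof.
move=> mX [m [s XE]] M0 k0 PM.
have mX' : measurable_fun setT (X : T -> RT) by exact: mX.
have mF : measurable_fun setT (fun x : RT => (expR (k * `|x|))%:E).
  apply/measurable_EFinP; apply: measurableT_comp => //.
  by apply: measurable_funM => //; exact: measurableT_comp.
have XM : [set w | `|X w| <= M] = X @^-1` `[- M, M].
  by apply/seteqP; split => w /=; rewrite in_itv/= ler_norml.
rewrite XM XE// in PM.
have -> : (\int[P]_w (expR (k * `|X w|))%:E =
           \int[pushforward P (X : T -> RT)]_x (expR (k * `|x|))%:E)%E.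
  by rewrite ge0_integral_pushforward// => x _; rewrite lee_fin expR_ge0.
have [s0|s0] := eqVneq s 0.
- rewrite s0 eqxx in PM XE.
  rewrite (@eq_measure_integral _ RT _ _ (\d_(m : RT))); last first.
    by move=> A mA _; exact: XE.
  rewrite integral_dirac// diracT mul1e lee_fin.
  move: PM; rewrite diracE lee_fin.
  have [|_] := boolP (m \in _); last by rewrite /=; lra.
  rewrite inE/= in_itv/= -ler_norml => mM _.
  apply: (@le_trans _ _ (expR (3 * M * k + k ^+ 2 * M ^+ 2))).
    rewrite ler_expR.
    have : k * `|m| <= k * M by rewrite ler_wpM2l.
    have : 0 <= k * M by rewrite mulr_ge0// ltW.
    have : 0 <= k ^+ 2 * M ^+ 2 by rewrite mulr_ge0// sqr_ge0.
    lra.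
  by rewrite ler_peMl ?expR_ge0// ler1n.
- rewrite (negbTE s0) in PM XE.
  rewrite (@eq_measure_integral _ _ _ _ (normal_prob m s)); last first.
    by move=> A mA _; exact: XE.
  have mE (j : R) : measurable_fun setT (fun x : RT => (expR (j * x))%:E).
    by apply/measurable_EFinP; apply: measurableT_comp.
  have s2 := normal_sd_le s0 M0 PM; have mM := normal_mean_le s0 M0 PM.
  apply: (@le_trans _ _ (\int[normal_prob m s]_x
      ((expR (k * x))%:E + (expR (- k * x))%:E))%E).
    apply: ge0_le_integral => //.
    + exact: (emeasurable_funD (mE k) (mE (- k))).
    + move=> x _; rewrite -EFinD lee_fin.
      have [x0|x0] := leP 0 x; first by rewrite ger0_norm// lerDl expR_ge0.
      by rewrite ltr0_norm// mulrN mulNr lerDr expR_ge0.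
  rewrite ge0_integralD//=.
  + rewrite !normal_mgf// -EFinD lee_fin [leRHS]mulr_natl [leRHS]mulr2n lerD// ler_expR.
    * have : k * m <= k * (3 * M).
        by rewrite ler_wpM2l// (le_trans (ler_norm _)).
      have : k ^+ 2 * s ^+ 2 <= k ^+ 2 * (2 * M ^+ 2).
        by rewrite ler_wpM2l// sqr_ge0.
      lra.
    * have : k * - m <= k * (3 * M).
        by rewrite ler_wpM2l// (le_trans (ler_norm _))// normrN.
      have : k ^+ 2 * s ^+ 2 <= k ^+ 2 * (2 * M ^+ 2).
        by rewrite ler_wpM2l// sqr_ge0.
      rewrite sqrrN; lra.
Qed.

(** y^b <= e^(by), applied with y = |X| / M so that the bound scales like M^b. *)
Lemma gaussian_moment_le d (T : measurableType d) (P : probability T R)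
    (X : T -> R) (M b : R) :
  measurable_fun setT X -> gaussian P X -> 0 < M -> 0 <= b ->
  ((3 / 4)%:E <= P [set w | `|X w|%R <= M]%R)%E ->
  (\int[P]_w (`|X w| `^ b)%:E <=
   (M `^ b * (2 * expR (3 * b + b ^+ 2)))%:E)%E.
Proof.
move=> mX gX M0 b0 PM.
have mn : measurable_fun setT (fun w => `|X w|) by exact: measurableT_comp.
apply: (@le_trans _ _ (\int[P]_w ((M `^ b)%:E * (expR (b / M * `|X w|))%:E))%E).
  apply: ge0_le_integral => //.
  - apply/measurable_EFinP; apply: (measurableT_comp (measurable_powR _)) => //.
  - apply/measurable_EFinP; apply: measurable_funM => //.
    by apply: measurableT_comp => //; exact: measurable_funM.
  - move=> w _; rewrite -EFinM lee_fin.
    have -> : `|X w| = M * (M^-1 * `|X w|) by rewrite mulVKf// gt_eqF.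
    have y0 : 0 <= M^-1 * `|X w| by rewrite mulr_ge0// invr_ge0 ltW.
    rewrite powRM// ?(ltW M0)// ler_wpM2l ?powR_ge0//.
    rewrite mulVKf ?gt_eqF// -[b / M * _]mulrA.
    apply: (@le_trans _ _ (expR (M^-1 * `|X w|) `^ b)).
      apply: ge0_ler_powR => //; rewrite ?nnegrE ?expR_ge0//.
      by rewrite (le_trans _ (expR_ge1Dx _))// lerDr.
    by rewrite -expRM mulrC.
rewrite ge0_integralZl//.
- rewrite EFinM lee_wpmul2l ?lee_fin ?powR_ge0//.
  apply: (le_trans (gaussian_expR_le mX gX M0 _ PM)).
    by rewrite divr_ge0// ltW.
  rewrite lee_fin ler_wpM2l// ler_expR.
  suff -> : 3 * M * (b / M) + (b / M) ^+ 2 * M ^+ 2 = 3 * b + b ^+ 2 by [].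
  by field; rewrite gt_eqF.
- apply/measurable_EFinP.
  by apply: measurableT_comp => //; exact: measurable_funM.
- by rewrite lee_fin powR_ge0.
Qed.

End gaussian_moments.

(** * Integration tools *)

Section measure_tools.
Context d (T : measurableType d) (R : realType).
Variable mu : {measure set T -> \bar R}.
Local Open Scope ereal_scope.

Lemma limn_einf_le (u : (\bar R)^nat) (B : \bar R) :
  (\forall n \near \oo, u n <= B) -> limn_einf u <= B.
Proof.
move=> uB; rewrite limn_einf_lim; apply: lime_le; first exact: is_cvg_einfs.
by apply: filterS uB => n; apply: le_trans; apply: ereal_inf_lbound; exists n => /=.
Qed.

(** Fatou's lemma in the form in which it is used below: a bound that holds
    eventually along an a.e. convergent sequence passes to the limit. *)
Lemma fatou_le (Y_ : nat -> T -> R) (Y : T -> R) (B : \bar R) :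
  (forall n, measurable_fun setT (Y_ n)) -> measurable_fun setT Y ->
  (forall n w, (0 <= Y_ n w)%R) -> (forall w, (0 <= Y w)%R) ->
  {ae mu, forall w, Y_ n w @[n --> \oo] --> Y w} ->
  (\forall n \near \oo, \int[mu]_w (Y_ n w)%:E <= B) ->
  \int[mu]_w (Y w)%:E <= B.
Proof.
move=> mY_ mY Y_0 Y0 cvgY YB.
apply: (@le_trans _ _ (\int[mu]_w limn_einf (fun n => (Y_ n w)%:E))).
  apply: ae_ge0_le_integral => //.
  - by move=> w _; rewrite lee_fin.
  - exact/measurable_EFinP.
  - move=> w _; rewrite limn_einf_lim; apply: lime_ge; first exact: is_cvg_einfs.
    by apply: nearW => n; apply: le_ereal_inf_tmp => _ [m _ <-]; rewrite lee_fin.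
  - apply: (eq_measurable_fun (fun w => - limn_esup (fun n => - (Y_ n w)%:E))).
      by move=> w _; rewrite -limn_einfN; congr limn_einf; apply/funext => n /=; rewrite opprK.
    apply: measurableT_comp => //; apply: measurable_fun_limn_esup => n.
    by apply: measurableT_comp => //; exact/measurable_EFinP.
  - apply: filterS cvgY => w wY _.
    have wYE : (Y_ n w)%:E @[n --> \oo] --> (Y w)%:E.
      by apply: cvg_EFin => //; exact: nearW.
    by have [-> _] := cvg_limn_einf_sup wYE.
apply: le_trans (limn_einf_le YB).
by apply: fatou => // [n|n x _]; [exact/measurable_EFinP|rewrite lee_fin].
Qed.

(** The integral of a nonnegative function is a supremum over the simple functions
    below it, so it is monotone without measurability of the smaller function. This
    spares measurability proofs for the quantities that are to be estimated. *)
Lemma le_integral_outer (f g : T -> \bar R) :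
  (forall x, 0 <= f x) -> (forall x, 0 <= g x) -> measurable_fun setT g ->
  {ae mu, forall x, f x <= g x} -> \int[mu]_x f x <= \int[mu]_x g x.
Proof.
move=> f0 g0 mg [N [mN N0 fgN]].
have mI : measurable_fun setT (fun x => +oo * (\1_N x)%:E : \bar R).
  by apply: emeasurable_funM => //; exact/measurable_EFinP.
(* g' is +oo on the exceptional null set, so it dominates f everywhere and has
   the same integral as g *)
pose g' x := g x + +oo * (\1_N x)%:E.
have -> : \int[mu]_x g x = \int[mu]_x g' x.
  have h0 x : setT x -> 0 <= +oo * (\1_N x)%:E :> \bar R.
    by move=> _; rewrite mule_ge0// lee_fin.
  have mN1 : measurable_fun setT (fun x => (\1_N x)%:E : \bar R).
    exact/measurable_EFinP.
  rewrite ge0_integralD// ge0_integralZl// integral_indic// setIT N0 mule0.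
  by rewrite adde0.
rewrite !ge0_integralTE//; last first.
  by move=> x; rewrite adde_ge0// mule_ge0// lee_fin.
apply: ereal_sup_le => _ [h hf <-]; exists h => // x.
apply: (le_trans (hf x)); have [xN|xN] := boolP (x \in N).
  by rewrite /g' indicE xN mule1 addey ?leey// -ltNye (lt_le_trans _ (g0 x)).
rewrite /g' indicE (negbTE xN) mule0 adde0.
by apply: contrapT => fg; move/negP: xN; apply; rewrite inE; exact: fgN.
Qed.

End measure_tools.

Section probability_tools.
Context d (T : measurableType d) (R : realType) (P : probability T R).

(** Chebyshev's inequality, with the probability 3/4 from which [gaussian_expR_le]
    starts. *)
Lemma second_moment_tight (X : T -> R) (M : R) : measurable_fun setT X -> 0 < M ->
  (\int[P]_w (X w ^+ 2)%:E <= ((M / 2) ^+ 2)%:E)%E ->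
  ((3 / 4)%:E <= P [set w | `|X w|%R <= M]%R)%E.
Proof.
move=> mX M0 XM.
have mX2 : measurable_fun setT (fun w => (X w ^+ 2)%:E).
  by apply/measurable_EFinP; exact: measurable_funX.
have mA : measurable [set w | `|X w|%R <= M]%R.
  rewrite -[X in measurable X]setTI.
  have -> : [set w | (`|X w| <= M)%R] = X @^-1` `[- M, M].
    by apply/seteqP; split => w /=; rewrite in_itv/= ler_norml.
  exact: mX.
have M2 : (0 < M ^+ 2)%R by rewrite exprn_gt0.
have := le_integral_abse P measurableT mX2 M2; rewrite setTI => h.
have {}h : (P (~` [set w | `|X w|%R <= M]%R) <= (4^-1)%:E)%E.
  rewrite -(@lee_pmul2l _ (M ^+ 2)%:E)//.
  apply: (@le_trans _ _ (\int[P]_w (X w ^+ 2)%:E)%E).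
    apply: le_trans (_ : _ <= \int[P]_w `|(X w ^+ 2)%:E|)%E _; last first.
      by under eq_integral do rewrite gee0_abs ?lee_fin ?sqr_ge0//.
    apply: le_trans h; rewrite lee_pmul2l// le_measure ?inE//.
    - exact: measurableC.
    - by rewrite -[X in measurable X]setTI; apply: emeasurable_fun_c_infty => //; exact: measurableT_comp.
    - move=> w /= /negP; rewrite -ltNge => wM.
      rewrite lee_fin ger0_norm ?sqr_ge0// -[leRHS]real_normK ?num_real//.
      by rewrite ler_sqr ?nnegrE// ltW.
  apply: (le_trans XM); rewrite -EFinM lee_fin expr_div_n; lra.
rewrite probability_setC// in h.
rewrite -[X in (_ <= P X)%E]setCK probability_setC; last exact: measurableC.
rewrite -probability_setC// in h.
rewrite leeBrDr; last by rewrite ge0_fin_numE// (le_lt_trans h)// ltry.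
apply: (le_trans (leeD2l _ h)); rewrite -EFinD lee_fin; lra.
Qed.

(** For Gaussian laws, also with a nonzero mean, the second moment bounds the
    moments of every order with the right scaling. *)
Lemma gaussian_moment_le_second (X : T -> R) (v b : R) :
  measurable_fun setT X -> gaussian P X -> 0 < v -> 0 <= b ->
  (\int[P]_w (X w ^+ 2)%:E <= v%:E)%E ->
  (\int[P]_w (`|X w| `^ b)%:E <=
   (2 `^ b * v `^ (b / 2) * (2 * expR (3 * b + b ^+ 2)))%:E)%E.
Proof.
move=> mX gX v0 b0 Xv.
have M0 : 0 < 2 * Num.sqrt v by rewrite mulr_gt0// sqrtr_gt0.
have PM : ((3 / 4)%:E <= P [set w | `|X w|%R <= 2 * Num.sqrt v]%R)%E.
  apply: second_moment_tight => //; rewrite mulrAC divff// mul1r sqr_sqrtr//.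
  exact: ltW.
apply: (le_trans (gaussian_moment_le mX gX M0 b0 PM)).
rewrite powRM ?sqrtr_ge0// -powR12_sqrt ?(ltW v0)// -powRrM.
by rewrite [2^-1 * b]mulrC.
Qed.

End probability_tools.

(** * Grids and jointly measurable versions of a continuous field *)

Section grids.
Context {R : realType}.
Local Notation RT := (measurableTypeR R).
Implicit Types (L x : R) (n i : nat) (p : R * R).

Lemma cell_itv L n x : 0 < L -> (0 < n)%N -> 0 <= x <= L ->
  (cell L n x < n)%N /\
  ((cell L n x)%:R <= x * n%:R / L) && (x * n%:R / L <= (cell L n x).+1%:R).
Proof.
move=> L0 n0 /andP[x0 xL]; rewrite /cell; set y := x * n%:R / L.
have y0 : 0 <= y by rewrite divr_ge0 ?mulr_ge0// ltW.
have yn : y <= n%:R.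
  by rewrite ler_pdivrMr// mulrC ler_wpM2l.
have /andP[y1 y2] := truncn_itv y0.
have [h|h] := leqP (Num.truncn y) n.-1.
  rewrite y1 (ltW y2); split => //.
  by rewrite (leq_ltn_trans h)// prednK.
split; first by rewrite prednK.
have nt : (n <= Num.truncn y)%N by rewrite -(prednK n0).
rewrite prednK// yn andbT; apply: le_trans y1; rewrite ler_nat.
exact: leq_trans (leq_pred _) nt.
Qed.

Lemma node_itv L n i : 0 < L -> (0 < n)%N -> (i <= n)%N -> 0 <= node L n i <= L.
Proof.
move=> L0 n0 iN; rewrite /node divr_ge0 ?mulr_ge0 ?(ltW L0)//=.
by rewrite ler_pdivrMr ?ltr0n// mulrC ler_wpM2l ?(ltW L0)// ler_nat.
Qed.

Lemma node_cell_dist L n x : 0 < L -> (0 < n)%N -> 0 <= x <= L ->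
  `|x - node L n (cell L n x)| <= L / n%:R.
Proof.
move=> L0 n0 xL; have [_ /andP[c1 c2]] := cell_itv L0 n0 xL.
have nR : 0 < n%:R :> R by rewrite ltr0n.
have xE : x = (x * n%:R / L) * (L / n%:R) by field; rewrite !gt_eqF.
have Ln : 0 < L / n%:R by rewrite divr_gt0.
rewrite /node -mulrA {1}xE -mulrBl normrM (gtr0_norm Ln) ler_piMl// ?(ltW Ln)//.
by rewrite ger0_norm ?subr_ge0// lerBlDr addrC natr1.
Qed.

Lemma node_cellS_dist L n x : 0 < L -> (0 < n)%N -> 0 <= x <= L ->
  `|x - node L n (cell L n x).+1| <= L / n%:R.
Proof.
move=> L0 n0 xL; have [_ /andP[c1 c2]] := cell_itv L0 n0 xL.
have nR : 0 < n%:R :> R by rewrite ltr0n.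
have xE : x = (x * n%:R / L) * (L / n%:R) by field; rewrite !gt_eqF.
have Ln : 0 < L / n%:R by rewrite divr_gt0.
rewrite /node -mulrA {1}xE -mulrBl normrM (gtr0_norm Ln) ler_piMl// ?(ltW Ln)//.
by rewrite ler0_norm ?subr_le0// opprB -natr1; lra.
Qed.

Definition grid L n p : R * R :=
  (node L n (cell L n p.1), node L n (cell L n p.2)).

Lemma grid_csquare L n p : 0 < L -> (0 < n)%N -> csquare L p ->
  csquare L (grid L n p).
Proof.
move=> L0 n0 [p1 p2]; split; rewrite /= node_itv//.
- by have [/ltnW] := cell_itv L0 n0 p1.
- by have [/ltnW] := cell_itv L0 n0 p2.
Qed.

Lemma node_cell_cvg L x : 0 < L -> 0 <= x <= L ->
  node L n.+1 (cell L n.+1 x) @[n --> \oo] --> x.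
Proof.
move=> L0 xL; have h : (L * n.+1%:R^-1) @[n --> \oo] --> (0 : R).
  by rewrite -[0](mulr0 L); apply: cvgM; [exact: cvg_cst|exact: cvg_harmonic].
apply/cvgrPdist_le => e e0; move/cvgrPdist_le/(_ e e0): h.
apply: filterS => n /= h; apply: le_trans (node_cell_dist L0 _ xL) _ => //.
by rewrite (le_trans (ler_norm _))// -normrN -sub0r.
Qed.

Lemma grid_cvg (f : R * R -> R) L p : 0 < L ->
  {within csquare L, continuous f} -> csquare L p ->
  f (grid L n.+1 p) @[n --> \oo] --> f p.
Proof.
move=> L0 cf Lp; have [p1 p2] := Lp.
move/subspace_continuousP/(_ p Lp): cf => cf.
apply: (@cvg_comp _ _ _ (fun n => grid L n.+1 p) f _
  (within (csquare L) (nbhs p))) => // A wA.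
have gc := @cvg_pair _ _ _ _ _ _ eventually_filter (nbhs_filter p.1)
  (nbhs_filter p.2) _ _ (node_cell_cvg L0 p1) (node_cell_cvg L0 p2).
have gA : \forall n \near \oo, csquare L (grid L n.+1 p) -> A (grid L n.+1 p).
  exact: (gc _ wA).
change (\forall n \near \oo, A (grid L n.+1 p)).
by apply: filterS gA => n hn; apply: hn; exact: grid_csquare.
Qed.

Lemma measurable_csquare L : measurable (csquare L : set (RT * RT)).
Proof.
have -> : csquare L = `[0, L]%classic `*` `[0, L]%classic :> set (RT * RT).
  by apply/seteqP; split => p /=; rewrite !in_itv.
exact: measurableX.
Qed.

Lemma measurable_osquare L : measurable (osquare L : set (RT * RT)).
Proof.
have -> : osquare L = `]0, L[%classic `*` `]0, L[%classic :> set (RT * RT).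
  by apply/seteqP; split => p /=; rewrite !in_itv.
exact: measurableX.
Qed.

Lemma compact_csquare L : compact (csquare L).
Proof.
have -> : csquare L = `[0, L]%classic `*` `[0, L]%classic.
  by apply/seteqP; split => p /=; rewrite !in_itv.
by apply: compact_setX; exact: segment_compact.
Qed.

Lemma csquare_bounded (f : R * R -> R) L :
  {within csquare L, continuous f} ->
  exists2 M, 0 < M & forall p, csquare L p -> `|f p| <= M.
Proof.
move=> cf; have := continuous_compact cf (@compact_csquare L).
move=> /compact_bounded[M [_ Mf]].
exists (`|M| + 1) => [|p Lp]; first by rewrite ltr_wpDl.
by apply: (Mf (`|M| + 1)); [rewrite (le_lt_trans (ler_norm _))// ltrDl|exists p].
Qed.

Lemma measurable_truncn : measurable_fun setT (Num.truncn : RT -> nat).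
Proof.
move=> _ Y _; rewrite setTI.
have -> : Num.truncn @^-1` Y =
    \bigcup_(n in Y) (Num.truncn @^-1` [set n]) :> set RT.
  by apply/seteqP; split => [x Yx|x [n Yn /= xn]]; [exists (Num.truncn x)|rewrite /= xn].
apply: bigcup_measurable => n _.
have [->|n0] := eqVneq n 0%N.
  have -> : Num.truncn @^-1` [set 0%N] = `]-oo, 1[%classic :> set RT.
    apply/seteqP; split => x /=; rewrite in_itv/=.
      by move=> /truncn0Pn; rewrite -ltNge.
    by move=> x1; apply/truncn0Pn; rewrite -ltNge.
  exact: measurable_itv.
have -> : Num.truncn @^-1` [set n] = `[n%:R, n.+1%:R[%classic :> set RT.
  apply/seteqP; split => x /=; rewrite in_itv/=; last exact: truncn_def.
  move=> xn; have [x0|x0] := leP 0 x; first by rewrite -xn truncn_itv.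
  by move: n0; rewrite -xn truncn_floor leNgt x0.
exact: measurable_itv.
Qed.

Lemma measurable_cell L n : measurable_fun setT (cell L n : RT -> nat).
Proof.
have -> : cell L n = (fun m => minn m n.-1) \o Num.truncn \o
    (fun x : RT => x * (n%:R / L)) :> (RT -> nat).
  by apply/funext => x; rewrite /cell /= mulrA.
apply: measurableT_comp; last exact: measurable_funM.
by apply: measurableT_comp measurable_truncn.
Qed.

End grids.

(** Each preimage is a countable union over the values of N; this is how functions
    that are constant on grid cells are shown to be measurable. *)
Lemma measurable_fun_countable_index d1 d2 (Z : measurableType d1)
    (V : measurableType d2) (N : Z -> nat) (F : nat -> Z -> V) :
  measurable_fun setT N -> (forall n, measurable_fun setT (F n)) ->
  measurable_fun setT (fun z => F (N z) z).
Proof.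
move=> mN mF _ Y mY; rewrite setTI.
have -> : (fun z => F (N z) z) @^-1` Y =
    \bigcup_n ((N @^-1` [set n]) `&` (F n @^-1` Y)).
  by apply/seteqP; split => [z Yz|z [n _ [/= <-]]//]; exists (N z).
apply: bigcup_measurable => n _; apply: measurableI.
  by rewrite -[X in measurable X]setTI; exact: mN.
by rewrite -[X in measurable X]setTI; exact: mF.
Qed.

Section continuous_version.
Context {R : realType} d (T : measurableType d) (P : probability T R).
Local Notation RT := (measurableTypeR R).
Variables (L : R) (L0 : 0 < L) (W : R * R -> {RV P >-> R}).

Lemma measurable_grid_field n :
  measurable_fun setT (fun z : (RT * RT) * T => W (grid L n z.1) z.2).
Proof.
pose F i j (z : (RT * RT) * T) := W (node L n i, node L n j) z.2.
have mc1 : measurable_fun setT (fun z : (RT * RT) * T => cell L n z.1.1).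
  apply: measurableT_comp (@measurable_cell R L n) _.
  exact: measurableT_comp measurable_fst.
have mc2 : measurable_fun setT (fun z : (RT * RT) * T => cell L n z.1.2).
  apply: measurableT_comp (@measurable_cell R L n) _.
  exact: measurableT_comp measurable_fst.
apply: (@measurable_fun_countable_index _ _ _ _ _
  (fun i z => F i (cell L n z.1.2) z) mc1) => i.
apply: (@measurable_fun_countable_index _ _ _ _ _ (F i) mc2) => j.
exact: measurableT_comp.
Qed.

(** A modification of W that is jointly measurable in the point and the outcome: W
    itself is a family of random variables, whose paths are continuous only for
    outcomes in a set of full measure. *)
Definition version (Om : set T) (z : (RT * RT) * T) : R :=
  W z.1 z.2 * \1_(csquare L `*` Om) z.

Definition good_set (Om : set T) : Prop := [/\ measurable Om, P (~` Om) = 0%E &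
  forall w, Om w -> {within csquare L, continuous (fun p => W p w)}].

Lemma ex_good_set :
  {ae P, forall w, {within csquare L, continuous (fun p => W p w)}} ->
  exists Om, good_set Om.
Proof.
move=> [N [mN N0 sN]]; exists (~` N); split.
- exact: measurableC.
- by rewrite setCK.
- by move=> w Nw; apply: contrapT => h; apply: Nw; exact: sN.
Qed.

Variables (Om : set T) (gOm : good_set Om).

Lemma versionE p w : csquare L p -> Om w -> version Om (p, w) = W p w.
Proof.
move=> Lp Ow; rewrite /version indicE mem_set ?mulr1//.
Qed.

Lemma version_out p w : ~ csquare L p -> version Om (p, w) = 0.
Proof.
by move=> Lp; rewrite /version indicE memNset ?mulr0// => -[].
Qed.

Lemma version_out_Om p w : ~ Om w -> version Om (p, w) = 0.
Proof.
by move=> Lp; rewrite /version indicE memNset ?mulr0// => -[].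
Qed.

(** By continuity it is the limit of the fields frozen at the nodes of finer and
    finer grids. *)
Lemma measurable_version : measurable_fun setT (version Om).
Proof.
have [mO _ cO] := gOm.
have mI : measurable (csquare L `*` Om : set ((RT * RT) * T)).
  by apply: measurableX => //; exact: measurable_csquare.
apply: (@measurable_fun_cvg _ _ _ _
  (fun n z => W (grid L n.+1 z.1) z.2 * \1_(csquare L `*` Om) z)).
- move=> n; apply: measurable_funM; first exact: measurable_grid_field.
  exact: measurable_indic.
- move=> -[p w] _; rewrite /version indicE.
  have [|_] := boolP (_ \in _); last first.
    by rewrite !mulr0; under eq_fun do rewrite mulr0; exact: cvg_cst.
  rewrite inE => -[/= Lp Ow]; rewrite mulr1.
  under eq_fun do rewrite mulr1.
  by apply: (@grid_cvg _ (fun p => W p w)) => //; exact: cO.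
Qed.

Lemma version_continuous w : {within csquare L, continuous (fun p => version Om (p, w))}.
Proof.
have [mO _ cO] := gOm.
have [Ow|Ow] := pselect (Om w).
  apply: subspace_eq_continuous (cO w Ow) => p; rewrite inE => Lp.
  exact/esym/versionE.
have c0 : {within csquare L, continuous (fun _ : R * R => 0 : R)}.
  by apply: continuous_subspaceT; exact: cst_continuous.
by apply: subspace_eq_continuous c0 => p _; exact/esym/version_out_Om.
Qed.

End continuous_version.

Section tightness.
Context {R : realType} d (T : measurableType d) (P : probability T R).
Variables (L : R) (L0 : 0 < L) (W : R * R -> {RV P >-> R}).

Lemma measurable_normr_le (X : T -> R) (c : R) : measurable_fun setT X ->
  measurable [set w | `|X w| <= c].
Proof.
move=> mX; have -> : [set w | `|X w| <= c] = setT `&` X @^-1` `[- c, c].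
  by rewrite setTI; apply/seteqP; split => w /=; rewrite in_itv/= ler_norml.
exact: mX.
Qed.

(** A continuous path is bounded on the square, so the events on which the values at
    all grid nodes are at most n exhaust the probability space; one of them has
    probability above 3/4, and density of the nodes extends the bound to every p. *)
Lemma field_tight :
  {ae P, forall w, {within csquare L, continuous (fun p => W p w)}} ->
  exists2 M, 0 < M & forall p, csquare L p ->
    ((3 / 4)%:E <= P [set w | `|W p w|%R <= M]%R)%E.
Proof.
move=> /ex_good_set[Om [mO O0 cO]].
pose pt k i j := (node L k.+1 (minn i k.+1), node L k.+1 (minn j k.+1)).
(* minn keeps the node inside the square for every pair of indices *)
pose E n := Om `&` \bigcap_k \bigcap_i \bigcap_j
  [set w | `|W (pt k i j) w| <= n%:R].
have ptL k i j : csquare L (pt k i j).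
  by split; rewrite /= node_itv// geq_minr.
have mE n : measurable (E n).
  apply: measurableI => //; apply: bigcapT_measurable => k.
  apply: bigcapT_measurable => i; apply: bigcapT_measurable => j.
  exact: measurable_normr_le.
have EO : \bigcup_n E n = Om.
  apply/seteqP; split => [w [n _ []]//|w Ow].
  have [M M0 WM] := csquare_bounded (cO w Ow).
  exists (Num.truncn M).+1 => //; split => // k _ i _ j _ /=.
  by rewrite (le_trans (WM _ _))// ltW// truncnS_gt.
have ndE : nondecreasing_seq E.
  move=> m n mn; apply/subsetPset => w [Ow Ew]; split => // k _ i _ j _.
  by rewrite /= (le_trans (Ew k _ i _ j _))// ler_nat.
have PO : P Om = 1%E.
  by rewrite -(setCK Om) probability_setC ?O0 ?sube0//; exact: measurableC.
have := nondecreasing_cvg_mu mE (bigcupT_measurable _ mE) ndE.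
rewrite EO => cvgE0.
have cvgE : P (E n) @[n --> \oo] --> 1%E by rewrite -PO; exact: cvgE0.
have [n PEn] : exists n, ((3 / 4)%:E < P (E n))%E.
  apply: contrapT => h; suff : (1 <= (3 / 4 : R)%:E)%E by rewrite lee_fin; lra.
  rewrite -(cvg_lim _ cvgE)//; apply: lime_le; first by apply/cvg_ex; exists 1%E.
  by apply: nearW => n; rewrite leNgt; apply/negP => ?; apply: h; exists n.
exists (n%:R + 1) => [|p Lp]; first by rewrite ltr_wpDl.
apply: (le_trans (ltW PEn)); rewrite le_measure ?inE//.
  exact: measurable_normr_le.
move=> w [Ow Ew] /=; apply: (@le_trans _ _ n%:R); last by rewrite lerDl.
have cW : `|W (grid L k.+1 p) w| @[k --> \oo] --> `|W p w|.
  by apply: cvg_norm; apply: (@grid_cvg _ (fun p => W p w)) => //; exact: cO.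
rewrite -(cvg_lim _ cW)//; apply: limr_le; first by apply/cvg_ex; eexists; exact: cW.
apply: nearW => k; have [p1 p2] := Lp.
have [c1 _] := cell_itv L0 (ltn0Sn k) p1.
have [c2 _] := cell_itv L0 (ltn0Sn k) p2.
have := Ew k I (cell L k.+1 p.1) I (cell L k.+1 p.2) I.
by rewrite /= /pt !(minn_idPl _) // ltnW.
Qed.

End tightness.

(** * Pairings of a random field with square integrable functions *)

Section square_integrable.
Context d (X : measurableType d) (R : realType) (mu : {measure set X -> \bar R}).
Local Open Scope ereal_scope.

Definition sq_int (f : X -> R) : Prop :=
  measurable_fun setT f /\ \int[mu]_x ((f x) ^+ 2)%:E < +oo.

Lemma Lnorm2E (f : X -> R) :
  'N[mu]_2%:E[EFin \o f] `^ 2 = \int[mu]_x ((f x) ^+ 2)%:E.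
Proof.
rewrite poweR_Lnorm//; apply: eq_integral => x _ /=.
by rewrite powR_mulrn// real_normK// num_real.
Qed.

Lemma sq_int_Lnorm (f : X -> R) : sq_int f -> 'N[mu]_2%:E[EFin \o f] < +oo.
Proof.
move=> [_]; rewrite -Lnorm2E; apply: lty_poweRy; by rewrite pnatr_eq0.
Qed.

Lemma Lnorm_sq_int (f : X -> R) : measurable_fun setT f ->
  'N[mu]_2%:E[EFin \o f] < +oo -> sq_int f.
Proof. by move=> mf f2; split => //; rewrite -Lnorm2E poweR_lty. Qed.

Lemma cauchy_schwarz (f g : X -> R) : measurable_fun setT f ->
  measurable_fun setT g -> \int[mu]_x `|(f x * g x)%:E| <=
  'N[mu]_2%:E[EFin \o f] * 'N[mu]_2%:E[EFin \o g].
Proof.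
move=> mf mg; have := hoelder mu mf mg (ltr0n _ 2) (ltr0n _ 2).
by rewrite Lnorm1; apply; field.
Qed.

Lemma sq_int_integrableM (f g : X -> R) : sq_int f -> sq_int g ->
  mu.-integrable setT (fun x => (f x * g x)%:E).
Proof.
move=> sf sg; have [mf _] := sf; have [mg _] := sg; apply/integrableP; split.
  by apply/measurable_EFinP; exact: measurable_funM.
apply: (le_lt_trans (cauchy_schwarz mf mg)).
have fN := sq_int_Lnorm sf.
apply: lte_mul_pinfty; rewrite ?Lnorm_ge0//; last exact: sq_int_Lnorm.
by rewrite ge0_fin_numE ?Lnorm_ge0.
Qed.

Lemma cauchy_schwarz_sq (f g : X -> R) : sq_int f -> sq_int g ->
  ((fine (\int[mu]_x (f x * g x)%:E)) ^+ 2)%:E <=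
  \int[mu]_x ((f x) ^+ 2)%:E * \int[mu]_x ((g x) ^+ 2)%:E.
Proof.
move=> sf sg; have [mf _] := sf; have [mg _] := sg.
have ifg := sq_int_integrableM sf sg.
have ffin := integrable_fin_num measurableT ifg.
rewrite -!Lnorm2E -poweRM ?Lnorm_ge0// -real_normK ?num_real//.
rewrite -powR_mulrn// -poweR_EFin.
apply: gt0_ler_poweR => //.
- by rewrite in_itv/= lee_fin leey normr_ge0.
- by rewrite in_itv/= leey mule_ge0// Lnorm_ge0.
apply: le_trans (cauchy_schwarz mf mg).
rewrite -fine_abse// fineK ?abse_fin_num//.
by apply: le_abse_integral => //; exact: measurable_int ifg.
Qed.

Lemma sq_intD (f g : X -> R) : sq_int f -> sq_int g ->
  sq_int (fun x => f x + g x)%R.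
Proof.
move=> [mf f2] [mg g2]; split; first exact: measurable_funD.
have mf2 : measurable_fun setT (fun x => ((f x) ^+ 2)%:E).
  by apply/measurable_EFinP; exact: measurable_funX.
have mg2 : measurable_fun setT (fun x => ((g x) ^+ 2)%:E).
  by apply/measurable_EFinP; exact: measurable_funX.
have f20 x : setT x -> 0 <= ((f x) ^+ 2)%:E by rewrite lee_fin sqr_ge0.
have g20 x : setT x -> 0 <= ((g x) ^+ 2)%:E by rewrite lee_fin sqr_ge0.
apply: (@le_lt_trans _ _
    (\int[mu]_x (2%:E * (((f x) ^+ 2)%:E + ((g x) ^+ 2)%:E)))).
  apply: ge0_le_integral => //.
  - by move=> x _; rewrite lee_fin sqr_ge0.
  - by apply/measurable_EFinP; apply: measurable_funX; exact: measurable_funD.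
  - by apply: emeasurable_funM => //; exact: emeasurable_funD.
  - move=> x _; rewrite -EFinD -EFinM lee_fin.
    have := sqr_ge0 (f x - g x)%R; nra.
rewrite ge0_integralZl//.
- by rewrite ge0_integralD// lte_mul_pinfty// lte_add_pinfty.
- exact: emeasurable_funD.
- by move=> x _; rewrite adde_ge0 ?f20 ?g20.
Qed.

Lemma sq_intZ (c : R) (f : X -> R) : sq_int f -> sq_int (fun x => c * f x)%R.
Proof.
move=> [mf f2]; split; first exact: measurable_funM.
under eq_integral do rewrite exprMn EFinM.
rewrite ge0_integralZl//.
- rewrite lte_mul_pinfty// lee_fin sqr_ge0//.
- by apply/measurable_EFinP; exact: measurable_funX.
- by move=> x _; rewrite lee_fin sqr_ge0.
- by rewrite lee_fin sqr_ge0.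
Qed.

Lemma sq_int_sum (c : nat -> R) (f : nat -> X -> R) n :
  (forall i, sq_int (f i)) -> sq_int (fun x => \sum_(i < n) c i * f i x)%R.
Proof.
move=> sf; elim: n => [|n IHn].
  under eq_fun do rewrite big_ord0; split; first exact: measurable_cst.
  by under eq_integral do rewrite expr0n; rewrite integral0.
by under eq_fun do rewrite big_ord_recr/=; apply: sq_intD => //; exact: sq_intZ.
Qed.

Lemma sq_int_indic (S : set X) : measurable S -> mu S < +oo ->
  sq_int (\1_S : X -> R).
Proof.
move=> mS muS; split; first exact: measurable_indic.
have E x : ((\1_S x : R) ^+ 2 = \1_S x)%R.
  by rewrite indicE; case: (_ \in _); rewrite ?expr1n ?expr0n.
by under eq_integral do rewrite E; rewrite integral_indic// setIT.
Qed.

End square_integrable.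

Lemma mule_le_sq (R : realType) (a b : \bar R) : (0 <= a -> 0 <= b ->
  a * b <= a * a + b * b)%E.
Proof.
case: a b => [a| |] [b| |] // a0 b0.
- rewrite -!EFinM -EFinD lee_fin; rewrite !lee_fin in a0 b0.
  have := sqr_ge0 (a - b); have := mulr_ge0 a0 b0; nra.
- by rewrite [(+oo * +oo)%E]mulyy addey ?leey.
- by rewrite [(+oo * +oo)%E]mulyy addye ?leey.
Qed.

Section random_integrals.
Context dX (X : measurableType dX) d (T : measurableType d) (R : realType).
Variables (mu : {sigma_finite_measure set X -> \bar R}) (P : probability T R).
Variables (S : set X) (mS : measurable S) (muS : (mu S < +oo)%E).
Variables (Z : X * T -> R) (mZ : measurable_fun setT Z).
Hypothesis Z0 : forall p w, ~ S p -> Z (p, w) = 0.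
Variables (M : R).
Hypothesis Z2 : forall p, (\int[P]_w (Z (p, w) ^+ 2)%:E <= M%:E)%E.
Hypothesis Zb : forall w, exists c : R, forall p, `|Z (p, w)| <= c.
Local Open Scope ereal_scope.

Let nZ w := 'N[mu]_2%:E[EFin \o (fun p => Z (p, w))].

Definition pairing (h : X -> R) (w : T) : R :=
  fine (\int[mu]_p (Z (p, w) * h p)%:E).

Definition second_moment (p p' : X) : R :=
  fine (\int[P]_w (Z (p, w) * Z (p', w))%:E).

Lemma Lnorm2_mul (f : X -> R) :
  'N[mu]_2%:E[EFin \o f] * 'N[mu]_2%:E[EFin \o f] = \int[mu]_x ((f x) ^+ 2)%:E.
Proof.
rewrite -Lnorm2E; have := Lnorm_ge0 mu 2%:E (EFin \o f).
case: ('N[mu]_2%:E[_]) => [r| |]// r0.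
- by rewrite poweR_EFin powR_mulrn// -EFinM -expr2.
- by rewrite mulyy poweRyr ?pnatr_eq0.
Qed.

Let mZp p : measurable_fun setT (fun w => Z (p, w)).
Proof. exact: (measurable_fun_pair2 p mZ). Qed.

Let mZw w : measurable_fun setT (fun p => Z (p, w)).
Proof. exact: (measurable_fun_pair1 w mZ). Qed.

Let mZsq : measurable_fun setT (fun z => (Z z ^+ 2)%:E).
Proof. by apply/measurable_EFinP; exact: measurable_funX. Qed.

Let sZp p : sq_int P (fun w => Z (p, w)).
Proof. by split => //; apply: le_lt_trans (Z2 p) _; rewrite ltry. Qed.

Let sZw w : sq_int mu (fun p => Z (p, w)).
Proof.
split => //; have [c Zc] := Zb w.
apply: (@le_lt_trans _ _ (\int[mu]_p ((c ^+ 2)%:E * (\1_S p)%:E))).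
  apply: ge0_le_integral => //.
  - by move=> p _; rewrite lee_fin sqr_ge0.
  - by apply/measurable_EFinP; exact: measurable_funX.
  - by apply: emeasurable_funM => //; apply/measurable_EFinP; exact: measurable_indic.
  - move=> p _; rewrite -EFinM lee_fin indicE.
    have [_|/negP] := boolP (p \in S); last first.
      by rewrite inE => /(Z0 w) ->; rewrite expr0n mulr0.
    rewrite mulr1 -[leLHS]real_normK ?num_real// ler_sqr ?nnegrE//.
    by rewrite (le_trans _ (Zc p)).
rewrite ge0_integralZl//.
- rewrite integral_indic// setIT lte_mul_pinfty// lee_fin sqr_ge0//.
- by apply/measurable_EFinP; exact: measurable_indic.
- by rewrite lee_fin sqr_ge0.
Qed.

Let nZ0 w : 0 <= nZ w. Proof. exact: Lnorm_ge0. Qed.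

Let nZ_fin w : nZ w \is a fin_num.
Proof. by rewrite ge0_fin_numE//; exact: sq_int_Lnorm. Qed.

Let mnZ2 : measurable_fun setT (fun w => \int[mu]_p (Z (p, w) ^+ 2)%:E).
Proof.
apply: (measurable_fun_fubini_tonelli_G (fun z => (Z z ^+ 2)%:E)) => //.
by move=> z; rewrite lee_fin sqr_ge0.
Qed.

Let mnZ : measurable_fun setT nZ.
Proof.
have -> : nZ = (fun w => (\int[mu]_p (Z (p, w) ^+ 2)%:E) `^ 2^-1).
  by apply/funext => w; rewrite -Lnorm2E -poweRrM mulfV ?poweRe1// Lnorm_ge0.
exact: (measurableT_comp (measurable_poweR _) mnZ2).
Qed.

Let int_nZ2 : \int[P]_w (nZ w * nZ w) < +oo.
Proof.
under eq_integral do rewrite /nZ Lnorm2_mul.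
rewrite -(fubini_tonelli (fun z => (Z z ^+ 2)%:E))//; last first.
  by move=> z; rewrite lee_fin sqr_ge0.
apply: (@le_lt_trans _ _ (\int[mu]_p (M%:E * (\1_S p)%:E))).
  apply: ge0_le_integral => //.
  - by move=> p _; apply: integral_ge0 => w _; rewrite lee_fin sqr_ge0.
  - apply: (measurable_fun_fubini_tonelli_F (fun z => (Z z ^+ 2)%:E)) => //.
    by move=> z; rewrite lee_fin sqr_ge0.
  - by apply: emeasurable_funM => //; apply/measurable_EFinP; exact: measurable_indic.
  - move=> p _; rewrite indicE; have [_|/negP] := boolP (p \in S).
      by rewrite mule1.
    rewrite inE => Sp; under eq_integral do rewrite Z0// expr0n.
    by rewrite integral0 mule0.
have [[p Sp]|S0] := pselect (exists p, S p).
  have M0 : 0 <= M%:E.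
    by apply: le_trans (Z2 p); apply: integral_ge0 => w _; rewrite lee_fin sqr_ge0.
  rewrite ge0_integralZl//.
  - by rewrite integral_indic// setIT lte_mul_pinfty.
  - by apply/measurable_EFinP; exact: measurable_indic.
rewrite integral0_eq ?ltry// => p _; rewrite indicE memNset ?mule0//.
by move=> Sp; apply: S0; exists p.
Qed.

Let int_nZ : \int[P]_w nZ w < +oo.
Proof.
apply: (@le_lt_trans _ _ (\int[P]_w (1 + nZ w * nZ w))).
  apply: ge0_le_integral => //.
  - by apply: emeasurable_funD => //; exact: emeasurable_funM.
  - by move=> w _; rewrite -{1}[nZ w]mul1e -[X in _ <= X + _]mule1 mule_le_sq.
rewrite ge0_integralD//.
- rewrite lte_add_pinfty// (_ : \int[P]_w 1 = 1) ?ltry//.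
  by rewrite integral_cst// mul1e; exact: probability_setT.
- by move=> w _; rewrite mule_ge0.
- exact: emeasurable_funM.
Qed.

(** Cauchy-Schwarz in the space variable; it justifies the exchange of integrals in
    [integral_weighted]. *)
Lemma integrable_weighted (h : X -> R) (U : T -> R) :
  sq_int mu h -> measurable_fun setT U ->
  \int[P]_w (`|U w|%:E * nZ w) < +oo ->
  (mu \x P).-integrable setT (fun z => (Z z * h z.1 * U z.2)%:E).
Proof.
move=> sh mU iU; have [mh h2] := sh.
apply/integrable21ltyP.
  apply/measurable_EFinP; apply: measurable_funM.
    by apply: measurable_funM => //; exact: measurableT_comp.
  exact: measurableT_comp.
have mUn : measurable_fun setT (fun w => `|U w|%:E * nZ w).
  by apply: emeasurable_funM => //; apply/measurable_EFinP; exact: measurableT_comp.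
have U0 w : 0 <= `|U w|%:E * nZ w by rewrite mule_ge0// lee_fin.
apply: (@le_lt_trans _ _
    (\int[P]_w ('N[mu]_2%:E[EFin \o h] * (`|U w|%:E * nZ w)))).
  apply: le_integral_outer.
  - by move=> w; apply: integral_ge0 => p _.
  - by move=> w; rewrite mule_ge0// Lnorm_ge0.
  - exact: emeasurable_funM.
  - apply: aeW => w /=.
    under eq_integral do rewrite normrM EFinM muleC.
    rewrite ge0_integralZl//; last first.
      apply/measurable_EFinP; apply: measurableT_comp => //.
      exact: measurable_funM.
    rewrite muleCA lee_wpmul2l// muleC.
    by apply: cauchy_schwarz.
rewrite ge0_integralZl// ?Lnorm_ge0// lte_mul_pinfty ?Lnorm_ge0//.
by rewrite ge0_fin_numE ?Lnorm_ge0// sq_int_Lnorm.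
Qed.

Lemma measurable_pairing h : sq_int mu h -> measurable_fun setT (pairing h).
Proof.
move=> sh; apply: measurableT_comp => //.
have /measurable_fubini_G : (mu \x P).-integrable setT
    (fun z => (Z z * h z.1 * cst 1%R z.2)%:E).
  apply: integrable_weighted => //.
  by under eq_integral do rewrite normr1 mul1e.
apply: eq_measurable_fun => w _; rewrite /fubini_G /=.
by apply: eq_integral => p _; rewrite mulr1.
Qed.

Lemma pairing_le h w : sq_int mu h ->
  `|pairing h w|%:E <= nZ w * 'N[mu]_2%:E[EFin \o h].
Proof.
move=> sh; have ih := sq_int_integrableM (sZw w) sh.
rewrite -fine_abse ?fineK ?abse_fin_num ?(integrable_fin_num _ ih)//.
apply: (le_trans (le_abse_integral _ measurableT _)).
  exact: measurable_int ih.
by apply: cauchy_schwarz => //; case: sh.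
Qed.

Lemma sq_int_pairing h : sq_int mu h -> sq_int P (pairing h).
Proof.
move=> sh; split; first exact: measurable_pairing.
have [_ h2] := sh.
apply: (@le_lt_trans _ _ (\int[P]_w ((\int[mu]_x (h x ^+ 2)%:E) * (nZ w * nZ w)))).
  apply: ge0_le_integral => //.
  - by move=> w _; rewrite lee_fin sqr_ge0.
  - by apply/measurable_EFinP; apply: measurable_funX; exact: measurable_pairing.
  - by apply: emeasurable_funM => //; exact: emeasurable_funM.
  - by move=> w _; rewrite /nZ Lnorm2_mul muleC; exact: cauchy_schwarz_sq.
rewrite ge0_integralZl//.
- rewrite lte_mul_pinfty//; last first.
    by rewrite ge0_fin_numE//; apply: integral_ge0 => x _; rewrite lee_fin sqr_ge0.
  by apply: integral_ge0 => x _; rewrite lee_fin sqr_ge0.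
- exact: emeasurable_funM.
- by move=> w _; rewrite mule_ge0.
- by apply: integral_ge0 => x _; rewrite lee_fin sqr_ge0.
Qed.
Let int_UnZ (U : T -> R) : sq_int P U -> \int[P]_w (`|U w|%:E * nZ w) < +oo.
Proof.
move=> [mU U2]; apply: (@le_lt_trans _ _ (\int[P]_w ((U w ^+ 2)%:E + nZ w * nZ w))).
  apply: ge0_le_integral => //.
  - by move=> w _; rewrite mule_ge0.
  - by apply: emeasurable_funM => //; apply/measurable_EFinP; exact: measurableT_comp.
  - apply: emeasurable_funD; last exact: emeasurable_funM.
    by apply/measurable_EFinP; exact: measurable_funX.
  - move=> w _; rewrite -real_normK ?num_real// expr2 EFinM.
    by apply: mule_le_sq.
rewrite ge0_integralD//.
- exact: lte_add_pinfty.
- by move=> w _; rewrite lee_fin sqr_ge0.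
- by apply/measurable_EFinP; exact: measurable_funX.
- by move=> w _; rewrite mule_ge0.
- exact: emeasurable_funM.
Qed.

(** Fubini: an expectation of pairings is an integral of expectations. Applied twice
    it expresses the covariance of two pairings by the covariance kernel. *)
Let integral_weighted (h : X -> R) (U : T -> R) : sq_int mu h -> sq_int P U ->
  \int[P]_w (pairing h w * U w)%:E =
  \int[mu]_p ((h p)%:E * \int[P]_w (Z (p, w) * U w)%:E).
Proof.
move=> sh sU; have [mU _] := sU.
have iF := integrable_weighted sh mU (int_UnZ sU).
transitivity (\int[P]_w \int[mu]_p (Z (p, w) * h p * U w)%:E).
  apply: eq_integral => w _.
  have ih := sq_int_integrableM (sZw w) sh.
  under eq_integral do rewrite EFinM.
  rewrite integralZr// EFinM /pairing fineK//.
  exact: integrable_fin_num ih.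
rewrite -(Fubini iF); apply: eq_integral => p _.
rewrite -integralZl//; last exact: sq_int_integrableM.
by apply: eq_integral => w _; rewrite -EFinM /= mulrAC mulrC.
Qed.

Lemma pairing_second_moment (p : X) (k : X -> R) : sq_int mu k ->
  \int[P]_w (Z (p, w) * pairing k w)%:E =
  \int[mu]_p' (second_moment p p' * k p')%:E.
Proof.
move=> sk; under eq_integral do rewrite mulrC.
rewrite integral_weighted//; apply: eq_integral => p' _.
rewrite mulrC EFinM /second_moment fineK; last first.
  exact: (integrable_fin_num _ (sq_int_integrableM (sZp p) (sZp p'))).
by congr (_ * _); apply: eq_integral => w _; rewrite mulrC.
Qed.

Lemma pairing_covariance (h k : X -> R) : sq_int mu h -> sq_int mu k ->
  \int[P]_w (pairing h w * pairing k w)%:E =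
  \int[mu]_p ((h p)%:E * \int[mu]_p' (second_moment p p' * k p')%:E).
Proof.
move=> sh sk; rewrite integral_weighted//; last exact: sq_int_pairing.
by apply: eq_integral => p _; rewrite pairing_second_moment.
Qed.

Section eigenbasis.
Variables (e : nat -> X -> R) (lam : nat -> R).
Hypothesis e_sq : forall i, sq_int mu (e i).
Hypothesis e0 : forall i p, ~ S p -> e i p = 0%R.
Hypothesis e_orth : forall i j, \int[mu]_p (e i p * e j p)%:E = ((i == j)%:R)%:E.
Hypothesis e_eig : forall i, {ae mu, forall p, S p ->
  fine (\int[mu]_p' (second_moment p p' * e i p')%:E) = (lam i * e i p)%R}.

(** The coordinates of the field in the eigenbasis are uncorrelated, with the
    eigenvalues as variances. *)
Lemma pairing_eigen i j :
  \int[P]_w (pairing (e i) w * pairing (e j) w)%:E = (lam j * (i == j)%:R)%:E.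
Proof.
have ie := sq_int_integrableM (e_sq i) (e_sq j).
rewrite pairing_covariance// EFinM -e_orth -integralZl//.
apply: ae_eq_integral => //.
- pose F p := \int[P]_w (Z (p, w) * pairing (e j) w)%:E.
  apply: (@eq_measurable_fun _ _ _ _ _ (fun p => (e i p)%:E * F p)).
    by move=> p _; rewrite /F pairing_second_moment.
  apply: emeasurable_funM; first by apply/measurable_EFinP; case: (e_sq i).
  have sj := sq_int_pairing (e_sq j); have [mj _] := sj.
  have s1 := sq_int_indic mS muS.
  have := integrable_weighted s1 mj (int_UnZ sj).
  move=> /measurable_fubini_F; apply: eq_measurable_fun => p _.
  rewrite /fubini_F /F; apply: eq_integral => w _ /=.
  have [Sp|Sp] := pselect (S p); first by rewrite indicE mem_set// mulr1.
  by rewrite Z0// !mul0r.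
- suff /measurable_int : mu.-integrable setT
      (fun p => (lam j)%:E * (e i p * e j p)%:E) by [].
  exact: integrableZl.
- apply: filterS (e_eig j) => p ep _.
  have [Sp|Sp] := pselect (S p); last by rewrite !e0// mul0r mul0e mule0.
  have fin : \int[mu]_p' (second_moment p p' * e j p')%:E \is a fin_num.
    rewrite -pairing_second_moment//.
    apply: (integrable_fin_num _ (sq_int_integrableM (sZp p) (sq_int_pairing _))) => //.
  by rewrite -(fineK fin) ep// -!EFinM mulrCA.
Qed.

Lemma eigenvalue_ge0 i : (0 <= lam i)%R.
Proof.
have := pairing_eigen i i; rewrite eqxx mulr1 => h.
rewrite -lee_fin -h; apply: integral_ge0 => w _.
by rewrite lee_fin -expr2 sqr_ge0.
Qed.

Lemma pairing_sum (c : nat -> R) n w :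
  pairing (fun p => \sum_(i < n) c i * e i p)%R w =
  (\sum_(i < n) c i * pairing (e i) w)%R.
Proof.
have ie i := sq_int_integrableM (sZw w) (e_sq i).
rewrite /pairing.
have -> : \int[mu]_p (Z (p, w) * (\sum_(i < n) c i * e i p))%:E =
   \int[mu]_p (\sum_(i < n) (c i)%:E * (Z (p, w) * e i p)%:E).
  apply: eq_integral => p _; rewrite mulr_sumr -sumEFin.
  by apply: eq_bigr => i _; rewrite -EFinM mulrCA.
rewrite integral_sum//; last by move=> i; exact: integrableZl.
have fin i := integrable_fin_num measurableT (ie i).
under eq_bigr => i _ do rewrite integralZl// -(fineK (fin i)) -EFinM.
by rewrite sumEFin.
Qed.

Lemma pairing_sum_sq (c : nat -> R) n :
  \int[P]_w ((pairing (fun p => \sum_(i < n) c i * e i p)%R w) ^+ 2)%:E =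
  (\sum_(i < n) lam i * c i ^+ 2)%:E.
Proof.
have ie i j := sq_int_integrableM (sq_int_pairing (e_sq i)) (sq_int_pairing (e_sq j)).
transitivity (\int[P]_w (\sum_(i < n) \sum_(j < n)
    (c i * c j)%:E * (pairing (e i) w * pairing (e j) w)%:E)).
  apply: eq_integral => w _; rewrite pairing_sum expr2 mulr_suml -sumEFin.
  apply: eq_bigr => i _; rewrite mulr_sumr -sumEFin.
  by apply: eq_bigr => j _; rewrite -EFinM mulrACA.
rewrite integral_sum//; last first.
  by move=> i; apply: integrable_sum => // j _; exact: integrableZl.
rewrite -sumEFin; apply: eq_bigr => i _.
rewrite integral_sum//; last by move=> j; exact: integrableZl.
rewrite (bigD1 i)//= big1 => [|j ji]; rewrite integralZl// pairing_eigen.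
  by rewrite eqxx addr0 mulr1 -EFinM mulrC expr2.
rewrite (_ : (i == j :> nat) = false) ?mulr0 ?mule0//.
by apply/negbTE; rewrite eq_sym.
Qed.

(** Weak form of the Karhunen-Loeve expansion. For finite combinations of the e i the
    second moment of the pairing is the spectral sum ([pairing_sum_sq]); for general
    h the pairings converge for each outcome, by Cauchy-Schwarz, and Fatou's lemma
    applies. *)
Lemma pairing_sq_le (h : X -> R) (c : nat -> R) (B : R) : sq_int mu h ->
  'N[mu]_2%:E[EFin \o (fun p => h p - \sum_(i < n) c i * e i p)%R]
    @[n --> \oo] --> 0 ->
  (forall n, (\sum_(i < n) lam i * c i ^+ 2 <= B)%R) ->
  \int[P]_w ((pairing h w) ^+ 2)%:E <= B%:E.
Proof.
move=> sh cvgh lamB.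
have s_sum n := sq_int_sum c n e_sq.
have mp k : sq_int mu k -> measurable_fun setT (pairing k) := @measurable_pairing k.
apply: (fatou_le (Y_ := fun n w =>
  ((pairing (fun p => \sum_(i < n) c i * e i p) w) ^+ 2)%R)).
- by move=> n; apply: measurable_funX; exact: mp.
- by apply: measurable_funX; exact: mp.
- by move=> n w; exact: sqr_ge0.
- by move=> w; exact: sqr_ge0.
- apply: aeW => w; pose h_ n p := (\sum_(i < n) c i * e i p)%R.
  pose r n := 'N[mu]_2%:E[EFin \o (fun p => h p - h_ n p)%R].
  have sr n : sq_int mu (fun p => h p - h_ n p)%R.
    have := sq_intD sh (sq_intZ (-1) (s_sum n)).
    by under eq_fun do rewrite mulN1r.
  have r0 : fine (r n) @[n --> \oo] --> (0%R : R) by exact: fine_cvg cvgh.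
  have {}r0 : (fine (nZ w) * fine (r n))%R @[n --> \oo] --> (0%R : R).
    by rewrite -[X in _ --> X](mulr0 (fine (nZ w))); apply: cvgM => //; exact: cvg_cst.
  suff : pairing (h_ n) w @[n --> \oo] --> pairing h w.
    by move=> hn; under eq_fun do rewrite expr2; rewrite expr2; exact: cvgM.
  apply/cvgrPdist_le => eps eps0; move/cvgrPdist_le/(_ eps eps0): r0.
  apply: filterS => n; rewrite sub0r normrN => hn.
  apply: le_trans (le_trans (ler_norm _) hn).
  have rfin : r n \is a fin_num by rewrite ge0_fin_numE ?Lnorm_ge0// sq_int_Lnorm.
  rewrite -lee_fin EFinM !fineK//; apply: le_trans (pairing_le w (sr n)).
  rewrite lee_fin.
  have ia := sq_int_integrableM (sZw w) sh.
  have ib := sq_int_integrableM (sZw w) (s_sum n).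
  have fa := integrable_fin_num measurableT ia.
  have fb := integrable_fin_num measurableT ib.
  rewrite /pairing -fineB// -integralB// le_eqVlt; apply/orP; left; apply/eqP.
  congr (`|fine _|)%R; apply: eq_integral => p _.
  by rewrite -EFinB mulrBr.
- by apply: nearW => n; rewrite pairing_sum_sq lee_fin.
Qed.

End eigenbasis.
End random_integrals.

(** * Averages over small squares *)

Section averages.
Context {R : realType}.
Local Notation RT := (measurableTypeR R).
Local Notation mu2 := (@lebesgue_measure R \x @lebesgue_measure R)%E.
Variables (L : R) (L0 : 0 < L).

(** A square of side del * L that stays inside (0, L)^2 for every p of the closed
    square: its position interpolates between the two ends, so that no case
    distinction is needed near the boundary. *)
Definition box (del : R) (p : R * R) : set (RT * RT) :=
  `]p.1 * (1 - del), p.1 * (1 - del) + del * L[%classic `*`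
  `]p.2 * (1 - del), p.2 * (1 - del) + del * L[%classic.

Lemma measurable_box (del : R) p : measurable (box del p).
Proof. exact: measurableX. Qed.

Lemma box_osquare (del : R) p : csquare L p -> 0 < del <= 1 -> box del p `<=` osquare L.
Proof.
move=> [/andP[p1 p1'] /andP[p2 p2']] /andP[d0 d1] z [/=]; rewrite !in_itv/=.
move=> /andP[z1 z1'] /andP[z2 z2']; split; apply/andP; split.
- by apply: le_lt_trans z1; rewrite mulr_ge0// subr_ge0.
- by apply: lt_le_trans z1' _; nra.
- by apply: le_lt_trans z2; rewrite mulr_ge0// subr_ge0.
- by apply: lt_le_trans z2' _; nra.
Qed.

Lemma osquare_csquare : osquare L `<=` csquare L.
Proof.
by move=> z [/andP[a b] /andP[c e]]; split; rewrite !ltW.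
Qed.

Lemma box_csquare (del : R) p : csquare L p -> 0 < del <= 1 -> box del p `<=` csquare L.
Proof.
by move=> Lp d01; apply: subset_trans osquare_csquare; exact: box_osquare.
Qed.

Lemma box_dist (del : R) p z : csquare L p -> 0 < del <= 1 -> box del p z ->
  `|p.1 - z.1| <= del * L /\ `|p.2 - z.2| <= del * L.
Proof.
move=> [/andP[p1 p1'] /andP[p2 p2']] /andP[d0 d1] [/=]; rewrite !in_itv/=.
move=> /andP[z1 z1'] /andP[z2 z2'].
by split; rewrite ler_norml; apply/andP; split; nra.
Qed.

Lemma box_measure (del : R) p : 0 < del -> mu2 (box del p) = ((del * L) ^+ 2)%:E.
Proof.
move=> d0; rewrite /box product_measure1E//= !lebesgue_measure_itv/=.
have dL : 0 < del * L by rewrite mulr_gt0.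
rewrite !lte_fin !ltrDl dL -!EFinD -EFinM; congr (_%:E).
by rewrite ![_ + del * L - _]addrAC !subrr !add0r expr2.
Qed.

Definition avg (del : R) (p : R * R) (f : R * R -> R) : R :=
  fine (\int[mu2]_(z in box del p) (f z)%:E)%E / (del * L) ^+ 2.

Section avg_bounds.
Variables (del : R) (p : R * R) (f : R * R -> R) (c : R).
Hypotheses (d0 : 0 < del)
  (intf : mu2.-integrable (box del p) (fun z => (f z)%:E)).

Let dL : 0 < (del * L) ^+ 2. Proof. by rewrite exprn_gt0// mulr_gt0. Qed.

Let intc : mu2.-integrable (box del p) (fun=> c%:E).
Proof.
apply/integrableP; split => //.
rewrite integral_cst; last exact: measurable_box.
by rewrite /= box_measure// -EFinM ltry.
Qed.

Lemma avg_le : (forall z, box del p z -> f z <= c) -> avg del p f <= c.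
Proof.
move=> fc; rewrite ler_pdivrMr// -lee_fin fineK; last first.
  by apply: integrable_fin_num intf; exact: measurable_box.
rewrite EFinM -(box_measure p d0) -integral_cst; last exact: measurable_box.
apply: le_integral => //; first exact: measurable_box.
by move=> z bz; rewrite lee_fin fc//; rewrite inE in bz.
Qed.

Lemma avg_ge : (forall z, box del p z -> c <= f z) -> c <= avg del p f.
Proof.
move=> fc; rewrite ler_pdivlMr// -lee_fin fineK; last first.
  by apply: integrable_fin_num intf; exact: measurable_box.
rewrite EFinM -(box_measure p d0) -integral_cst; last exact: measurable_box.
apply: le_integral => //; first exact: measurable_box.
by move=> z bz; rewrite lee_fin fc//; rewrite inE in bz.
Qed.

Lemma avg_norm_le : 0 <= c ->
  {ae mu2, forall z, box del p z -> `|f z| <= c} -> `|avg del p f| <= c.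
Proof.
move=> c0 fc; rewrite /avg normrM normfV (gtr0_norm dL) ler_pdivrMr//.
have mB := measurable_box del p.
rewrite -lee_fin -fine_abse ?(integrable_fin_num mB intf)//.
rewrite fineK ?abse_fin_num ?(integrable_fin_num mB intf)//.
have mf := measurable_int _ intf.
apply: (le_trans (le_abse_integral _ mB mf)).
rewrite EFinM -(box_measure p d0).
apply: le_trans (_ : _ <= \int[mu2]_(z in box del p) c%:E)%E _.
  by apply: ae_ge0_le_integral => //; exact: measurableT_comp.
by rewrite integral_cst.
Qed.

End avg_bounds.

Lemma measurable_continuous_csquare (f : R * R -> R) :
  {within csquare L, continuous f} ->
  measurable_fun (csquare L : set (RT * RT)) f.
Proof.
move=> cf; apply: (@measurable_fun_cvg _ _ _ _
  (fun n z => f (grid L n.+1 z))); last by move=> z Lz; exact: grid_cvg.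
move=> n; apply: measurable_funTS.
have mc1 : measurable_fun setT (fun z : RT * RT => cell L n.+1 z.1).
  exact: measurableT_comp (@measurable_cell R L n.+1) measurable_fst.
have mc2 : measurable_fun setT (fun z : RT * RT => cell L n.+1 z.2).
  exact: measurableT_comp (@measurable_cell R L n.+1) measurable_snd.
pose F i j (z : RT * RT) := f (node L n.+1 i, node L n.+1 j).
apply: (@measurable_fun_countable_index _ _ _ _ _
  (fun i z => F i (cell L n.+1 z.2) z) mc1) => i.
apply: (@measurable_fun_countable_index _ _ _ _ _ (F i) mc2) => j.
exact: measurable_cst.
Qed.

Lemma csquare_measure : mu2 (csquare L) = (L ^+ 2)%:E.
Proof.
have -> : csquare L = `[0, L]%classic `*` `[0, L]%classic :> set (RT * RT).
  by apply/seteqP; split => p /=; rewrite !in_itv.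
by rewrite product_measure1E//= !lebesgue_measure_itv/= lte_fin L0 -!EFinD -EFinM subr0 expr2.
Qed.

Lemma continuous_csquare_integrable (f : R * R -> R) :
  {within csquare L, continuous f} ->
  mu2.-integrable (csquare L) (fun z => (f z)%:E).
Proof.
move=> cf; apply: measurable_bounded_integrable.
- exact: measurable_csquare.
- by rewrite /= csquare_measure ltry.
- exact: measurable_continuous_csquare.
- have [M M0 fM] := csquare_bounded cf.
  by exists M; split; [rewrite num_real|move=> c Mc z Lz; apply: le_trans (fM z Lz) _; exact: ltW].
Qed.

Lemma avg_cvg (f : R * R -> R) p : {within csquare L, continuous f} ->
  csquare L p -> avg n.+1%:R^-1 p f @[n --> \oo] --> f p.
Proof.
move=> cf Lp; have intf := continuous_csquare_integrable cf.
have d01 n : 0 < (n.+1%:R^-1 : R) <= 1.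
  by rewrite invr_gt0 ltr0n invf_le1 ?ltr0n// ler1n.
move/subspace_continuousP/(_ p Lp)/cvgrPdist_le: cf => cf.
apply/cvgrPdist_le => eps eps0.
have [[A B] /= [Ap Bp] AB] := cf _ eps0.
have [a /= a0 aA] := Ap; have [b /= b0 bB] := Bp.
pose m := Num.min a b.
have m0 : 0 < m by rewrite lt_min a0 b0.
have h : (L * n.+1%:R^-1) @[n --> \oo] --> (0 : R).
  by rewrite -[0](mulr0 L); apply: cvgM; [exact: cvg_cst|exact: cvg_harmonic].
move/cvgrPdist_lt/(_ _ m0): h; apply: filterS => n /=.
rewrite sub0r normrN ger0_norm; last by rewrite mulr_ge0// ?invr_ge0 ltW.
rewrite mulrC lt_min => /andP[na nb].
have intb : mu2.-integrable (box n.+1%:R^-1 p) (fun z => (f z)%:E).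
  apply: integrableS intf; first exact: measurable_csquare.
    exact: measurable_box.
  exact: box_csquare.
have fz z : box n.+1%:R^-1 p z -> `|f p - f z| <= eps.
  move=> bz; have [z1 z2] := box_dist Lp (d01 n) bz.
  apply: (AB z); last exact: (box_csquare Lp (d01 n)).
  split; [apply: aA|apply: bB]; rewrite /ball/=; [exact: le_lt_trans na|exact: le_lt_trans nb].
have [d0 _] := andP (d01 n).
rewrite ler_norml; apply/andP; split.
  rewrite lerBrDl -lerBrDr opprK; apply: avg_le => // z /fz.
  by rewrite ler_norml => /andP[+ _]; lra.
rewrite lerBlDr -lerBlDl; apply: avg_ge => // z /fz.
by rewrite ler_norml => /andP[_]; lra.
Qed.

(** The value at p is the limit of averages over small squares near p, and these do
    not see null sets; it applies to continuous extensions up to the boundary. *)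
Lemma ae_bound_continuous (f : R * R -> R) (c : R) : 0 <= c ->
  {within csquare L, continuous f} ->
  {ae mu2, forall z, csquare L z -> `|f z| <= c} ->
  forall p, csquare L p -> `|f p| <= c.
Proof.
move=> c0 cf aef p Lp; have intf := continuous_csquare_integrable cf.
have d01 n : 0 < (n.+1%:R^-1 : R) <= 1.
  by rewrite invr_gt0 ltr0n invf_le1 ?ltr0n// ler1n.
have cvgf : `|avg n.+1%:R^-1 p f| @[n --> \oo] --> `|f p|.
  by apply: cvg_norm; exact: avg_cvg.
rewrite -(cvg_lim _ cvgf)//; apply: limr_le; first by apply/cvg_ex; eexists; exact: cvgf.
apply: nearW => n; have [d0 _] := andP (d01 n).
apply: avg_norm_le => //.
- apply: integrableS intf; [exact: measurable_csquare|exact: measurable_box|exact: box_csquare].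
- have [N [mN N0 sN]] := aef; exists N; split => // z /= h; apply: sN => h'.
  by apply: h => bz; apply: h'; exact: (box_csquare Lp (d01 n)).
Qed.

(** Mean value theorem along the two axis-parallel sides joining the points. *)
Lemma C1_lipschitz (u : R * R -> R) (du : R * R -> R * R) (c : R) :
  C1_gradient L u du -> (forall z, osquare L z -> `|(du z).1| <= c) ->
  (forall z, osquare L z -> `|(du z).2| <= c) ->
  forall z z', osquare L z -> osquare L z' ->
  `|u z - u z'| <= c * (`|z.1 - z'.1| + `|z.2 - z'.2|).
Proof.
move=> [_ _ dU] c1 c2.
have mvt (f df : R -> R) a b : 0 < a < L -> 0 < b < L ->
    (forall x, 0 < x < L -> is_derive x 1 f (df x)) ->
    (forall x, 0 < x < L -> `|df x| <= c) -> `|f a - f b| <= c * `|a - b|.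
  wlog : a b / a <= b.
    move=> H a0 b0 fd dfc; have [ab|/ltW ba] := leP a b; first exact: H.
    by rewrite distrC [`|a - b|]distrC; exact: H.
  move=> ab /andP[a0 aL] /andP[b0 bL] fd dfc.
  have sub x : a <= x <= b -> 0 < x < L.
    by move=> /andP[ax xb]; rewrite (lt_le_trans a0)//= (le_lt_trans xb).
  have [||x xab fE] := @MVT_segment R f df a b ab.
  - by move=> x; rewrite in_itv/= => /andP[ax xb]; apply: fd; apply: sub; rewrite !ltW.
  - apply: derivable_within_continuous => x; rewrite in_itv/= => /sub /fd.
    by move=> [].
  rewrite distrC fE normrM [`|a - b|]distrC ler_wpM2r//.
  by apply: dfc; apply: sub; move: xab; rewrite in_itv.
move=> [x y] [x' y'] [/= x0 y0] [/= x'0 y'0].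
have -> : u (x, y) - u (x', y') =
    (u (x, y) - u (x', y)) + (u (x', y) - u (x', y')) by rewrite addrA subrK.
apply: (le_trans (ler_normD _ _)); rewrite mulrDr lerD//.
- apply: (mvt (fun x => u (x, y)) (fun x => (du (x, y)).1)) => //.
    by move=> a a0; have [] := dU (a, y) (conj a0 y0).
  by move=> a a0; exact: (c1 (a, y)).
- apply: (mvt (fun y => u (x', y)) (fun y => (du (x', y)).2)) => //.
    by move=> a a0; have [] := dU (x', a) (conj x'0 a0).
  by move=> a a0; exact: (c2 (x', a)).
Qed.

End averages.

Section plane_measure.
Context {R : realType}.
Local Notation RT := (measurableTypeR R).
Local Notation mu2 := (@lebesgue_measure R \x @lebesgue_measure R)%E.

Lemma leb2_sigma_finite : sigma_finite setT (leb2 (R := R)).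
Proof.
pose I n : set RT := `[- n%:R, n%:R]%classic.
exists (fun n => I n `*` I n).
  apply/seteqP; split => // -[x y] _.
  exists (Num.truncn (Num.max `|x| `|y|)).+1 => //=.
  have := truncnS_gt (Num.max `|x| `|y|); rewrite gt_max => /andP[hx hy].
  by split; rewrite /I/= in_itv/= -ler_norml ltW.
move=> n; split; first by apply: measurableX; exact: measurable_itv.
rewrite /leb2/= product_measure1E; [|exact: measurable_itv..].
have Ioo : (@lebesgue_measure R (I n) < +oo)%E.
  by rewrite /I lebesgue_measure_itv/=; case: ifP => _; rewrite -?EFinD ltry.
by apply: lte_mul_pinfty => //; rewrite ge0_fin_numE.
Qed.

(** Tonelli's theorem asks for a measure with a sigma-finite structure. *)
Definition leb2_sf : {sigma_finite_measure set (RT * RT)%type -> \bar R} :=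
  let m := Measure_isSigmaFinite.Build _ _ _ _ leb2_sigma_finite in
  HB.pack (Measure.sort (leb2 (R := R))) m.

End plane_measure.

(** * A Gaussian field and its eigenpairs *)

Section field.
Context {R : realType} d (T : measurableType d) (P : probability T R).
Local Notation RT := (measurableTypeR R).
Local Notation mu2 := (@lebesgue_measure R \x @lebesgue_measure R)%E.
Variables (L : R) (L0 : 0 < L) (W : R * R -> {RV P >-> R}).
Hypothesis W_gauss : gaussian_field (csquare L) W.
Hypothesis W_cont :
  {ae P, forall w, {within csquare L, continuous (fun p => W p w)}}.

Lemma field_gaussian p : csquare L p -> gaussian P (W p).
Proof.
move=> Lp; have := W_gauss (fun _ : 'I_1 => 1) (fun _ : 'I_1 => Lp).
by under eq_fun do rewrite big_ord1 mul1r.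
Qed.

Lemma increment_gaussian p p' : csquare L p -> csquare L p' ->
  gaussian P (fun w => W p w - W p' w).
Proof.
move=> Lp Lp'; pose z (i : 'I_2) := if i == ord0 then p else p'.
pose c (i : 'I_2) : R := if i == ord0 then 1 else -1.
have Lz i : csquare L (z i) by rewrite /z; case: ifP.
have := W_gauss c Lz.
by under eq_fun do rewrite big_ord_recr big_ord1 /z /c /= mul1r mulN1r.
Qed.

Lemma field_expR_bounded (k : R) : 0 <= k -> exists2 C : R, 0 < C &
  forall p, csquare L p -> (\int[P]_w (expR (k * `|W p w|))%:E <= C%:E)%E.
Proof.
move=> k0; have [M M0 PM] := field_tight L0 W_cont.
exists (2 * expR (3 * M * k + k ^+ 2 * M ^+ 2)).
  by rewrite mulr_gt0// expR_gt0.
by move=> p Lp; apply: gaussian_expR_le => //; [exact: field_gaussian|exact: PM].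
Qed.

Lemma field_sq_bounded : exists2 C : R, 0 < C &
  forall p, csquare L p -> (\int[P]_w (W p w ^+ 2)%:E <= C%:E)%E.
Proof.
have [M M0 PM] := field_tight L0 W_cont.
exists (M `^ 2 * (2 * expR (3 * 2 + 2 ^+ 2))).
  by rewrite !mulr_gt0// ?expR_gt0 ?powR_gt0.
move=> p Lp.
have := gaussian_moment_le (measurable_funP (W p)) (field_gaussian Lp) M0
  (ler0n _ 2) (PM p Lp).
by under eq_integral do rewrite powR_mulrn// real_normK ?num_real//.
Qed.

Hypothesis W_mean0 : forall p, csquare L p -> ('E_P[W p] = 0)%E.
Variables (lam : nat -> R) (e : nat -> R * R -> R).
Hypothesis eig : eigenpairs L W lam e.
Variable Om : set T.
Hypothesis gOm : good_set L W Om.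

Let mus := @leb2_sf R.
Let Z := version L W Om.
Let S : set (RT * RT) := csquare L.
Let ee i : RT * RT -> R := e i \_ S.

Let mS : measurable S. Proof. exact: measurable_csquare. Qed.

Let muS : (mu2 S < +oo)%E. Proof. by rewrite csquare_measure// ltry. Qed.

Let mZ : measurable_fun setT Z. Proof. exact: measurable_version. Qed.

Let Z0 p w : ~ S p -> Z (p, w) = 0. Proof. exact: version_out. Qed.

Let aeZ p : S p -> {ae P, forall w, Z (p, w) = W p w}.
Proof.
move=> Sp; have [mO O0 _] := gOm; exists (~` Om); split => //.
  exact: measurableC.
by move=> w /= h Ow; apply: h; exact: versionE.
Qed.

Let Zsq : exists M : R, forall p, (\int[P]_w (Z (p, w) ^+ 2)%:E <= M%:E)%E.
Proof.
have [C C0 WC] := field_sq_bounded; exists C => p.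
have [Sp|Sp] := pselect (S p); last first.
  under eq_integral do rewrite Z0// expr0n.
  by rewrite integral0 lee_fin ltW.
apply: le_trans (WC p Sp).
apply: ae_ge0_le_integral => //.
- by move=> w _; rewrite lee_fin sqr_ge0.
- apply/measurable_EFinP; apply: measurable_funX.
  exact: (measurable_fun_pair2 p mZ).
- by move=> w _; rewrite lee_fin sqr_ge0.
- by apply/measurable_EFinP; exact: measurable_funX.
- by apply: filterS (aeZ Sp) => w -> _.
Qed.

Let Zbd w : exists c : R, forall p, `|Z (p, w)| <= c.
Proof.
have [M M0 ZM] := csquare_bounded (version_continuous (L := L) gOm (w := w)).
exists M => p; have [Sp|Sp] := pselect (S p); first exact: ZM.
by rewrite Z0// normr0 ltW.
Qed.

Let patch_sq (h : R * R -> R) : in_Lp leb2 S 2%:E h ->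
  sq_int mu2 (h \_ S).
Proof.
move=> [mh h2]; apply: Lnorm_sq_int; last exact: h2.
exact/(measurable_restrictT _ _).1.
Qed.

Let ee_sq i : sq_int mu2 (ee i).
Proof. by apply: patch_sq; case: eig => -[]. Qed.

Let ee0 i p : ~ S p -> ee i p = 0.
Proof. by move=> Sp; rewrite /ee patchE memNset. Qed.

Let inner_patch (h : R * R -> R) i :
  inner leb2 S h (e i) = fine (\int[mu2]_p ((h \_ S) p * ee i p)%:E).
Proof.
rewrite /inner Rintegral_mkcond /Rintegral; congr fine.
by apply: eq_integral => p _; rewrite /ee !patchE; case: ifPn; rewrite ?mul0r.
Qed.

Let ee_orth i j : (\int[mu2]_p (ee i p * ee j p)%:E = ((i == j)%:R)%:E)%E.
Proof.
have [[_ orth _] _] := eig; rewrite -orth inner_patch fineK//.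
exact: (integrable_fin_num _ (sq_int_integrableM (ee_sq i) (ee_sq j))).
Qed.

Let second_momentE p p' : S p -> S p' ->
  second_moment P Z p p' = covariance_function W p p'.
Proof.
move=> Sp Sp'; rewrite /second_moment /covariance_function covariance.unlock.
rewrite !W_mean0//= expectation.unlock; congr fine.
have [mO O0 _] := gOm.
apply: ae_eq_integral => //.
- apply/measurable_EFinP; apply: measurable_funM.
    exact: (measurable_fun_pair2 p mZ).
  exact: (measurable_fun_pair2 p' mZ).
- by apply/measurable_EFinP; apply: measurable_funM; exact: measurable_funB.
- exists (~` Om); split => //; first exact: measurableC.
  move=> w /= h Ow; apply: h => _.
  by rewrite /Z !versionE// -[in LHS](subr0 (W p w)) -[in LHS](subr0 (W p' w)).
Qed.

Let ee_eig i : {ae mu2, forall p, S p ->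
  fine (\int[mu2]_p' (second_moment P Z p p' * ee i p')%:E) = lam i * ee i p}.
Proof.
have [_ /(_ i) [N [mN N0 sN]]] := eig; exists N; split => // p /= h; apply: sN.
move=> h'; apply: h => Sp; move: h' => /(_ Sp).
rewrite /ee patchE mem_set// => <-.
rewrite /covariance_operator Rintegral_mkcond /Rintegral; congr fine.
apply: eq_integral => p' _; rewrite !patchE; case: ifPn => [|_].
  by rewrite inE => Sp'; rewrite second_momentE.
by rewrite mulr0.
Qed.

(** The eigenvalue is the variance of a coordinate of the field. *)
Lemma field_eigenvalue_ge0 i : 0 <= lam i.
Proof.
have [M ZM] := Zsq.
exact: (@eigenvalue_ge0 _ _ _ _ _ mus P S mS muS Z mZ Z0 M ZM Zbd ee lam ee_sq ee0 ee_orth ee_eig).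
Qed.

Lemma measurable_field_pairing (h : RT * RT -> R) : sq_int mu2 h ->
  measurable_fun setT (pairing (@leb2_sf R) Z h).
Proof.
have [M ZM] := Zsq.
exact: (@measurable_pairing _ _ _ _ _ mus P S mS muS Z mZ Z0 M ZM).
Qed.

(** [pairing_sq_le] for the version of W, whose second moments agree with the
    covariance function because W is centred. *)
Lemma field_pairing_sq_le (h : RT * RT -> R) (B : R) : sq_int mu2 h ->
  (forall p, ~ S p -> h p = 0) ->
  (forall n, \sum_(i < n) lam i *
     (fine (\int[mu2]_p (h p * ee i p)%:E)) ^+ 2 <= B) ->
  (\int[P]_w ((pairing (@leb2_sf R) Z h w) ^+ 2)%:E <= B%:E)%E.
Proof.
move=> sh h0 hB; have [M ZM] := Zsq.
have hS : h \_ S = h.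
  by apply/funext => p; rewrite patchE; case: ifPn => // /negP; rewrite inE => /h0.
apply: (@pairing_sq_le _ _ _ _ _ mus P S mS muS Z mZ Z0 M ZM Zbd ee lam ee_sq ee0 ee_orth ee_eig h
  (fun i => fine (\int[mu2]_p (h p * ee i p)%:E)) B sh _ hB).
have [[_ _ complete] _] := eig.
have hLp : in_Lp leb2 S 2%:E h.
  have [mh _] := sh; split; first exact: measurable_funTS.
  by rewrite /Lp_norm hS; exact: (sq_int_Lnorm sh).
apply: cvg_trans (complete h hLp); apply: near_eq_cvg; apply: nearW => n.
rewrite /Lp_norm. congr Lnorm; apply/funext => p /=; rewrite patchE.
congr (_%:E); case: ifPn => [pS|/negP]; last first.
  rewrite inE => Sp; rewrite h0// sub0r big1 ?oppr0// => i _.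
  by rewrite ee0// mulr0.
congr (_ - _); apply: eq_bigr => i _.
rewrite inner_patch hS.
by rewrite /ee patchE pS.
Qed.

End field.

(** * Increments of the field in mean square *)

Section box_pairing.
Context {R : realType}.
Local Notation RT := (measurableTypeR R).
Local Notation mu2 := (@lebesgue_measure R \x @lebesgue_measure R)%E.
Variables (L : R) (L0 : 0 < L).

(** Pairing with this function gives a difference of averages of the field, close to
    its increment between p and p'. *)
Definition box_test (del : R) (p p' : R * R) (z : RT * RT) : R :=
  (\1_(box L del p) z - \1_(box L del p') z) / (del * L) ^+ 2.

Lemma box_test_out (del : R) p p' z : csquare L p -> csquare L p' -> 0 < del <= 1 ->
  ~ csquare L z -> box_test del p p' z = 0.
Proof.
move=> Lp Lp' d01 Lz; rewrite /box_test !indicE !memNset ?subrr ?mul0r//.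
- by move=> /(box_csquare Lp' d01).
- by move=> /(box_csquare Lp d01).
Qed.

Lemma sq_int_box_test (del : R) p p' : 0 < del -> sq_int mu2 (box_test del p p').
Proof.
move=> d0.
have s q : sq_int mu2 (\1_(box L del q) : RT * RT -> R).
  apply: sq_int_indic; first exact: measurable_box.
  by rewrite /= box_measure// ltry.
have := sq_intZ ((del * L) ^- 2) (sq_intD (s p) (sq_intZ (-1) (s p'))).
by under eq_fun do rewrite mulN1r mulrC.
Qed.

Lemma integral_box_test (del : R) p p' (f : R * R -> R) : 0 < del ->
  mu2.-integrable (box L del p) (fun z => (f z)%:E) ->
  mu2.-integrable (box L del p') (fun z => (f z)%:E) ->
  fine (\int[mu2]_z (f z * box_test del p p' z)%:E) =
  avg L del p f - avg L del p' f.
Proof.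
move=> d0 ip ip'.
have mB q := measurable_box L del q.
have ep := (integrable_mkcond _ (mB p)).1 ip.
have ep' := (integrable_mkcond _ (mB p')).1 ip'.
have -> : (\int[mu2]_z (f z * box_test del p p' z)%:E =
  \int[mu2]_z (((del * L) ^- 2)%:E * ((((fun z => (f z)%:E) \_ (box L del p)) \-
   ((fun z => (f z)%:E) \_ (box L del p'))) z)))%E.
  apply: eq_integral => z _ /=.
  have pE q : ((fun z => (f z)%:E) \_ (box L del q)) z =
      (f z * \1_(box L del q) z)%:E.
    by rewrite patchE indicE; case: ifPn => _; rewrite ?mulr1 ?mulr0.
  rewrite !pE -EFinB -EFinM; congr (_%:E); rewrite /box_test; ring.
rewrite integralZl//; last exact: integrableB.
rewrite integralB// -!integral_mkcond.
have fp := integrable_fin_num (mB p) ip.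
have fp' := integrable_fin_num (mB p') ip'.
rewrite /avg -(fineK fp) -(fineK fp') -EFinB -EFinM /=.
by rewrite -mulrBl mulrC.
Qed.

Lemma avg_diff_le (del : R) p p' (f : R * R -> R) (c : R) : 0 < del ->
  mu2.-integrable (box L del p) (fun z => (f z)%:E) ->
  mu2.-integrable (box L del p') (fun z => (f z)%:E) ->
  (forall z z', box L del p z -> box L del p' z' -> `|f z - f z'| <= c) ->
  `|avg L del p f - avg L del p' f| <= c.
Proof.
move=> d0 ip ip' fc; rewrite ler_norml; apply/andP; split.
- rewrite lerBrDr addrC -lerBrDr opprK [_ + c]addrC; apply: avg_le => // z' bz'.
  rewrite -lerBlDl; apply: avg_ge => // z bz.
  by have := fc z z' bz bz'; rewrite ler_norml => /andP[+ _]; lra.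
- rewrite lerBlDr -lerBlDl; apply: avg_ge => // z' bz'.
  rewrite lerBlDr; apply: avg_le => // z bz.
  by have := fc z z' bz bz'; rewrite ler_norml => /andP[_]; lra.
Qed.

End box_pairing.

Section eigenfunctions.
Context {R : realType}.
Local Notation RT := (measurableTypeR R).
Variables (L : R) (L0 : 0 < L).

Lemma Lp_norm_oo_ae (f : R * R -> R) (c : R) :
  (Lp_norm leb2 (csquare L) +oo f <= c%:E)%E ->
  {ae leb2, forall z, csquare L z -> `|f z| <= c}.
Proof.
rewrite /Lp_norm Lnorm.unlock.
have -> : (0 < leb2 [set: (RT * RT)%type])%E.
  apply: (@lt_le_trans _ _ (leb2 (csquare L))).
    by rewrite /leb2 /= csquare_measure// lte_fin exprn_gt0.
  by apply: le_measure => //; rewrite inE//; exact: measurable_csquare.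
move=> /ess_supP [N [mN N0 sN]]; exists N; split => // z /= h; apply: sN => h'.
by apply: h => Lz; move: h'; rewrite /= patchE mem_set// lee_fin.
Qed.

Variables (e : nat -> R * R -> R) (alpha Ce : R).
Hypotheses (Ce0 : 0 < Ce) (e_bounds : eigenfunction_bounds L e alpha Ce).

Lemma eigenfunction_continuous i : {within csquare L, continuous (e i)}.
Proof. by have [_ [de [ce _ _] _]] := e_bounds i. Qed.

Lemma eigenfunction_le i p : csquare L p -> `|e i p| <= Ce.
Proof.
have [eC _] := e_bounds i.
apply: ae_bound_continuous => //; [exact: ltW|exact: eigenfunction_continuous|].
exact: (Lp_norm_oo_ae eC).
Qed.

Lemma eigenfunction_lipschitz i z z' : osquare L z -> osquare L z' ->
  `|e i z - e i z'| <=
  Ce * i.+1%:R `^ alpha * (`|z.1 - z'.1| + `|z.2 - z'.2|).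
Proof.
have [_ [de C1 /Lp_norm_oo_ae deC]] := e_bounds i.
have [_ cde _] := C1.
have k0 : 0 <= Ce * i.+1%:R `^ alpha by rewrite mulr_ge0 ?powR_ge0 ?ltW.
have le1 (v : R * R) : `|v.1| <= `|euclid v|.
  rewrite [`|euclid v|]ger0_norm ?sqrtr_ge0// -[`|v.1|]sqrtr_sqr.
  by rewrite ler_wsqrtr// lerDl sqr_ge0.
have le2 (v : R * R) : `|v.2| <= `|euclid v|.
  rewrite [`|euclid v|]ger0_norm ?sqrtr_ge0// -[`|v.2|]sqrtr_sqr.
  by rewrite ler_wsqrtr// lerDr sqr_ge0.
have c1 : {within csquare L, continuous (fun p => (de p).1)}.
  by move=> p; apply: continuous_comp; [exact: cde|exact: cvg_fst].
have c2 : {within csquare L, continuous (fun p => (de p).2)}.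
  by move=> p; apply: continuous_comp; [exact: cde|exact: cvg_snd].
apply: (C1_lipschitz C1) => {}z /osquare_csquare Lz.
- apply: (ae_bound_continuous L0 k0 c1) => //.
  have [N [mN N0 sN]] := deC; exists N; split => // q /= h; apply: sN => h'.
  by apply: h => Lq; apply: le_trans (le1 _) (h' Lq).
- apply: (ae_bound_continuous L0 k0 c2) => //.
  have [N [mN N0 sN]] := deC; exists N; split => // q /= h; apply: sN => h'.
  by apply: h => Lq; apply: le_trans (le2 _) (h' Lq).
Qed.

(** The coefficient is at most 2 Ce by the sup bound and at most Ce i^alpha rho by
    the gradient bound; min(1, y) <= y^gamma interpolates between the two. *)
Lemma box_coefficient_sq_le i (del gamma rho : R) p p' :
  csquare L p -> csquare L p' -> 0 < del <= 1 ->
  0 < gamma < 1 ->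
  `|p.1 - p'.1| + `|p.2 - p'.2| + 4 * (del * L) <= rho ->
  (avg L del p (e i) - avg L del p' (e i)) ^+ 2 <=
  4 * Ce ^+ 2 * (i.+1%:R `^ (alpha * (2 * gamma)) * rho `^ (2 * gamma)).
Proof.
move=> Lp Lp' d01 /andP[g0 g1] rhoE; have [d0 d1] := andP d01.
have ib q : csquare L q -> (leb2 (R := R)).-integrable (box L del q)
    (fun z => (e i z)%:E).
  move=> Lq; have ie := continuous_csquare_integrable L0 (@eigenfunction_continuous i).
  apply: integrableS ie; [exact: measurable_csquare|exact: measurable_box|exact: box_csquare].
have cp := @measurable_csquare R L.
set A := avg L del p (e i) - avg L del p' (e i).
pose k : R := i.+1%:R `^ alpha.
have k0 : 0 < k by rewrite powR_gt0.
have A1 : `|A| <= 2 * Ce.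
  apply: (avg_diff_le L0 d0 (ib _ Lp) (ib _ Lp')) => z z' bz bz'.
  have := eigenfunction_le i (box_csquare Lp d01 bz).
  have := eigenfunction_le i (box_csquare Lp' d01 bz').
  have := ler_normB (e i z) (e i z'); lra.
have A2 : `|A| <= Ce * k * rho.
  apply: (avg_diff_le L0 d0 (ib _ Lp) (ib _ Lp')) => z z' bz bz'.
  apply: (le_trans (eigenfunction_lipschitz i (box_osquare Lp d01 bz)
    (box_osquare Lp' d01 bz'))).
  rewrite ler_wpM2l ?mulr_ge0 ?powR_ge0 ?(ltW Ce0)//.
  apply: le_trans rhoE.
  have [z1 z2] := box_dist Lp d01 bz; have [z1' z2'] := box_dist Lp' d01 bz'.
  have t (x y a b c : R) : `|a - x| <= c -> `|b - y| <= c ->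
      `|x - y| <= `|a - b| + 2 * c.
    move=> ac bc; have -> : x - y = (a - b) - (a - x) + (b - y) by ring.
    have := ler_normD (a - b - (a - x)) (b - y).
    have := ler_normB (a - b) (a - x); lra.
  have := t _ _ _ _ _ z1 z1'; have := t _ _ _ _ _ z2 z2'; lra.
have r0 : 0 < rho.
  apply: lt_le_trans rhoE; rewrite ltr_wpDl ?addr_ge0// mulr_gt0//.
  by rewrite mulr_gt0.
have y0 : 0 < k * rho by rewrite mulr_gt0.
have Ay : `|A| <= 2 * Ce * (k * rho) `^ gamma.
  have [y1|y1] := leP (k * rho) 1.
    have : k * rho <= (k * rho) `^ gamma.
      by rewrite -{1}[k * rho]powRr1 ?(ltW y0)// ger_powR ?y0// ltW.
    move: A2; rewrite -mulrA => A2 yg.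
    have : Ce * (k * rho) <= Ce * (k * rho) `^ gamma by rewrite ler_wpM2l// ltW.
    have : 0 <= Ce * (k * rho) `^ gamma by rewrite mulr_ge0 ?powR_ge0// ltW.
    lra.
  apply: (le_trans A1); rewrite ler_peMr ?mulr_ge0 ?(ltW Ce0)//.
  by rewrite -[leLHS](powRr0 (k * rho)) ler_powR// ltW.
have : `|A| ^+ 2 <= (2 * Ce * (k * rho) `^ gamma) ^+ 2.
  by rewrite ler_sqr ?nnegrE// !mulr_ge0 ?powR_ge0// ltW.
rewrite real_normK ?num_real// => /le_trans; apply.
rewrite !exprMn -[(_ `^ gamma) ^+ 2]powR_mulrn ?powR_ge0// -powRrM.
rewrite powRM ?(ltW k0) ?(ltW r0)// /k -powRrM [gamma * 2]mulrC.
by rewrite le_eqVlt; apply/orP; left; apply/eqP; congr (_ * _); ring.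
Qed.

End eigenfunctions.

Section increments.
Context {R : realType} d (T : measurableType d) (P : probability T R).
Local Notation RT := (measurableTypeR R).
Variables (L : R) (L0 : 0 < L) (W : R * R -> {RV P >-> R}).
Hypothesis W_gauss : gaussian_field (csquare L) W.
Hypothesis W_cont :
  {ae P, forall w, {within csquare L, continuous (fun p => W p w)}}.
Hypothesis W_mean0 : forall p, csquare L p -> ('E_P[W p] = 0)%E.
Variables (lam : nat -> R) (e : nat -> R * R -> R).
Hypothesis eig : eigenpairs L W lam e.
Variables (alpha beta Ce Clam gamma : R).
Hypotheses (Ce0 : 0 < Ce) (e_bounds : eigenfunction_bounds L e alpha Ce).
Hypothesis lam_sum :
  forall n, \sum_(i < n) lam i * i.+1%:R `^ beta <= Clam.
Hypotheses (g01 : 0 < gamma < 1) (ag : alpha * (2 * gamma) <= beta).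

Definition dist1 (p p' : R * R) : R := `|p.1 - p'.1| + `|p.2 - p'.2|.

(** [field_pairing_sq_le] with [box_test] for shrinking squares, and Fatou's lemma:
    the spectral sum is bounded by [box_coefficient_sq_le] and sum lam_i i^beta. The
    factor 2 leaves room for the sides of the squares. *)
Lemma field_increment_sq_le p p' : csquare L p -> csquare L p' ->
  0 < dist1 p p' ->
  (\int[P]_w ((W p w - W p' w) ^+ 2)%:E <=
   (4 * Ce ^+ 2 * Clam * (2 * dist1 p p') `^ (2 * gamma))%:E)%E.
Proof.
move=> Lp Lp' r0; have [Om gOm] := ex_good_set W_cont.
set r := dist1 p p' in r0 *; set B := 4 * Ce ^+ 2 * Clam * _.
pose Z := version L W Om; have mZ : measurable_fun setT Z by exact: measurable_version.
have mZp q : measurable_fun setT (fun w => Z (q, w)) := measurable_fun_pair2 q mZ.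
have d01 n : 0 < (n.+1%:R^-1 : R) <= 1.
  by rewrite invr_gt0 ltr0n invf_le1 ?ltr0n// ler1n.
have d0 n : 0 < (n.+1%:R^-1 : R) by have [] := andP (d01 n).
have cZ w := version_continuous gOm (w := w).
apply: (@le_trans _ _ (\int[P]_w ((Z (p, w) - Z (p', w)) ^+ 2)%:E)%E).
  apply: ae_ge0_le_integral => //.
  - by move=> w _; rewrite lee_fin sqr_ge0.
  - by apply/measurable_EFinP; apply: measurable_funX; exact: measurable_funB.
  - by move=> w _; rewrite lee_fin sqr_ge0.
  - by apply/measurable_EFinP; apply: measurable_funX; exact: measurable_funB.
  - have [mO O0 _] := gOm; exists (~` Om); split => //; first exact: measurableC.
    move=> w /= h Ow; apply: h => _; rewrite /Z.
    by rewrite (versionE W Lp Ow) (versionE W Lp' Ow).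
have ibx n q w : csquare L q -> (leb2 (R := R)).-integrable (box L n.+1%:R^-1 q)
    (fun z => (Z (z, w))%:E).
  move=> Lq; have ie := continuous_csquare_integrable L0 (@cZ w).
  apply: integrableS ie; [exact: measurable_csquare|exact: measurable_box|exact: box_csquare].
have ibe n q i : csquare L q -> (leb2 (R := R)).-integrable (box L n.+1%:R^-1 q)
    (fun z => (e i z)%:E).
  move=> Lq; have ie := continuous_csquare_integrable L0
    (@eigenfunction_continuous _ _ _ _ _ e_bounds i).
  apply: integrableS ie; [exact: measurable_csquare|exact: measurable_box|exact: box_csquare].
pose h n := box_test L n.+1%:R^-1 p p'.
have sh n : sq_int leb2 (h n) by exact: sq_int_box_test.
have pairE n w : pairing (@leb2_sf R) Z (h n) w =
    avg L n.+1%:R^-1 p (fun z => Z (z, w)) - avg L n.+1%:R^-1 p' (fun z => Z (z, w)).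
  by rewrite /pairing (integral_box_test (d0 n) (ibx n p w Lp) (ibx n p' w Lp')).
have mpair n : measurable_fun setT (pairing (@leb2_sf R) Z (h n)).
  exact: (measurable_field_pairing L0 W_gauss W_cont gOm).
apply: (fatou_le (Y_ := fun n w => (pairing (@leb2_sf R) Z (h n) w) ^+ 2)).
- by move=> n; exact: measurable_funX.
- by apply: measurable_funX; exact: measurable_funB.
- by move=> n w; exact: sqr_ge0.
- by move=> w; exact: sqr_ge0.
- apply: aeW => w; under eq_fun do rewrite pairE expr2; rewrite expr2.
  by apply: cvgM; apply: cvgB; exact: avg_cvg.
have : (L * n.+1%:R^-1) @[n --> \oo] --> (0 : R).
  by rewrite -[0](mulr0 L); apply: cvgM; [exact: cvg_cst|exact: cvg_harmonic].
(* squares of side at most r / 4 enlarge the distance r to at most 2 r *)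
have r4 : 0 < r / 4 by rewrite divr_gt0.
move=> /cvgrPdist_le/(_ _ r4); apply: filterS => n /=.
rewrite sub0r normrN ger0_norm; last by rewrite mulr_ge0 ?invr_ge0 ?ltW.
move=> nr; apply: (field_pairing_sq_le L0 W_gauss W_cont W_mean0 eig gOm (sh n)).
  by move=> z; exact: box_test_out.
move=> m; rewrite /B.
have lam0 i := field_eigenvalue_ge0 L0 W_gauss W_cont W_mean0 eig gOm i.
have R0 : 0 <= (2 * r) `^ (2 * gamma) by exact: powR_ge0.
apply: (@le_trans _ _ (\sum_(i < m) 4 * Ce ^+ 2 * (2 * r) `^ (2 * gamma) *
    (lam i * i.+1%:R `^ beta))); last first.
  rewrite -mulr_sumr [leRHS]mulrAC ler_wpM2l ?lam_sum//.
  by rewrite mulr_ge0// mulr_ge0// sqr_ge0.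
apply: ler_sum => i _; rewrite [leRHS]mulrCA ler_wpM2l//.
have cE : fine (\int[leb2]_z (h n z * (e i \_ (csquare L)) z)%:E)%E =
    avg L n.+1%:R^-1 p (e i) - avg L n.+1%:R^-1 p' (e i).
  rewrite -(integral_box_test (d0 n) (ibe n p i Lp) (ibe n p' i Lp')).
  congr fine; apply: eq_integral => z _; rewrite mulrC patchE.
  case: ifPn => // /negP; rewrite inE => Lz.
  by rewrite /h box_test_out// !mulr0.
rewrite cE.
have rE : `|p.1 - p'.1| + `|p.2 - p'.2| + 4 * (n.+1%:R^-1 * L) <= 2 * r.
  have {nr} : n.+1%:R^-1 * L <= r / 4 by rewrite mulrC.
  rewrite -/(dist1 p p') -/r; set y := _ * L; lra.
apply: (le_trans (box_coefficient_sq_le L0 Ce0 e_bounds i Lp Lp' (d01 n) g01 rE)).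
rewrite -[leRHS]mulrA ler_wpM2l ?mulr_ge0 ?(ltW Ce0)//.
rewrite [leRHS]mulrC ler_wpM2r// ler_powR//.
by rewrite ler1n.
Qed.

End increments.

(** * Moments of increments, at fixed and at independent random points *)

Section increment_moments.
Context {R : realType} d (T : measurableType d) (P : probability T R).
Variables (L : R) (L0 : 0 < L) (W : R * R -> {RV P >-> R}).
Hypothesis W_gauss : gaussian_field (csquare L) W.
Hypothesis W_cont :
  {ae P, forall w, {within csquare L, continuous (fun p => W p w)}}.
Hypothesis W_mean0 : forall p, csquare L p -> ('E_P[W p] = 0)%E.
Variables (lam : nat -> R) (e : nat -> R * R -> R).
Hypothesis eig : eigenpairs L W lam e.
Variables (alpha beta Ce Clam gamma : R).
Hypotheses (Ce0 : 0 < Ce) (e_bounds : eigenfunction_bounds L e alpha Ce).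
Hypotheses (Clam0 : 0 < Clam)
  (lam_sum : forall n, \sum_(i < n) lam i * i.+1%:R `^ beta <= Clam).
Hypotheses (g01 : 0 < gamma < 1) (ag : alpha * (2 * gamma) <= beta).

Lemma dist1_ge0 (p p' : R * R) : 0 <= dist1 p p'.
Proof. by rewrite addr_ge0. Qed.

Lemma dist1_eq0 (p p' : R * R) : dist1 p p' = 0 -> p = p'.
Proof.
case: p p' => [x y] [x' y'] /eqP; rewrite paddr_eq0//= !normr_eq0 !subr_eq0.
by move=> /andP[/eqP -> /eqP ->].
Qed.

(** The increment is Gaussian, so its second moment controls all the others. *)
Lemma field_increment_moment (b : R) : 0 < b -> exists2 C : R, 0 < C &
  forall p p', csquare L p -> csquare L p' ->
  (\int[P]_w (`|W p w - W p' w| `^ b)%:E <= (C * dist1 p p' `^ (b * gamma))%:E)%E.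
Proof.
move=> b0; pose K := 4 * Ce ^+ 2 * Clam.
have K0 : 0 < K by rewrite !mulr_gt0 ?exprn_gt0.
exists (2 `^ b * (K `^ (b / 2) * 2 `^ (b * gamma)) * (2 * expR (3 * b + b ^+ 2))).
  by rewrite !mulr_gt0 ?powR_gt0 ?expR_gt0.
move=> p p' Lp Lp'.
have [r0|r0] := ltP 0 (dist1 p p'); last first.
  have r00 : dist1 p p' = 0 by apply/eqP; rewrite eq_le r0 dist1_ge0.
  rewrite (dist1_eq0 r00); under eq_integral do rewrite subrr normr0 powR0 ?gt_eqF//.
  by rewrite integral0 lee_fin mulr_ge0 ?powR_ge0// !mulr_ge0 ?powR_ge0 ?expR_ge0.
have sq := field_increment_sq_le L0 W_gauss W_cont W_mean0 eig Ce0 e_bounds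
  lam_sum g01 ag Lp Lp' r0.
have v0 : 0 < K * (2 * dist1 p p') `^ (2 * gamma).
  by rewrite mulr_gt0// powR_gt0// mulr_gt0.
have mX : measurable_fun setT (fun w => W p w - W p' w) by exact: measurable_funB.
apply: (le_trans (gaussian_moment_le_second mX (increment_gaussian W_gauss Lp Lp')
  v0 (ltW b0) sq)).
rewrite lee_fin powRM ?powR_ge0 ?(ltW K0)// -powRrM.
rewrite (_ : 2 * gamma * (b / 2) = b * gamma); last by field.
rewrite powRM ?(ltW r0)//.
rewrite le_eqVlt; apply/orP; left; apply/eqP; ring.
Qed.

End increment_moments.

Section independence.
Context {R : realType} d (T : measurableType d) (P : probability T R).

(** Restricting P to E and pushing it forward by Y gives P E times the law of Y. *)
Lemma integral_indep_event (E : set T) (Y : T -> R) (f : R -> \bar R) :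
  measurable E -> measurable_fun setT Y ->
  (forall B, measurable B -> P (E `&` Y @^-1` B) = (P E * P (Y @^-1` B))%E) ->
  measurable_fun setT f -> (forall y, (0 <= f y)%E) ->
  (\int[P]_w (f (Y w) * (\1_E w)%:E) = P E * \int[P]_w f (Y w))%E.
Proof.
move=> mE mY indep mf f0.
have mfY : measurable_fun setT (fun w => f (Y w)) by exact: measurableT_comp.
rewrite -(@ge0_integral_density _ _ _ P (mrestr P mE) (\1_E))//; last first.
  by move=> A mA; rewrite integral_indic// setIC.
have PEfin : P E \is a fin_num by exact: fin_num_measure.
pose k : {nonneg R} := NngNum (fine_ge0 (measure_ge0 P E)).
have kE : k%:num%:E = P E by rewrite /= fineK.
transitivity (\int[pushforward (mrestr P mE) Y]_y f y)%E.
  by rewrite ge0_integral_pushforward.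
rewrite (eq_measure_integral (mscale k (pushforward P Y))); last first.
  move=> B mB _; transitivity (P (E `&` Y @^-1` B)).
    by rewrite setIC.
  rewrite indep//; transitivity (k%:num%:E * P (Y @^-1` B))%E => //.
  by rewrite kE.
by rewrite ge0_integral_mscale// kE ge0_integral_pushforward.
Qed.

Variables (G H : set (set T)).
Hypothesis GH : independent_families P G H.

(** Measurability with respect to the sigma-algebra generated by F, stated without
    changing the type of outcomes. *)
Definition sub_measurable (F : set (set T)) (X : T -> R) : Prop :=
  forall B, measurable B -> <<s F >> (X @^-1` B).

(** A sum over the finitely many values of the index I, in which the event I = j is
    independent of F j. *)
Lemma integral_indep_select (J : finType) (I : T -> J) (F : J -> T -> R)
    (s : R) (c : J -> R) : 0 <= s ->
  (forall j, measurable (I @^-1` [set j])) ->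
  (forall j, <<s G >> (I @^-1` [set j])) ->
  (forall j, measurable_fun setT (F j)) ->
  (forall j, sub_measurable H (F j)) ->
  (forall j, 0 <= c j) ->
  (forall j, (\int[P]_w (`|F j w| `^ s)%:E <= (c j)%:E)%E) ->
  (\int[P]_w (`|F (I w) w| `^ s)%:E <= \int[P]_w (c (I w))%:E)%E.
Proof.
move=> s0 mI GI mF HF c0 Fc.
have sumE (a : J -> T -> R) w : (forall j, 0 <= a j w) ->
    ((a (I w) w)%:E = \sum_(j : J) ((a j w)%:E * (\1_(I @^-1` [set j]) w)%:E))%E.
  move=> a0; rewrite (bigD1 (I w))//= big1 => [|j jI].
    by rewrite indicE mem_set//= mule1 adde0.
  by rewrite indicE memNset ?mule0// => /= Iw; rewrite Iw eqxx in jI.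
have mFs j : measurable_fun setT (fun w => (`|F j w| `^ s)%:E).
  apply/measurable_EFinP; apply: (measurableT_comp (measurable_powR _)) => //.
  exact: measurableT_comp.
have m1 j : measurable_fun setT (fun w => (\1_(I @^-1` [set j]) w)%:E : \bar R).
  by apply/measurable_EFinP; exact: measurable_indic.
under eq_integral do rewrite (sumE (fun j w => `|F j w| `^ s)) ?powR_ge0//.
under [leRHS]eq_integral do rewrite (sumE (fun j w => c j))//.
have f1 j : measurable_fun setT
    (fun w => (`|F j w| `^ s)%:E * (\1_(I @^-1` [set j]) w)%:E)%E.
  exact: emeasurable_funM.
have f2 j : measurable_fun setT
    (fun w => (c j)%:E * (\1_(I @^-1` [set j]) w)%:E : \bar R)%E.
  exact: emeasurable_funM.
have f10 j w : setT w ->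
    (0 <= (`|F j w| `^ s)%:E * (\1_(I @^-1` [set j]) w)%:E)%E.
  by rewrite mule_ge0// lee_fin ?powR_ge0.
have f20 j w : setT w -> (0 <= (c j)%:E * (\1_(I @^-1` [set j]) w)%:E :> \bar R)%E.
  by rewrite mule_ge0// lee_fin.
rewrite ge0_integral_sum// ge0_integral_sum//.
apply: lee_sum => j _.
rewrite (@integral_indep_event (I @^-1` [set j]) (F j) (fun y => (`|y| `^ s)%:E))//.
- rewrite ge0_integralZl// ?lee_fin//.
  by rewrite integral_indic// setIT muleC lee_wpmul2r.
- by move=> B mB; apply: GH; [exact: GI|exact: HF].
- apply/measurable_EFinP; apply: (measurableT_comp (measurable_powR _)) => //.
Qed.

End independence.

Lemma powR_invK {R : realType} (x r : R) : 0 < r -> 0 <= x ->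
  (x `^ r^-1) `^ r = x.
Proof. by move=> r0 x0; rewrite -powRrM mulVf ?gt_eqF// powRr1. Qed.

(** The exponent is positive, so the limit may be 0. *)
Lemma cvg_powR {R : realType} (u : nat -> R) (l s : R) : 0 < s ->
  (forall n, 0 <= u n) -> 0 <= l -> u n @[n --> \oo] --> l ->
  u n `^ s @[n --> \oo] --> l `^ s.
Proof.
move=> s0 u0; rewrite le_eqVlt => /predU1P[<- ul|l0 ul].
  rewrite powR0 ?gt_eqF//; apply/cvgrPdist_le => eps eps0.
  have e0 : 0 < eps `^ s^-1 by rewrite powR_gt0.
  move/cvgrPdist_le/(_ _ e0): ul; apply: filterS => n.
  rewrite !sub0r !normrN !ger0_norm ?powR_ge0// => un.
  rewrite -[leRHS](powR_invK s0 (ltW eps0)).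
  by apply: ge0_ler_powR; rewrite ?nnegrE ?powR_ge0// ltW.
have E (x : R) : 0 < x -> x `^ s = expR (s * ln x) by move=> x0; rewrite /powR gt_eqF.
rewrite E//; apply: (@cvg_trans _ (expR (s * ln (u n)) @[n --> \oo])).
  apply: near_eq_cvg; near=> n; rewrite E//.
  by near: n; exact: (cvgr_gt l).
apply: (@cvg_comp _ _ _ (fun n => s * ln (u n)) expR _ (nbhs (s * ln l))).
  apply: cvgM; first exact: cvg_cst.
  by apply: (@cvg_comp _ _ _ u (@ln R) _ (nbhs l)) => //; exact: continuous_ln.
exact: continuous_expR.
Unshelve. all: by end_near. Qed.

Section random_points.
Context {R : realType} d (T : measurableType d) (P : probability T R).
Local Notation RT := (measurableTypeR R).
Variables (L : R) (L0 : 0 < L) (W : R * R -> {RV P >-> R}).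
Variables (Om : set T) (gOm : good_set L W Om).
Variables (G H : set (set T)).
Hypothesis GH : independent_families P G H.
Hypothesis WH : process_events (csquare L) (fun p => W p : T -> R) `<=` H.
Variables (s r C : R).
Hypotheses (s0 : 0 < s) (r0 : 0 < r) (C0 : 0 < C).
Hypothesis W_moment : forall p p', csquare L p -> csquare L p' ->
  (\int[P]_w (`|W p w - W p' w| `^ s)%:E <= (C * dist1 p p' `^ r)%:E)%E.

Lemma sub_measurable_setI (F : set (set T)) (A B : set T) :
  <<s F >> A -> <<s F >> B -> <<s F >> (A `&` B).
Proof.
by move=> FA FB; exact: (@measurableI _ (g_sigma_algebraType F) A B FA FB).
Qed.

Lemma sub_measurable_increment z z' : csquare L z -> csquare L z' ->
  sub_measurable H (fun w => W z w - W z' w).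
Proof.
move=> Lz Lz'; pose TH := g_sigma_algebraType H.
have mW q : csquare L q -> measurable_fun (setT : set TH) (W q : TH -> R).
  move=> Lq _ B mB; rewrite setTI; apply: sub_sigma_algebra; apply: WH.
  by exists q => //; exists B => //; rewrite setTI.
move=> B mB; have := measurable_funB (mW z Lz) (mW z' Lz').
by move=> /(_ measurableT B mB); rewrite setTI.
Qed.

Let pt n (a : 'I_n.+1 * 'I_n.+1) : R * R := (node L n.+1 a.1, node L n.+1 a.2).

Let pt_csquare n a : csquare L (@pt n a).
Proof. by split; rewrite /= node_itv// ltnW. Qed.

Variables (U V : T -> R * R).
Hypotheses (UL : forall w, csquare L (U w)) (VL : forall w, csquare L (V w)).
Hypotheses (mU : measurable_fun setT (U : T -> RT * RT))
  (mV : measurable_fun setT (V : T -> RT * RT)).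
Hypotheses (GU1 : sub_measurable G (fun w => (U w).1))
  (GU2 : sub_measurable G (fun w => (U w).2))
  (GV1 : sub_measurable G (fun w => (V w).1))
  (GV2 : sub_measurable G (fun w => (V w).2)).

Let mdist : measurable_fun setT (fun w => dist1 (U w) (V w)).
Proof.
have mU1 : measurable_fun setT (fun w => (U w).1) by exact: measurableT_comp measurable_fst mU.
have mU2 : measurable_fun setT (fun w => (U w).2) by exact: measurableT_comp measurable_snd mU.
have mV1 : measurable_fun setT (fun w => (V w).1) by exact: measurableT_comp measurable_fst mV.
have mV2 : measurable_fun setT (fun w => (V w).2) by exact: measurableT_comp measurable_snd mV.
by apply: measurable_funD; apply: measurableT_comp => //; exact: measurable_funB.
Qed.

Lemma dist1_grid n p p' : csquare L p -> csquare L p' ->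
  dist1 (grid L n.+1 p) (grid L n.+1 p') <= dist1 p p' + 4 * (L / n.+1%:R).
Proof.
move=> [p1 p2] [p1' p2'].
have h1 := node_cell_dist L0 (ltn0Sn n) p1.
have h2 := node_cell_dist L0 (ltn0Sn n) p2.
have h1' := node_cell_dist L0 (ltn0Sn n) p1'.
have h2' := node_cell_dist L0 (ltn0Sn n) p2'.
have t (x y a b c : R) : `|a - x| <= c -> `|b - y| <= c ->
    `|x - y| <= `|a - b| + 2 * c.
  move=> ac bc; have -> : x - y = (a - b) - (a - x) + (b - y) by ring.
  have := ler_normD (a - b - (a - x)) (b - y).
  have := ler_normB (a - b) (a - x); lra.
have := t _ _ _ _ _ h1 h1'; have := t _ _ _ _ _ h2 h2'.
rewrite /dist1 /=; set y := L / _; lra.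
Qed.

(** On the grid U and V take finitely many values, and the field enters only through
    the increments between nodes, which are independent of the pair (U, V). *)
Let grid_increment n :
  (\int[P]_w (`|W (grid L n.+1 (U w)) w - W (grid L n.+1 (V w)) w| `^ s)%:E <=
   \int[P]_w (C * dist1 (grid L n.+1 (U w)) (grid L n.+1 (V w)) `^ r)%:E)%E.
Proof.
pose cl x : 'I_n.+1 := inord (cell L n.+1 x).
pose J : finType := (('I_n.+1 * 'I_n.+1) * ('I_n.+1 * 'I_n.+1))%type.
pose I w : J := ((cl (U w).1, cl (U w).2), (cl (V w).1, cl (V w).2)).
pose F (j : J) w := W (pt j.1) w - W (pt j.2) w.
have clE x : 0 <= x <= L -> cl x = cell L n.+1 x :> nat.
  by move=> xL; rewrite inordK//; have [] := cell_itv L0 (ltn0Sn n) xL.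
have gU w : grid L n.+1 (U w) = pt (I w).1.
  by have [u1 u2] := UL w; rewrite /pt/= !clE.
have gV w : grid L n.+1 (V w) = pt (I w).2.
  by have [u1 u2] := VL w; rewrite /pt/= !clE.
under eq_integral do rewrite gU gV.
under [leRHS]eq_integral do rewrite gU gV.
pose A (a : 'I_n.+1) : set R := cell L n.+1 @^-1` [set nat_of_ord a].
have mA a : measurable (A a).
  by rewrite -[X in measurable X]setTI; exact: (@measurable_cell R L n.+1).
have IE j : I @^-1` [set j] =
    (((fun w => (U w).1) @^-1` A j.1.1) `&` ((fun w => (U w).2) @^-1` A j.1.2)) `&`
    (((fun w => (V w).1) @^-1` A j.2.1) `&` ((fun w => (V w).2) @^-1` A j.2.2)).
  apply/seteqP; split => w /=.
    by move=> <-; have [u1 u2] := UL w; have [v1 v2] := VL w; rewrite /A/= !clE.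
  have [u1 u2] := UL w; have [v1 v2] := VL w.
  rewrite /A/= -!clE// => -[[/val_inj a1 /val_inj a2] [/val_inj a3 /val_inj a4]].
  by rewrite /I a1 a2 a3 a4; case: (j) => -[? ?] [? ?].
have m1 (X : T -> R) a : measurable_fun setT X -> measurable (X @^-1` A a).
  by move=> mX; rewrite -[X in measurable X]setTI; exact: mX.
apply: (integral_indep_select GH (I := I) (F := F)
  (c := fun j => C * dist1 (pt j.1) (pt j.2) `^ r) (ltW s0)).
- move=> j; rewrite IE; apply: measurableI; apply: measurableI; apply: m1.
  + exact: measurableT_comp measurable_fst mU.
  + exact: measurableT_comp measurable_snd mU.
  + exact: measurableT_comp measurable_fst mV.
  + exact: measurableT_comp measurable_snd mV.
- move=> j; rewrite IE; apply: sub_measurable_setI; apply: sub_measurable_setI.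
  + exact: GU1. + exact: GU2. + exact: GV1. + exact: GV2.
- by move=> j; exact: measurable_funB.
- by move=> j; apply: sub_measurable_increment; exact: pt_csquare.
- by move=> j; rewrite mulr_ge0 ?powR_ge0// ltW.
- by move=> j; apply: W_moment; exact: pt_csquare.
Qed.

(** [grid_increment] and Fatou's lemma: the version has continuous paths, so its
    values at the nodes converge to those at U and V. Once the mesh is so fine that
    it contributes at most B to the moment of the distance, the bound no longer
    depends on it. *)
Lemma random_increment_moment (B : R) : 0 < B ->
  (\int[P]_w (dist1 (U w) (V w) `^ r)%:E <= B%:E)%E ->
  (\int[P]_w (`|version L W Om (U w, w) - version L W Om (V w, w)| `^ s)%:E <=
   (C * (2 `^ r * (2 * B)))%:E)%E.
Proof.
move=> B0 distB.
pose Z := version L W Om; have mZ : measurable_fun setT Z by exact: measurable_version.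
have mZc (Q : T -> R * R) : measurable_fun setT (Q : T -> RT * RT) ->
    measurable_fun setT (fun w => Z (Q w, w)).
  move=> mQ; apply: (measurableT_comp mZ).
  exact: (measurable_fun_pair (f := (Q : T -> (RT * RT)%type)) mQ (@measurable_id _ T setT)).
have mgc (Q : T -> R * R) n : measurable_fun setT (Q : T -> RT * RT) ->
    measurable_fun setT (fun w => W (grid L n (Q w)) w).
  move=> mQ.
  have mQ1 := measurable_fun_pair (f := (Q : T -> (RT * RT)%type)) mQ
    (@measurable_id _ T setT).
  exact: (measurableT_comp (@measurable_grid_field _ _ _ _ L W n) mQ1).
have mps : measurable_fun setT (fun x : R => `|x| `^ s).
  by apply: (measurableT_comp (measurable_powR _)) => //.
have mpr : measurable_fun setT (fun w => dist1 (U w) (V w) `^ r).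
  exact: (measurableT_comp (measurable_powR _) mdist).
apply: (fatou_le (Y_ := fun n w =>
  `|W (grid L n.+1 (U w)) w - W (grid L n.+1 (V w)) w| `^ s)).
- move=> n; apply: (measurableT_comp mps); apply: measurable_funB; exact: mgc.
- apply: (measurableT_comp mps); apply: measurable_funB; exact: mZc.
- by move=> n w; exact: powR_ge0.
- by move=> w; exact: powR_ge0.
- have [mO O0 cO] := gOm; exists (~` Om); split => //; first exact: measurableC.
  move=> w /= h Ow; apply: h.
  rewrite (versionE W (UL w) Ow) (versionE W (VL w) Ow).
  apply: cvg_powR => //; apply: cvg_norm; apply: cvgB.
    by apply: (@grid_cvg _ (fun p => W p w)) => //; exact: cO.
  by apply: (@grid_cvg _ (fun p => W p w)) => //; exact: cO.
have h : (L * n.+1%:R^-1) @[n --> \oo] --> (0 : R).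
  by rewrite -[0](mulr0 L); apply: cvgM; [exact: cvg_cst|exact: cvg_harmonic].
(* a mesh of size B^(1/r) / 4 contributes at most B to the r-th moment *)
have b0 : 0 < B `^ r^-1 / 4 by rewrite divr_gt0 ?powR_gt0.
move/cvgrPdist_le/(_ _ b0): h; apply: filterS => n /=.
rewrite sub0r normrN ger0_norm; last by rewrite mulr_ge0 ?invr_ge0 ?ltW.
move=> nB; apply: (le_trans (grid_increment n)).
have Bn : (4 * (L / n.+1%:R)) `^ r <= B.
  rewrite -[leRHS](powR_invK r0 (ltW B0)).
  have y0 : 0 <= 4 * (L / n.+1%:R) by rewrite mulr_ge0// divr_ge0// ltW.
  apply: (ge0_ler_powR (ltW r0)); rewrite ?nnegrE ?powR_ge0//.
  by move: nB; set b := B `^ _; set y := L * _; lra.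
have mU1 : measurable_fun setT (fun w => (U w).1) by exact: measurableT_comp measurable_fst mU.
apply: (@le_trans _ _ (\int[P]_w ((C * 2 `^ r)%:E * ((dist1 (U w) (V w) `^ r)%:E + B%:E)))%E).
  apply: le_integral_outer.
  - by move=> w; rewrite lee_fin mulr_ge0 ?powR_ge0// ltW.
  - by move=> w; rewrite -EFinD -EFinM lee_fin mulr_ge0 ?addr_ge0 ?mulr_ge0 ?powR_ge0// ltW.
  - apply: emeasurable_funM => //; apply: emeasurable_funD => //.
    exact/measurable_EFinP.
  - apply: aeW => w; rewrite -EFinD -EFinM lee_fin -mulrA ler_wpM2l ?(ltW C0)//.
    set x := dist1 (U w) (V w); have x0 : 0 <= x := dist1_ge0 _ _.
    set y := 4 * (L / n.+1%:R) in Bn *.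
    have y0 : 0 <= y by rewrite mulr_ge0// divr_ge0// ltW.
    apply: (@le_trans _ _ ((2 * Num.max x y) `^ r)).
      apply: (ge0_ler_powR (ltW r0)); rewrite ?nnegrE ?dist1_ge0//.
        by rewrite mulr_ge0// le_max x0.
      apply: (le_trans (dist1_grid n (UL w) (VL w))); rewrite -/x -/y.
      have a1 : x <= Num.max x y by rewrite le_max lexx.
      have a2 : y <= Num.max x y by rewrite le_max lexx orbT.
      lra.
    rewrite powRM ?le_max ?x0// ler_wpM2l ?powR_ge0//.
    have [xy|yx] := leP x y; first by apply: (le_trans Bn); rewrite lerDr powR_ge0.
    by rewrite lerDl ltW.
have f1 w : setT w -> (0 <= (dist1 (U w) (V w) `^ r)%:E)%E.
  by rewrite lee_fin powR_ge0.
have f2 w : (setT : set T) w -> (0 <= B%:E)%E by rewrite lee_fin ltW.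
have mf1 : measurable_fun setT (fun w => (dist1 (U w) (V w) `^ r)%:E).
  exact/measurable_EFinP.
have k0 : (0 <= (C * 2 `^ r)%:E)%E by rewrite lee_fin mulr_ge0 ?powR_ge0// ltW.
have f12 w : setT w -> (0 <= (dist1 (U w) (V w) `^ r)%:E + B%:E)%E.
  by move=> _; rewrite adde_ge0// ?f1// (f2 w).
have mf12 : measurable_fun setT (fun w => (dist1 (U w) (V w) `^ r)%:E + B%:E)%E.
  by apply: emeasurable_funD.
rewrite ge0_integralZl//.
rewrite ge0_integralD// integral_cst//= (_ : P setT = 1%E); last exact: probability_setT.
rewrite mule1 mulrA [leRHS]EFinM lee_wpmul2l// (le_trans (leeD2r _ distB))//.
by rewrite -EFinD lee_fin mulr_natl mulr2n.
Qed.

End random_points.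

(** * Jointly measurable versions of a subordinator *)

(** Tonelli: both iterated integrals of the indicator are the same. *)
Lemma ae_null_sections dX (X : measurableType dX) d (T : measurableType d)
    (R : realType) (mu : {sigma_finite_measure set X -> \bar R})
    (P : probability T R) (N : set (X * T)) : measurable N ->
  (forall x, P [set w | N (x, w)] = 0%E) ->
  {ae P, forall w, mu.-negligible [set x | N (x, w)]}.
Proof.
move=> mN PN.
have m1 : measurable_fun setT (fun z : X * T => (\1_N z)%:E : \bar R).
  by apply/measurable_EFinP; exact: measurable_indic.
have p1 (z : X * T) : (0 <= (\1_N z)%:E :> \bar R)%E by rewrite lee_fin.
have mxs w : measurable [set x | N (x, w)].
  have := measurable_ysection w mN; congr (measurable _).
  by apply/seteqP; split => x; rewrite /ysection /= inE.
have mys x : measurable [set w | N (x, w)].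
  have := measurable_xsection x mN; congr (measurable _).
  by apply/seteqP; split => w; rewrite /xsection /= inE.
have E w : (\int[mu]_x (\1_N (x, w))%:E = mu [set x | N (x, w)])%E.
  by rewrite -[X in mu X]setIT -integral_indic.
have E' x : (\int[P]_w (\1_N (x, w))%:E = 0)%E.
  by rewrite -(PN x) -[X in P X]setIT -integral_indic.
have int0 : (\int[P]_w `|\int[mu]_x (\1_N (x, w))%:E| = 0)%E.
  transitivity (\int[P]_w \int[mu]_x (\1_N (x, w))%:E)%E.
    by apply: eq_integral => w _; rewrite gee0_abs// integral_ge0.
  rewrite -(fubini_tonelli (fun z => (\1_N z)%:E))//.
  by under eq_integral do rewrite E'; rewrite integral0.
have mF : measurable_fun setT (fun w => \int[mu]_x (\1_N (x, w))%:E)%E.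
  exact: (measurable_fun_fubini_tonelli_G (fun z => (\1_N z)%:E)).
have [+ _] := ae_eq_integral_abs P measurableT mF.
move=> /(_ int0); apply: filterS => w /(_ I); rewrite E /= => Nw.
exact/negligibleP.
Qed.

Section subordinator.
Context {R : realType} d (T : measurableType d) (P : probability T R).
Local Notation RT := (measurableTypeR R).
Variables (D : R) (D0 : 0 < D) (l : R -> {RV P >-> R}).
Hypothesis l_cont : forall t eps : R, 0 <= t <= D -> 0 < eps ->
  P [set w | eps < `|l s w - l t w|] @[s --> within `[0, D] (nbhs t)] --> 0%E.
Hypothesis l_mono : {ae P, forall w (x y : R), 0 <= x -> x <= y -> y <= D ->
  l x w <= l y w}.

Let lower n x := node D n.+1 (cell D n.+1 x).
Let upper n x := node D n.+1 (cell D n.+1 x).+1.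

Let cell_lt n x : (cell D n.+1 x < n.+1)%N.
Proof. by rewrite /cell ltnS geq_minr. Qed.

Let lower_itv n x : 0 <= lower n x <= D.
Proof. by rewrite node_itv// ltnW. Qed.

Let upper_itv n x : 0 <= upper n x <= D.
Proof. exact: node_itv. Qed.

Let lower_le n x : 0 <= x <= D -> lower n x <= x.
Proof.
move=> xD; have [_ /andP[c1 _]] := cell_itv D0 (ltn0Sn n) xD.
rewrite /lower /node ler_pdivrMr ?ltr0n//.
by move: c1; rewrite ler_pdivlMr.
Qed.

Let upper_ge n x : 0 <= x <= D -> x <= upper n x.
Proof.
move=> xD; have [_ /andP[_ c1]] := cell_itv D0 (ltn0Sn n) xD.
rewrite /upper /node ler_pdivlMr ?ltr0n//.
by move: c1; rewrite ler_pdivrMr.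
Qed.

Let measurable_at (c : nat -> R) (n : nat) :
  measurable_fun setT (fun z : RT * T => l (c (cell D n.+1 z.1)) z.2).
Proof.
have mc : measurable_fun setT (fun z : RT * T => cell D n.+1 z.1).
  exact: measurableT_comp (@measurable_cell R D n.+1) measurable_fst.
apply: (@measurable_fun_countable_index _ _ _ _ _ (fun i z => l (c i) z.2) mc) => i.
exact: measurableT_comp.
Qed.

Let cvg_within (u : nat -> R) (x : R) : (forall n, 0 <= u n <= D) ->
  u n @[n --> \oo] --> x -> u n @[n --> \oo] --> within `[0, D] (nbhs x).
Proof.
move=> uD ux A wA.
have uA : \forall n \near \oo, `[0, D]%classic (u n) -> A (u n).
  exact: (ux _ wA).
change (\forall n \near \oo, A (u n)).
by apply: filterS uA => n; apply; rewrite /= in_itv/= uD.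
Qed.

Let dist_cvg (u : nat -> R) (x : R) : (forall n, `|x - u n| <= D / n.+1%:R) ->
  u n @[n --> \oo] --> x.
Proof.
move=> ux; have h : (D * n.+1%:R^-1) @[n --> \oo] --> (0 : R).
  by rewrite -[0](mulr0 D); apply: cvgM; [exact: cvg_cst|exact: cvg_harmonic].
apply/cvgrPdist_le => e e0; move/cvgrPdist_le/(_ e e0): h.
apply: filterS => n /= h; apply: le_trans (ux n) _.
by rewrite (le_trans (ler_norm _))// -normrN -sub0r.
Qed.

(** The event that the gap exceeds eps does not depend on n and is contained in the
    event |l(u_n) - l(x)| > eps, whose probability tends to 0. *)
Let no_gap (u : nat -> R) (x : R) (gap : T -> R) : 0 <= x <= D ->
  (forall n, 0 <= u n <= D) -> u n @[n --> \oo] --> x ->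
  measurable_fun setT gap ->
  {ae P, forall w n, gap w <= `|l (u n) w - l x w|} ->
  {ae P, forall w, gap w <= 0}.
Proof.
move=> xD uD ux mgap gapl.
have mset (eps : R) : measurable [set w | eps < gap w].
  rewrite (_ : [set w | eps < gap w] = setT `&` gap @^-1` `]eps, +oo[); first exact: mgap.
  by rewrite setTI; apply/seteqP; split => w /=; rewrite in_itv/= andbT.
have P0 k : P [set w | k.+1%:R^-1 < gap w] = 0%E.
  have k0 : 0 < k.+1%:R^-1 :> R by rewrite invr_gt0.
  have v0 : P [set w | k.+1%:R^-1 < `|l (u n) w - l x w|] @[n --> \oo] --> 0%E.
    apply: (@cvg_comp _ _ _ u (fun s => P [set w | k.+1%:R^-1 < `|l s w - l x w|])
      _ (within `[0, D] (nbhs x))); [exact: cvg_within|exact: l_cont].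
  apply/eqP; rewrite eq_le measure_ge0 andbT -(cvg_lim _ v0)//.
  apply: lime_ge; first by apply/cvg_ex; exists 0%E.
  apply: nearW => n; have [N [mN N0 sN]] := gapl.
  have ml : measurable [set w | k.+1%:R^-1 < `|l (u n) w - l x w|].
    rewrite (_ : [set w | _] = setT `&` (fun w => `|l (u n) w - l x w|) @^-1` `]k.+1%:R^-1, +oo[).
      have : measurable_fun setT (fun w => `|l (u n) w - l x w|).
        by apply: measurableT_comp => //; exact: measurable_funB.
      exact.
    by rewrite setTI; apply/seteqP; split => w /=; rewrite in_itv/= andbT.
  apply: (@le_trans _ _ (P ([set w | k.+1%:R^-1 < `|l (u n) w - l x w|] `|` N))).
    apply: le_measure; rewrite ?inE//; first exact: measurableU.
    move=> w /= h; have [Nw|Nw] := pselect (N w); first by right.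
    left; apply: lt_le_trans h _; apply: contrapT => h'; apply: Nw; apply: sN.
    by move=> h''; apply: h'; exact: h''.
  apply: (le_trans (measureU2 P ml mN)).
  by rewrite [X in (_ + X)%E](_ : _ = 0%E) ?adde0.
have : {ae P, forall w (k : nat), gap w <= k.+1%:R^-1}.
  apply: ae_foralln => k; exists [set w | k.+1%:R^-1 < gap w]; split => //; first exact: P0.
  by move=> w /= /negP; rewrite -ltNge.
apply: filterS => w gw; apply/ler_addgt0Pr => eps eps0; rewrite add0r.
have := gw (Num.truncn eps^-1); move=> /le_trans; apply.
by rewrite invf_ple ?posrE// ltW// truncnS_gt.
Qed.

(** A supremum and an infimum over countably many grid approximations are jointly
    measurable; monotone paths lie between them, and [no_gap] shows that at each
    fixed time both agree with the path almost surely. *)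
Lemma subordinator_sandwich : exists lo up : RT * T -> R,
  [/\ measurable_fun setT lo, measurable_fun setT up,
    {ae P, forall w x, 0 <= x <= D -> lo (x, w) <= l x w <= up (x, w)} &
    forall x, 0 <= x <= D ->
      {ae P, forall w, lo (x, w) = l x w /\ up (x, w) = l x w}].
Proof.
have [N [mN N0 sN]] := l_mono.
have mono w x y : ~ N w -> 0 <= x -> x <= y -> y <= D -> l x w <= l y w.
  move=> Nw; apply: contrapT => h; apply: Nw; apply: sN => h'; apply: h.
  exact: h'.
pose g (c : nat -> nat -> R) n (z : RT * T) :=
  l (c n (cell D n.+1 z.1)) z.2 * \1_(~` N) z.2.
pose cl n i := node D n.+1 i.
pose cu n i := node D n.+1 i.+1.
have mg c n : measurable_fun setT (g c n).
  apply: measurable_funM; first exact: measurable_at.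
  apply: (measurableT_comp _ measurable_snd).
  by apply: measurable_indic; exact: measurableC.
have gE c n x w : ~ N w -> g c n (x, w) = l (c n (cell D n.+1 x)) w.
  by move=> Nw; rewrite /g /= indicE mem_set ?mulr1.
have gN c n x w : N w -> g c n (x, w) = 0.
  by move=> Nw; rewrite /g /= indicE memNset ?mulr0// => /(_ Nw).
have ub (z : RT * T) : has_ubound [set g cl i z | i in [set: nat]].
  case: z => x w; have [Nw|Nw] := pselect (N w).
    by exists 0 => _ [n _ <-]; rewrite gN.
  exists (l D w) => _ [n _ <-]; rewrite gE//.
  by have /andP[a b] := lower_itv n x; exact: mono.
have lb (z : RT * T) : has_lbound [set g cu i z | i in [set: nat]].
  case: z => x w; have [Nw|Nw] := pselect (N w).
    by exists 0 => _ [n _ <-]; rewrite gN.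
  exists (l 0 w) => _ [n _ <-]; rewrite gE//.
  by have /andP[a b] := upper_itv n x; exact: mono.
pose lo z := sups (g cl ^~ z) 0.
pose up z := infs (g cu ^~ z) 0.
have mlo : measurable_fun setT lo.
  by apply: measurable_fun_sups => [z _|n]; [exact: ub|exact: mg].
have mup : measurable_fun setT up.
  by apply: measurable_fun_infs => [z _|n]; [exact: lb|exact: mg].
have lo_ge n z : g cl n z <= lo z.
  apply: sup_upper_bound; last by exists n.
  split; first by exists (g cl 0%N z); exists 0%N.
  by have [y hy] := ub z; exists y => _ [m _ <-]; apply: hy; exists m.
have up_le n z : up z <= g cu n z.
  apply: ge_inf; last by exists n.
  by have [y hy] := lb z; exists y => _ [m _ <-]; apply: hy; exists m.
have lo_le x w : ~ N w -> 0 <= x <= D -> lo (x, w) <= l x w.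
  move=> Nw xD; apply: ge_sup; first by exists (g cl 0%N (x, w)); exists 0%N.
  move=> _ [n _ <-]; rewrite gE//; have /andP[a _] := lower_itv n x.
  apply: mono => //; [exact: lower_le|by case/andP: xD].
have up_ge x w : ~ N w -> 0 <= x <= D -> l x w <= up (x, w).
  move=> Nw xD; apply: lb_le_inf; first by exists (g cu 0%N (x, w)); exists 0%N.
  move=> _ [n _ <-]; rewrite gE//; have /andP[_ a] := upper_itv n x.
  apply: mono => //; [by case/andP: xD|exact: upper_ge].
have PN : P.-negligible N by exists N; split.
exists lo, up; split => //.
  by exists N; split => // w /= h; apply: contrapT => Nw; apply: h => x xD;
    rewrite lo_le// up_ge.
move=> x xD.
have glo : {ae P, forall w, l x w - lo (x, w) <= 0}.
  apply: (@no_gap (fun n => lower n x) x) => //.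
  - by apply: dist_cvg => n; exact: node_cell_dist.
  - apply: measurable_funB => //; exact: (measurable_fun_pair2 (x : RT) mlo).
  - exists N; split => // w /= h; apply: contrapT => Nw; apply: h => n.
    rewrite distrC (le_trans _ (ler_norm _))// lerB//.
    by have := lo_ge n (x, w); rewrite gE.
have gup : {ae P, forall w, up (x, w) - l x w <= 0}.
  apply: (@no_gap (fun n => upper n x) x) => //.
  - by apply: dist_cvg => n; exact: node_cellS_dist.
  - apply: measurable_funB => //; exact: (measurable_fun_pair2 (x : RT) mup).
  - exists N; split => // w /= h; apply: contrapT => Nw; apply: h => n.
    rewrite (le_trans _ (ler_norm _))// lerB//.
    by have := up_le n (x, w); rewrite gE.
have Lnorm2_mul : {ae P, forall w, ~ N w} by exists N; split => // w /contrapT.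
near=> w; have Nw : ~ N w by near: w.
have a : l x w - lo (x, w) <= 0 by near: w.
have b : up (x, w) - l x w <= 0 by near: w.
by split; apply/eqP; rewrite eq_le ?lo_le// ?up_ge// ?andbT -subr_le0.
Unshelve. all: by end_near. Qed.

End subordinator.

(** * Elementary inequalities and bilinear interpolation *)

Section elementary.
Context {R : realType}.

Lemma ex_max_finType (I : finType) (i0 : I) (a : I -> R) : exists i, forall j, a j <= a i.
Proof.
case: (@Order.TotalTheory.arg_maxP _ _ I i0 xpredT a isT) => i _ h.
by exists i => j; exact: h.
Qed.

Lemma sum_le_card_max (I : finType) (i : I) (a : I -> R) :
  (forall j, a j <= a i) -> \sum_j a j <= #|I|%:R * a i.
Proof.
move=> ai; rewrite mulr_natl.
have -> : a i *+ #|I| = \sum_(j : I) a i by rewrite sumr_const.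
by apply: ler_sum => j _; exact: ai.
Qed.

Lemma powR_sum_le (I : finType) (a : I -> R) (s : R) : 0 < s ->
  (forall i, 0 <= a i) ->
  (\sum_i a i) `^ s <= (#|I|%:R) `^ s * \sum_i (a i) `^ s.
Proof.
move=> s0 a0.
have sum0 : 0 <= \sum_i (a i) `^ s by rewrite sumr_ge0// => i _; exact: powR_ge0.
have [/existsP[i0 _]|/existsPn I0] := boolP [exists i : I, true]; last first.
  rewrite big1 => [|i _]; last by have := I0 i.
  by rewrite powR0 ?gt_eqF// mulr_ge0// powR_ge0.
have [i ai] := ex_max_finType i0 a.
apply: (@le_trans _ _ ((#|I|%:R * a i) `^ s)).
  apply: (ge0_ler_powR (ltW s0)); rewrite ?nnegrE ?sumr_ge0 ?mulr_ge0//.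
  exact: sum_le_card_max.
rewrite powRM// ler_wpM2l ?powR_ge0//.
by rewrite (bigD1 i)//= lerDl sumr_ge0// => j _; exact: powR_ge0.
Qed.

(** Bounding the sum by its largest term avoids Hoelder's inequality for several
    factors. *)
Lemma expR_sum_le (I : finType) (i0 : I) (a : I -> R) (k : R) : 0 <= k ->
  expR (k * \sum_i a i) <= \sum_i expR (k * #|I|%:R * a i).
Proof.
move=> k0; have [i ai] := ex_max_finType i0 a.
apply: (@le_trans _ _ (expR (k * #|I|%:R * a i))).
  by rewrite ler_expR -mulrA ler_wpM2l// sum_le_card_max.
by rewrite (bigD1 i)//= lerDl sumr_ge0// => j _; exact: expR_ge0.
Qed.

Lemma mul_le_weighted_sq (th a b : R) : 0 < th ->
  a * b <= th * a ^+ 2 + th^-1 * b ^+ 2.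
Proof.
move=> th0; rewrite -subr_ge0.
have -> : th * a ^+ 2 + th^-1 * b ^+ 2 - a * b =
    th * (a - th^-1 * b / 2) ^+ 2 + th^-1 * (3 / 4 * b ^+ 2).
  by field; rewrite gt_eqF.
by rewrite addr_ge0// mulr_ge0 ?invr_ge0 ?(ltW th0) ?sqr_ge0// mulr_ge0 ?sqr_ge0.
Qed.

(** Mean value theorem; an intermediate point satisfies |c| <= |x| + |y|. *)
Lemma exp_growth_lipschitz (F : R -> R) (phi psi : R) : 0 < phi -> 0 < psi ->
  (forall x, derivable F x 1) -> continuous F ->
  (forall x, `|F^`()%classic x| <= phi * expR (psi * `|x|)) ->
  forall x y, `|F x - F y| <= phi * expR (psi * (`|x| + `|y|)) * `|x - y|.
Proof.
move=> phi0 psi0 dF cF growth.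
have main x y : x <= y ->
    `|F x - F y| <= phi * expR (psi * (`|x| + `|y|)) * `|x - y|.
  move=> xy; have dFx z : z \in `]x, y[ -> is_derive z (1 : R) F (F^`()%classic z).
    by move=> _; rewrite derive1E; exact/derivableP.
  have cFx : {within `[x, y], continuous F} by exact: continuous_subspaceT.
  have [c /itvP cxy FE] := MVT_segment xy dFx cFx.
  rewrite distrC FE normrM [`|x - y|]distrC ler_wpM2r//.
  apply: (le_trans (growth c)); rewrite ler_wpM2l ?(ltW phi0)// ler_expR ler_wpM2l ?(ltW psi0)//.
  rewrite ler_norml; apply/andP; split.
    rewrite -[leRHS]opprK lerN2 (le_trans (y := - x)) ?lerN2 ?cxy//.
    by rewrite (le_trans (ler_norm _))// normrN lerDl.
  by rewrite (le_trans (y := y)) ?cxy// (le_trans (ler_norm _))// lerDr.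
move=> x y; have [xy|/ltW yx] := leP x y; first exact: main.
by rewrite distrC [`|x - y|]distrC [`|x| + _]addrC; exact: main.
Qed.

End elementary.

Section moment_tools.
Context d (T : measurableType d) (R : realType).
Variable mu : {measure set T -> \bar R}.

Lemma integral_scale_le (f : T -> R) (k c : R) : 0 <= k ->
  measurable_fun setT f -> (forall w, 0 <= f w) ->
  (\int[mu]_w (f w)%:E <= c%:E)%E ->
  (\int[mu]_w (k * f w)%:E <= (k * c)%:E)%E.
Proof.
move=> k0 mf f0 fc; under eq_integral do rewrite EFinM.
have p w : setT w -> (0 <= (f w)%:E)%E by rewrite lee_fin.
have m : measurable_fun setT (fun w => (f w)%:E) by exact/measurable_EFinP.
by rewrite ge0_integralZl// EFinM lee_wpmul2l.
Qed.

Lemma integral_add_le (f g : T -> R) (c c' : R) :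
  measurable_fun setT f -> (forall w, 0 <= f w) ->
  measurable_fun setT g -> (forall w, 0 <= g w) ->
  (\int[mu]_w (f w)%:E <= c%:E)%E -> (\int[mu]_w (g w)%:E <= c'%:E)%E ->
  (\int[mu]_w (f w + g w)%:E <= (c + c')%:E)%E.
Proof.
move=> mf f0 mg g0 fc gc; under eq_integral do rewrite EFinD.
have p w : setT w -> (0 <= (f w)%:E)%E by rewrite lee_fin.
have p' w : setT w -> (0 <= (g w)%:E)%E by rewrite lee_fin.
have m : measurable_fun setT (fun w => (f w)%:E) by exact/measurable_EFinP.
have m' : measurable_fun setT (fun w => (g w)%:E) by exact/measurable_EFinP.
by rewrite ge0_integralD// EFinD leeD.
Qed.

Lemma integral_sum_le (I : finType) (f : I -> T -> R) (c : R) :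
  (forall i, measurable_fun setT (f i)) -> (forall i w, 0 <= f i w) ->
  (forall i, (\int[mu]_w (f i w)%:E <= c%:E)%E) ->
  (\int[mu]_w (\sum_i f i w)%:E <= (#|I|%:R * c)%:E)%E.
Proof.
move=> mf f0 fc; under eq_integral do rewrite -sumEFin.
have p i w : setT w -> (0 <= (f i w)%:E)%E by rewrite lee_fin.
have m i : measurable_fun setT (fun w => (f i w)%:E) by exact/measurable_EFinP.
rewrite ge0_integral_sum// (@le_trans _ _ (\sum_(i : I) c%:E)%E)//.
  by apply: lee_sum => i _.
by rewrite sumEFin lee_fin sumr_const mulr_natl.
Qed.

End moment_tools.

Section interpolation.
Context {R : realType}.
Local Notation RT := (measurableTypeR R).
Variables (L : R) (n : nat) (L0 : 0 < L) (n0 : (0 < n)%N).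

Definition corner (b : bool * bool) (p : R * R) : R * R :=
  (node L n (cell L n p.1 + b.1)%N, node L n (cell L n p.2 + b.2)%N).

Lemma corner_csquare b p : csquare L p -> csquare L (corner b p).
Proof.
move=> [p1 p2].
have [c1 _] := cell_itv L0 n0 p1; have [c2 _] := cell_itv L0 n0 p2.
by split; apply: node_itv => //; case: b => -[] [] /=; rewrite ?addn0 ?addn1 ?(ltnW c1) ?(ltnW c2).
Qed.

Lemma corner_dist b p : csquare L p -> dist1 p (corner b p) <= 2 * (L / n%:R).
Proof.
move=> [p1 p2].
have h x (c : bool) : 0 <= x <= L -> `|x - node L n (cell L n x + c)| <= L / n%:R.
  by case: c => xL; rewrite ?addn1 ?addn0; [exact: node_cellS_dist|exact: node_cell_dist].
have := h _ b.1 p1; have := h _ b.2 p2; rewrite /dist1 /=; set y := L / _; lra.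
Qed.

(** The interpolant is a convex combination of the corner values. *)
Lemma bilinear_interp_dist (w : R * R -> R) (c : R) p : csquare L p ->
  `|c - bilinear_interp L n w p| <= \sum_(b : bool * bool) `|c - w (corner b p)|.
Proof.
move=> [p1 p2]; rewrite /bilinear_interp.
have h x : 0 <= x <= L ->
    0 <= x * n%:R / L - (cell L n x)%:R <= 1.
  by move=> /(cell_itv L0 n0)[_ /andP[]]; rewrite -natr1; lra.
have /andP[] := h _ p1; have /andP[] := h _ p2.
set u := p.1 * _ / _ - _; set v := p.2 * _ / _ - _ => v0 v1 u0 u1.
rewrite -(pair_bigA _ (fun b1 b2 => `|c - w (corner (b1, b2) p)|)) /= !big_bool /=.
rewrite /corner /= !addn0 !addn1.
set w00 := w (node _ _ (cell _ _ _), node _ _ (cell _ _ _)).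
set w10 := w (node _ _ (cell _ _ _).+1, node _ _ (cell _ _ _)).
set w01 := w (node _ _ (cell _ _ _), node _ _ (cell _ _ _).+1).
set w11 := w (node _ _ (cell _ _ _).+1, node _ _ (cell _ _ _).+1).
have -> : c - ((1 - u) * (1 - v) * w00 + u * (1 - v) * w10 + (1 - u) * v * w01 +
    u * v * w11) = (1 - u) * (1 - v) * (c - w00) + u * (1 - v) * (c - w10) +
    (1 - u) * v * (c - w01) + u * v * (c - w11) by ring.
have t (x y z : R) : 0 <= x <= 1 -> 0 <= y <= 1 -> `|x * y * z| <= `|z|.
  move=> /andP[x0 x1] /andP[y0 y1]; rewrite normrM ger0_norm ?mulr_ge0//.
  by rewrite ler_piMl// mulr_ile1.
have Hu : 0 <= u <= 1 by rewrite u0.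
have Hv : 0 <= v <= 1 by rewrite v0.
have Hu' : 0 <= 1 - u <= 1 by lra.
have Hv' : 0 <= 1 - v <= 1 by lra.
have := t _ _ (c - w00) Hu' Hv'; have := t _ _ (c - w10) Hu Hv'.
have := t _ _ (c - w01) Hu' Hv; have := t _ _ (c - w11) Hu Hv.
set a1 := (1 - u) * (1 - v) * _; set a2 := u * (1 - v) * _.
set a3 := (1 - u) * v * _; set a4 := u * v * _.
have := ler_normD (a1 + a2 + a3) a4; have := ler_normD (a1 + a2) a3.
have := ler_normD a1 a2; lra.
Qed.

Lemma bilinear_interp_norm_le (w : R * R -> R) p : csquare L p ->
  `|bilinear_interp L n w p| <= \sum_(b : bool * bool) `|w (corner b p)|.
Proof.
move=> /(bilinear_interp_dist w 0); rewrite sub0r normrN.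
by under eq_bigr do rewrite sub0r normrN.
Qed.

Lemma measurable_node_cell (c : nat) :
  measurable_fun setT (fun x : RT => node L n (cell L n x + c) : RT).
Proof.
have := @measurable_fun_countable_index _ _ RT RT (cell L n)
  (fun i _ => node L n (i + c)) (@measurable_cell R L n).
by apply => i; exact: measurable_cst.
Qed.

Lemma measurable_corner b :
  measurable_fun setT (corner b : (RT * RT)%type -> (RT * RT)%type).
Proof.
apply: measurable_fun_pair.
- exact: (measurableT_comp (@measurable_node_cell b.1) measurable_fst).
- exact: (measurableT_comp (@measurable_node_cell b.2) measurable_snd).
Qed.

End interpolation.

(** * Interpolation error of a transformed field *)

Section transformed_field.
Context {R : realType} d (T : measurableType d) (P : probability T R).
Variables (L : R) (L0 : 0 < L) (W : R * R -> {RV P >-> R}).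
Variables (s gamma C2 : R).
Hypotheses (s0 : 0 < s) (g0 : 0 < gamma) (C20 : 0 < C2).
Hypothesis W_exp : forall k : R, 0 <= k -> exists2 C : R, 0 < C &
  forall p, csquare L p -> (\int[P]_w (expR (k * `|W p w|))%:E <= C%:E)%E.
Hypothesis W_inc : forall p p', csquare L p -> csquare L p' ->
  (\int[P]_w (`|W p w - W p' w| `^ (2 * s))%:E <=
   (C2 * dist1 p p' `^ (2 * s * gamma))%:E)%E.
Variables (F : R -> R) (phi psi : R).
Hypotheses (phi0 : 0 < phi) (psi0 : 0 < psi).
Hypothesis F_lip : forall x y,
  `|F x - F y| <= phi * expR (psi * (`|x| + `|y|)) * `|x - y|.

Local Notation quad := (bool * bool)%type.

Lemma powR_sqr (x r : R) : (x `^ r) ^+ 2 = x `^ (2 * r).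
Proof. by rewrite -powR_mulrn ?powR_ge0// -powRrM mulrC. Qed.

(** The local Lipschitz constant of F and the increments both are random; the
    weighted inequality a b <= th a^2 + b^2 / th separates them and leaves th free,
    to be matched with the size of the increments. *)
Lemma transform_error_pointwise (x y th : R) (X : quad -> R) : 0 < th ->
  `|y| <= \sum_b `|X b| -> `|x - y| <= \sum_b `|x - X b| ->
  `|F x - F y| `^ s <= phi `^ s *
    (th * (expR (4 * s * psi * `|x|) + \sum_b expR (16 * s * psi * `|X b|)) +
     th^-1 * 4 `^ (2 * s) * (\sum_b `|x - X b| `^ (2 * s))).
Proof.
move=> th0 yX xyX.
set sX := \sum_b `|X b| in yX *; set q := \sum_b `|x - X b| in xyX *.
have q0 : 0 <= q by rewrite sumr_ge0.
have s20 : 0 < 2 * s by rewrite mulr_gt0.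
have card4 : #|{: quad}|%:R = 4 :> R by rewrite card_prod card_bool.
apply: (@le_trans _ _ (phi `^ s * (expR (s * psi * (`|x| + sX)) * q `^ s))).
  rewrite -[s * psi * _]mulrA [s * (psi * _)]mulrC expRM.
  rewrite -!powRM ?mulr_ge0 ?expR_ge0 ?(ltW phi0)//.
  apply: (ge0_ler_powR (ltW s0)); rewrite ?nnegrE ?mulr_ge0 ?expR_ge0 ?(ltW phi0)//.
  rewrite mulrA (le_trans (F_lip _ _))// ler_pM// ?mulr_ge0 ?expR_ge0 ?(ltW phi0)//.
  by rewrite ler_wpM2l ?(ltW phi0)// ler_expR ler_wpM2l ?(ltW psi0)// lerD2l.
rewrite ler_wpM2l ?powR_ge0//; apply: (le_trans (mul_le_weighted_sq _ _ th0)).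
have k0 : 0 <= 4 * s * psi by rewrite !mulr_ge0 ?(ltW s0) ?(ltW psi0).
apply: lerD.
  rewrite ler_wpM2l ?(ltW th0)// -expRM_natl.
  have -> : 2 * (s * psi * (`|x| + sX)) =
      2 * s * psi * `|x| + 2 * s * psi * sX by ring.
  rewrite expRD (le_trans (mul_le_weighted_sq _ _ ltr01))// invr1 !mul1r.
  rewrite -!expRM_natl lerD//; first by rewrite ler_expR !mulrA -natrM.
  rewrite (_ : 2 * (_ * sX) = 4 * s * psi * sX); last by ring.
  apply: (le_trans (expR_sum_le (true, true) (fun b => `|X b|) k0)).
  by rewrite card4; apply: ler_sum => b _; rewrite le_eqVlt; apply/orP; left;
     apply/eqP; congr expR; ring.
rewrite -mulrA ler_wpM2l ?invr_ge0 ?(ltW th0)// powR_sqr.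
have := @powR_sum_le _ quad (fun b => `|x - X b|) _ s20 (fun b => normr_ge0 _).
by rewrite card4.
Qed.

(** [transform_error_pointwise] with th = del^(s gamma): the exponential factors have
    bounded moments and the increments contribute del^(2 s gamma) / th. *)
Lemma field_transform_error : exists2 C : R, 0 < C &
  forall (n : nat) (del : R) p, (0 < n)%N -> 0 < del -> L / n%:R <= del ->
  csquare L p ->
  (\int[P]_w (`|F (W p w) - F (bilinear_interp L n (fun p => W p w) p)| `^ s)%:E
    <= (C * del `^ (s * gamma))%:E)%E.
Proof.
have k1 : 0 <= 4 * s * psi by rewrite !mulr_ge0 ?(ltW s0) ?(ltW psi0).
have k2 : 0 <= 16 * s * psi by rewrite !mulr_ge0 ?(ltW s0) ?(ltW psi0).
have [A1 A10 WA1] := W_exp k1; have [A2 A20 WA2] := W_exp k2.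
pose B := 4 `^ (2 * s) * (4 * (C2 * 2 `^ (2 * s * gamma))).
have B0 : 0 < B by rewrite !mulr_gt0 ?powR_gt0.
exists (phi `^ s * ((A1 + 4 * A2) + B)).
  by rewrite mulr_gt0 ?powR_gt0 ?addr_gt0 ?mulr_gt0.
move=> n del p n0 del0 ndel Lp.
pose th := del `^ (s * gamma); have th0 : 0 < th by rewrite powR_gt0.
have Lc b := corner_csquare L0 n0 b Lp.
have card4 : #|{: quad}|%:R = 4 :> R by rewrite card_prod card_bool.
have mexp k q : measurable_fun setT (fun w => expR (k * `|W q w|)).
  apply: measurableT_comp => //; apply: measurable_funM => //.
  exact: measurableT_comp.
have mpw b : measurable_fun setT (fun w => `|W p w - W (corner L n b p) w| `^ (2 * s)).
  apply: (measurableT_comp (measurable_powR _)); apply: measurableT_comp => //.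
  exact: measurable_funB.
have msum1 : measurable_fun setT
    (fun w => \sum_(b : quad) expR (16 * s * psi * `|W (corner L n b p) w|)).
  by apply: measurable_sum => b; exact: mexp.
have msum2 : measurable_fun setT
    (fun w => \sum_(b : quad) `|W p w - W (corner L n b p) w| `^ (2 * s)).
  by apply: measurable_sum => b; exact: mpw.
have p1 w : 0 <= \sum_(b : quad) expR (16 * s * psi * `|W (corner L n b p) w|).
  by apply: sumr_ge0 => b _; exact: expR_ge0.
have p2 w : 0 <= \sum_(b : quad) `|W p w - W (corner L n b p) w| `^ (2 * s).
  by apply: sumr_ge0 => b _; exact: powR_ge0.
have thB : 0 <= th^-1 * 4 `^ (2 * s) by rewrite mulr_ge0 ?powR_ge0 ?invr_ge0 ?(ltW th0).
have i1 : (\int[P]_w (expR (4 * s * psi * `|W p w|) +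
    \sum_(b : quad) expR (16 * s * psi * `|W (corner L n b p) w|))%:E <=
    (A1 + 4 * A2)%:E)%E.
  apply: integral_add_le => //; [exact: WA1|].
  rewrite -card4; apply: integral_sum_le => //.
  by move=> b; exact: WA2.
have i2 : (\int[P]_w (\sum_(b : quad) `|W p w - W (corner L n b p) w| `^ (2 * s))%:E
    <= (4 * (C2 * (2 `^ (2 * s * gamma) * th ^+ 2)))%:E)%E.
  rewrite -card4; apply: integral_sum_le => //.
  move=> b; apply: (le_trans (W_inc Lp (Lc b))); rewrite lee_fin ler_wpM2l ?(ltW C20)//.
  rewrite /th powR_sqr [2 * (s * gamma)]mulrA -powRM ?(ltW del0)//.
  apply: ge0_ler_powR; rewrite ?nnegrE ?dist1_ge0 ?mulr_ge0 ?(ltW s0) ?(ltW g0) ?(ltW del0)//.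
  by rewrite (le_trans (corner_dist L0 n0 b Lp))// ler_wpM2l.
apply: (@le_trans _ _ (\int[P]_w (phi `^ s *
    (th * (expR (4 * s * psi * `|W p w|) +
        \sum_(b : quad) expR (16 * s * psi * `|W (corner L n b p) w|)) +
     th^-1 * 4 `^ (2 * s) *
        (\sum_(b : quad) `|W p w - W (corner L n b p) w| `^ (2 * s))))%:E)%E).
  apply: le_integral_outer.
  - by move=> w; rewrite lee_fin powR_ge0.
  - move=> w; rewrite lee_fin; apply: mulr_ge0; first exact: powR_ge0.
    apply: addr_ge0; last exact: mulr_ge0 thB (p2 w).
    exact: mulr_ge0 (ltW th0) (addr_ge0 (expR_ge0 _) (p1 w)).
  - apply/measurable_EFinP; apply: measurable_funM => //.
    apply: measurable_funD; apply: measurable_funM => //.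
    exact: measurable_funD.
  - apply: aeW => w; rewrite lee_fin; apply: transform_error_pointwise => //.
      exact: bilinear_interp_norm_le.
    exact: bilinear_interp_dist.
rewrite -(mulrA (phi `^ s)).
have m1 : measurable_fun setT (fun w => expR (4 * s * psi * `|W p w|) +
    \sum_(b : quad) expR (16 * s * psi * `|W (corner L n b p) w|)).
  exact: measurable_funD.
have q1 w : 0 <= expR (4 * s * psi * `|W p w|) +
    \sum_(b : quad) expR (16 * s * psi * `|W (corner L n b p) w|).
  by rewrite addr_ge0 ?expR_ge0.
apply: integral_scale_le; rewrite ?powR_ge0//.
- by apply: measurable_funD; apply: measurable_funM.
- move=> w; exact: (addr_ge0 (mulr_ge0 (ltW th0) (q1 w)) (mulr_ge0 thB (p2 w))).
have -> : (A1 + 4 * A2 + B) * del `^ (s * gamma) = th * (A1 + 4 * A2) +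
    th^-1 * 4 `^ (2 * s) * (4 * (C2 * (2 `^ (2 * s * gamma) * th ^+ 2))).
  by rewrite /B -/th; field; rewrite gt_eqF.
apply: integral_add_le.
- exact: measurable_funM.
- by move=> w; exact: mulr_ge0 (ltW th0) (q1 w).
- exact: measurable_funM.
- by move=> w; exact: mulr_ge0 thB (p2 w).
- by apply: integral_scale_le => //; exact: ltW.
- exact: integral_scale_le.
Qed.

End transformed_field.

(** * Interpolation error at random points, and Bochner norms *)

Section interpolation_at_random_points.
Context {R : realType} d (T : measurableType d) (P : probability T R).
Local Notation RT := (measurableTypeR R).
Variables (L : R) (L0 : 0 < L) (W : R * R -> {RV P >-> R}).
Variables (Om : set T) (gOm : good_set L W Om).
Variable H : set (set T).
Hypothesis WH : process_events (csquare L) (fun p => W p : T -> R) `<=` H.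
Variables (s r C : R).
Hypotheses (s0 : 0 < s) (r0 : 0 < r) (C0 : 0 < C).
Hypothesis W_moment : forall p p', csquare L p -> csquare L p' ->
  (\int[P]_w (`|W p w - W p' w| `^ s)%:E <= (C * dist1 p p' `^ r)%:E)%E.

Local Notation quad := (bool * bool)%type.
Local Notation Z := (version L W Om).

Lemma sub_measurable_comp (F : set (set T)) (X : T -> R) (h : RT -> RT) :
  measurable_fun setT h -> sub_measurable F X -> sub_measurable F (h \o X).
Proof.
move=> mh FX B mB; rewrite comp_preimage; apply: FX.
by rewrite -[X in measurable X]setTI; exact: mh.
Qed.

Lemma dist1_tri (p q z : R * R) : dist1 p z <= dist1 p q + dist1 q z.
Proof.
rewrite /dist1; have := ler_distD q.1 p.1 z.1; have := ler_distD q.2 p.2 z.2; lra.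
Qed.

Lemma powR_add_le (x y a : R) : 0 < a -> 0 <= x -> 0 <= y ->
  (x + y) `^ a <= 2 `^ a * (x `^ a + y `^ a).
Proof.
move=> a0 x0 y0.
have := @powR_sum_le R bool (fun b => if b then x else y) a a0.
by rewrite card_bool !big_bool /=; apply => -[].
Qed.

(** The interpolant at V is a combination of values at the four corners around V,
    which are again points independent of the field, at distance at most 2 del from
    V. The constant does not depend on G, hence not on the approximate processes. *)
Lemma random_interpolation_moment : exists2 K : R, 0 < K &
  forall (G : set (set T)), independent_families P G H ->
  forall (n : nat) (del B : R) (U V : T -> R * R),
  (0 < n)%N -> 0 < del -> L / n%:R <= del -> 0 <= B ->
  (forall w, csquare L (U w)) -> (forall w, csquare L (V w)) ->
  measurable_fun setT (U : T -> RT * RT) ->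
  measurable_fun setT (V : T -> RT * RT) ->
  sub_measurable G (fun w => (U w).1) -> sub_measurable G (fun w => (U w).2) ->
  sub_measurable G (fun w => (V w).1) -> sub_measurable G (fun w => (V w).2) ->
  (\int[P]_w (dist1 (U w) (V w) `^ r)%:E <= B%:E)%E ->
  (\int[P]_w (`|Z (U w, w) - bilinear_interp L n (fun p => Z (p, w)) (V w)| `^ s)%:E
    <= (K * (B + del `^ r))%:E)%E.
Proof.
pose K := 4 `^ s * (4 * (C * (2 `^ r * (2 * (2 `^ r * 2 `^ r))))).
exists K; first by rewrite !mulr_gt0 ?powR_gt0.
move=> G GH n del B U V n0 del0 ndel B0 UL VL mU mV GU1 GU2 GV1 GV2 distB.
have card4 : #|{: quad}|%:R = 4 :> R by rewrite card_prod card_bool.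
pose Vc b w := corner L n b (V w).
have VcL b w : csquare L (Vc b w) by exact: corner_csquare.
have mVc b : measurable_fun setT (Vc b : T -> RT * RT).
  exact: measurableT_comp (@measurable_corner _ L n b) mV.
have mZ : measurable_fun setT Z by exact: measurable_version.
have mZc (Q : T -> R * R) : measurable_fun setT (Q : T -> RT * RT) ->
    measurable_fun setT (fun w => Z (Q w, w)).
  move=> mQ; apply: (measurableT_comp mZ).
  exact: (measurable_fun_pair (f := (Q : T -> (RT * RT)%type)) mQ (@measurable_id _ T setT)).
have mdist : measurable_fun setT (fun w => dist1 (U w) (V w)).
  have mU1 : measurable_fun setT (fun w => (U w).1) by exact: measurableT_comp measurable_fst mU.
  have mU2 : measurable_fun setT (fun w => (U w).2) by exact: measurableT_comp measurable_snd mU.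
  have mV1 : measurable_fun setT (fun w => (V w).1) by exact: measurableT_comp measurable_fst mV.
  have mV2 : measurable_fun setT (fun w => (V w).2) by exact: measurableT_comp measurable_snd mV.
  by apply: measurable_funD; apply: measurableT_comp => //; exact: measurable_funB.
have mdr : measurable_fun setT (fun w => dist1 (U w) (V w) `^ r).
  exact: (measurableT_comp (measurable_powR _) mdist).
have d2 : 0 < 2 * del by rewrite mulr_gt0.
have dr0 : 0 < (2 * del) `^ r by rewrite powR_gt0.
have distc b : (\int[P]_w (dist1 (U w) (Vc b w) `^ r)%:E <=
    (2 `^ r * (B + (2 * del) `^ r))%:E)%E.
  apply: (@le_trans _ _ (\int[P]_w
     (2 `^ r * (dist1 (U w) (V w) `^ r + (2 * del) `^ r))%:E)%E).
    apply: le_integral_outer.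
    - by move=> w; rewrite lee_fin powR_ge0.
    - by move=> w; rewrite lee_fin mulr_ge0 ?addr_ge0 ?powR_ge0.
    - apply/measurable_EFinP; apply: measurable_funM => //.
      exact: measurable_funD.
    - apply: aeW => w; rewrite lee_fin.
      apply: le_trans (powR_add_le r0 (dist1_ge0 _ _) (ltW d2)).
      apply: (ge0_ler_powR (ltW r0)); rewrite ?nnegrE ?addr_ge0 ?dist1_ge0 ?(ltW d2)//.
      apply: (le_trans (dist1_tri _ (V w) _)); rewrite lerD2l.
      by rewrite (le_trans (corner_dist L0 n0 b (VL w)))// ler_wpM2l.
  apply: integral_scale_le; rewrite ?powR_ge0//.
    exact: measurable_funD.
    by move=> w; rewrite addr_ge0 ?powR_ge0.
  apply: integral_add_le => //; [by move=> w; exact: powR_ge0|by move=> w; exact: ltW|].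
  by rewrite integral_cst//= (_ : P setT = 1%E) ?mule1//; exact: probability_setT.
have mom b := random_increment_moment L0 gOm GH WH s0 r0 C0 W_moment UL (VcL b)
  mU (mVc b) GU1 GU2
  (sub_measurable_comp (@measurable_node_cell _ L n b.1) GV1)
  (sub_measurable_comp (@measurable_node_cell _ L n b.2) GV2)
  (mulr_gt0 (powR_gt0 r (ltr0Sn R 1)) (ltr_wpDl B0 dr0)) (distc b).
apply: (@le_trans _ _ (\int[P]_w (4 `^ s *
   (\sum_(b : quad) `|Z (U w, w) - Z (Vc b w, w)| `^ s))%:E)%E).
  apply: le_integral_outer.
  - by move=> w; rewrite lee_fin powR_ge0.
  - move=> w; rewrite lee_fin mulr_ge0 ?powR_ge0// sumr_ge0// => b _; exact: powR_ge0.
  - apply/measurable_EFinP; apply: measurable_funM => //.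
    apply: measurable_sum => b; apply: (measurableT_comp (measurable_powR _)).
    by apply: measurableT_comp => //; apply: measurable_funB; exact: mZc.
  - apply: aeW => w; rewrite lee_fin.
    have := @powR_sum_le R quad (fun b => `|Z (U w, w) - Z (Vc b w, w)|) s s0
      (fun b => normr_ge0 _).
    rewrite card4; apply: le_trans; apply: (ge0_ler_powR (ltW s0)); rewrite ?nnegrE//.
      by rewrite sumr_ge0.
    exact: bilinear_interp_dist.
have mZb b : measurable_fun setT (fun w => `|Z (U w, w) - Z (Vc b w, w)| `^ s).
  apply: (measurableT_comp (measurable_powR _)).
  by apply: measurableT_comp => //; apply: measurable_funB; exact: mZc.
rewrite /K -(mulrA (4 `^ s)); apply: integral_scale_le; rewrite ?powR_ge0//.
- exact: measurable_sum.
- by move=> w; rewrite sumr_ge0// => b _; exact: powR_ge0.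
rewrite -{1}card4 -mulrA; apply: integral_sum_le => //.
move=> b; apply: (le_trans (mom b)); rewrite lee_fin -!mulrA !ler_pM2l ?powR_gt0//.
rewrite powRM ?(ltW del0)// mulrDr lerD2r ler_peMl//.
by rewrite -[leLHS](powRr0 2) ler_powR ?ler1n// ltW.
Qed.

End interpolation_at_random_points.

Section bochner.
Context dX (X : measurableType dX) d (T : measurableType d) (R : realType).
Variables (mu : {sigma_finite_measure set X -> \bar R}) (P : probability T R).
Variables (S : set X) (mS : measurable S) (m : R) (m0 : 0 <= m).
Hypothesis muS : mu S = m%:E.
Variables (t s : R) (t1 : 1 <= t) (ts : t <= s).

Let int1S : (\int[mu]_x (\1_S x)%:E = m%:E)%E.
Proof. by rewrite integral_indic// setIT; exact: muS. Qed.

(** It compares L^t with L^s on a set of finite measure without normalizing the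
    measure. *)
Lemma powR_le_1D (z : R) : 0 <= z -> z `^ t <= 1 + z `^ s.
Proof.
move=> z0; have [z1|/ltW z1] := leP z 1.
  have : z `^ t <= 1 `^ t by apply: ge0_ler_powR; rewrite ?nnegrE// (le_trans _ t1).
  by rewrite powR1 => /le_trans; apply; rewrite lerDl powR_ge0.
by rewrite (le_trans (ler_powR z1 ts))// lerDr.
Qed.

(** Rescaling h by c = (j + K)^(1/s) and applying z^t <= 1 + z^s; adding K keeps c
    positive. *)
Lemma Lp_norm_le_moment (h g : X -> R) (j K : R) : 0 < K ->
  measurable_fun setT g -> (forall x, 0 <= g x) ->
  {ae mu, forall x, S x -> `|h x| <= g x} ->
  (\int[mu]_x (g x `^ s * \1_S x)%:E = j%:E)%E ->
  (Lp_norm mu S t%:E h `^ s <= ((m + 1) `^ (s / t) * (j + K))%:E)%E.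
Proof.
move=> K0 mg g0 hg jE.
have t0 : 0 < t by exact: lt_le_trans t1.
have s0 : 0 < s by exact: lt_le_trans ts.
have j0 : 0 <= j.
  rewrite -lee_fin -jE integral_ge0// => x _.
  by rewrite lee_fin mulr_ge0 ?powR_ge0.
have jK : 0 < j + K by rewrite ltr_wpDl.
pose c := (j + K) `^ s^-1; have c0 : 0 < c by rewrite powR_gt0.
have cs : c `^ s = j + K by rewrite powR_invK// ltW.
have m1 : 0 < m + 1 by rewrite ltr_wpDl.
have mgs : measurable_fun setT (fun x => g x `^ s * \1_S x).
  apply: measurable_funM; first exact: (measurableT_comp (measurable_powR _)).
  exact: measurable_indic.
have int_t : (\int[mu]_x `|((h \_ S) x)%:E| `^ t <= (c `^ t * (m + 1))%:E)%E.
  apply: (@le_trans _ _ (\int[mu]_x (c `^ t *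
      (\1_S x + (j + K)^-1 * (g x `^ s * \1_S x)))%:E)%E).
    apply: le_integral_outer.
    - by move=> x; exact: poweR_ge0.
    - move=> x; rewrite lee_fin mulr_ge0 ?powR_ge0// addr_ge0// mulr_ge0 ?invr_ge0 ?(ltW jK)//.
      by rewrite mulr_ge0 ?powR_ge0.
    - apply/measurable_EFinP; apply: measurable_funM => //.
      apply: measurable_funD; first exact: measurable_indic.
      exact: measurable_funM.
    - apply: filterS hg => x hx; rewrite patchE indicE.
      have [Sx|Sx] := boolP (x \in S); last first.
        by rewrite abse0 poweR0r ?gt_eqF// !mulr0 addr0 mulr0.
      rewrite !mulr1 /= lee_fin.
      apply: (@le_trans _ _ (g x `^ t)).
        by apply: (ge0_ler_powR (ltW t0)); rewrite ?nnegrE// hx// -inE.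
      have gc : 0 <= g x / c by rewrite divr_ge0// ltW.
      have gE : g x = c * (g x / c) by field; rewrite gt_eqF.
      have -> : (j + K)^-1 * g x `^ s = (g x / c) `^ s.
        rewrite {1}gE powRM ?(ltW c0)// cs mulrA mulVf ?gt_eqF//.
        by rewrite mul1r.
      by rewrite {1}gE powRM ?(ltW c0)// ler_wpM2l ?powR_ge0// powR_le_1D.
  apply: integral_scale_le; rewrite ?powR_ge0//.
  - apply: measurable_funD; first exact: measurable_indic.
    exact: measurable_funM.
  - move=> x; apply: addr_ge0 => //; apply: mulr_ge0; first by rewrite invr_ge0 ltW.
    by rewrite mulr_ge0 ?powR_ge0.
  apply: (@le_trans _ _ (m + (j + K)^-1 * j)%:E); last first.
    by rewrite lee_fin lerD2l mulrC ler_pdivrMr// mul1r lerDl ltW.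
  have pgs x : 0 <= g x `^ s * \1_S x by rewrite mulr_ge0 ?powR_ge0.
  have k0 : 0 <= (j + K)^-1 by rewrite invr_ge0 ltW.
  have mi : measurable_fun setT (\1_S : X -> R) by exact: measurable_indic.
  have m2 : measurable_fun setT (fun x => (j + K)^-1 * (g x `^ s * \1_S x)).
    exact: measurable_funM.
  have p2 x : 0 <= (j + K)^-1 * (g x `^ s * \1_S x) by exact: mulr_ge0.
  have i1 : (\int[mu]_x (\1_S x)%:E <= m%:E)%E by rewrite int1S.
  have i2 : (\int[mu]_x ((j + K)^-1 * (g x `^ s * \1_S x))%:E <=
      ((j + K)^-1 * j)%:E)%E.
    by apply: integral_scale_le => //; rewrite jE.
  exact: integral_add_le.
rewrite /Lp_norm Lnorm.unlock.
have mono (x y : \bar R) a : (0 <= a)%R -> (0 <= x)%E -> (x <= y)%E -> (x `^ a <= y `^ a)%E.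
  move=> a0 x0 xy; apply: gt0_ler_poweR => //; rewrite in_itv/= ?leey ?andbT//.
  exact: le_trans xy.
have I0 : (0 <= \int[mu]_x `|((h \_ S) x)%:E| `^ t)%E.
  by apply: integral_ge0 => x _; exact: poweR_ge0.
apply: (@le_trans _ _ (((c `^ t * (m + 1))%:E `^ t^-1) `^ s)%E).
  apply: (mono); [exact: ltW|exact: poweR_ge0|].
  by apply: (mono) => //; rewrite invr_ge0 ltW.
rewrite !poweR_EFin lee_fin powRM ?powR_ge0 ?(ltW m1)//.
rewrite -powRrM mulfV ?gt_eqF// powRr1 ?(ltW c0)// powRM ?powR_ge0 ?(ltW c0)//.
by rewrite cs -powRrM [t^-1 * s]mulrC [leLHS]mulrC.
Qed.

(** Tonelli's theorem for the dominating function g, and [Lp_norm_le_moment] for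
    almost every outcome. The added 1 and K avoid the degenerate cases m = 0 and
    zero moment. *)
Lemma bochner_norm_le (F : T -> X -> R) (g : X * T -> R) (K : R) : 0 < K ->
  measurable_fun setT g -> (forall z, 0 <= g z) ->
  {ae P, forall w, {ae mu, forall x, S x -> `|F w x| <= g (x, w)}} ->
  (forall x, S x -> (\int[P]_w (g (x, w) `^ s)%:E <= K%:E)%E) ->
  (bochner_norm mu S P s%:E t%:E F <=
   ((m + 1) `^ t^-1 * ((m + 1) * K) `^ s^-1)%:E)%E.
Proof.
move=> K0 mg g0 Fg gK.
have t0 : 0 < t by exact: lt_le_trans t1.
have s0 : 0 < s by exact: lt_le_trans ts.
have m1 : 0 < m + 1 by rewrite ltr_wpDl.
pose gs (z : X * T) : \bar R := (g z `^ s * \1_S z.1)%:E.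
have gs0 z : (0 <= gs z)%E by rewrite lee_fin mulr_ge0 ?powR_ge0.
have mgs : measurable_fun setT gs.
  apply/measurable_EFinP; apply: measurable_funM.
    exact: (measurableT_comp (measurable_powR _)).
  apply: (measurableT_comp _ measurable_fst).
  exact: measurable_indic.
pose J w := (\int[mu]_x gs (x, w))%E.
have J0 w : (0 <= J w)%E by apply: integral_ge0.
have mJ : measurable_fun setT J by exact: (measurable_fun_fubini_tonelli_G gs).
have intJ : (\int[P]_w J w <= (m * K)%:E)%E.
  rewrite /J -(fubini_tonelli gs)//.
  apply: (@le_trans _ _ (\int[mu]_x (K * \1_S x)%:E)%E); last first.
    rewrite mulrC; apply: integral_scale_le => //; first exact: ltW.
    by rewrite int1S.
  apply: le_integral_outer.
  - by move=> x; exact: integral_ge0.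
  - by move=> x; rewrite lee_fin mulr_ge0// ltW.
  - by apply/measurable_EFinP; apply: measurable_funM => //; exact: measurable_indic.
  - apply: aeW => x; rewrite /gs /= indicE.
    have [Sx|Sx] := boolP (x \in S); last first.
      by rewrite mulr0; under eq_integral do rewrite mulr0; rewrite integral0.
    rewrite mulr1; under eq_integral do rewrite mulr1.
    by apply: gK; rewrite -inE.
have key : {ae P, forall w, (`|Lp_norm mu S t%:E (F w)| `^ s <=
    ((m + 1) `^ (s / t))%:E * (J w + K%:E))%E}.
  apply: filterS Fg => w Fw; rewrite gee0_abs; last exact: Lnorm_ge0.
  have [Jfin|] := ltP (J w) +oo%E; last first.
    rewrite leye_eq => /eqP ->; rewrite addye// mulry gtr0_sg ?powR_gt0// mul1e.
    exact: leey.
  have Jf : J w \is a fin_num by rewrite ge0_fin_numE.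
  rewrite -(fineK Jf) -EFinD -EFinM.
  apply: (@Lp_norm_le_moment _ (fun x => g (x, w))) => //.
  - exact: (measurable_fun_pair1 w mg).
  - by rewrite fineK.
rewrite /bochner_norm Lnorm.unlock.
apply: (@le_trans _ _ ((((m + 1) `^ (s / t) * ((m + 1) * K))%:E `^ s^-1)%E)).
  apply: gt0_ler_poweR; rewrite ?in_itv/= ?leey ?andbT ?invr_ge0 ?(ltW s0)//.
  - by apply: integral_ge0 => w _; exact: poweR_ge0.
  - by rewrite lee_fin !mulr_ge0 ?powR_ge0 ?(ltW m1) ?(ltW K0).
  apply: (@le_trans _ _ (\int[P]_w (((m + 1) `^ (s / t))%:E * (J w + K%:E)))%E).
    apply: le_integral_outer => //.
    - by move=> w; exact: poweR_ge0.
    - move=> w; apply: mule_ge0; first by rewrite lee_fin powR_ge0.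
      by apply: adde_ge0; rewrite ?lee_fin ?(ltW K0).
    - by apply: emeasurable_funM => //; exact: emeasurable_funD.
  have p1 w : setT w -> (0 <= J w)%E by [].
  have p2 w : (setT : set T) w -> (0 <= K%:E)%E by rewrite lee_fin ltW.
  have p3 w : setT w -> (0 <= J w + K%:E)%E by move=> _; rewrite adde_ge0 ?lee_fin ?(ltW K0).
  have m3 : measurable_fun setT (fun w => J w + K%:E)%E by exact: emeasurable_funD.
  have k0 : (0 <= ((m + 1) `^ (s / t))%:E)%E by rewrite lee_fin powR_ge0.
  rewrite ge0_integralZl// ge0_integralD// integral_cst//=.
  rewrite (_ : P setT = 1%E); last exact: probability_setT.
  rewrite mule1 EFinM lee_wpmul2l//.
  by rewrite mulrDl mul1r EFinD leeD2r.
rewrite poweR_EFin lee_fin powRM ?powR_ge0 ?mulr_ge0 ?(ltW m1) ?(ltW K0)//.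
rewrite -powRrM (_ : s / t / s = t^-1)//.
by field; rewrite !gt_eqF.
Qed.

End bochner.

(** * Measurability and Lipschitz bounds for the coefficient *)

Section interpolation_measurability.
Context {R : realType} dX (X : measurableType dX).
Local Notation RT := (measurableTypeR R).
Variables (L : R) (n : nat).

Lemma bilinear_interp_eq (f g : R * R -> R) p : 0 < L -> (0 < n)%N ->
  csquare L p -> (forall z, csquare L z -> f z = g z) ->
  bilinear_interp L n f p = bilinear_interp L n g p.
Proof.
move=> L0 n0 Lp fg; rewrite /bilinear_interp.
have h b1 b2 := fg _ (corner_csquare L0 n0 (b1, b2) Lp).
have := h false false; have := h true false; have := h false true; have := h true true.
by rewrite /corner/= !addn0 !addn1 => -> -> -> ->.
Qed.

Lemma measurable_bilinear_interp (f : X -> R * R -> R) (V : X -> R * R) :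
  measurable_fun setT (V : X -> (RT * RT)%type) ->
  (forall b, measurable_fun setT (fun x => f x (corner L n b (V x)))) ->
  measurable_fun setT (fun x => bilinear_interp L n (f x) (V x)).
Proof.
move=> mV mf.
have mcell : measurable_fun setT (fun x : RT => (cell L n x)%:R : RT).
  have := @measurable_fun_countable_index _ _ RT RT (cell L n)
    (fun i _ => i%:R) (@measurable_cell R L n).
  by apply => i; exact: measurable_cst.
have mu1 (v : X -> RT) : measurable_fun setT v ->
    measurable_fun setT (fun x => v x * n%:R / L - (cell L n (v x))%:R).
  move=> mv; apply: measurable_funB; last exact: measurableT_comp mcell mv.
  by apply: measurable_funM => //; exact: measurable_funM.
have mV1 := mu1 _ (measurableT_comp measurable_fst mV).
have mV2 := mu1 _ (measurableT_comp measurable_snd mV).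
have m1 (v : X -> RT) : measurable_fun setT v -> measurable_fun setT (fun x => 1 - v x).
  by move=> mv; exact: measurable_funB.
have := mf (false, false); have := mf (true, false).
have := mf (false, true); have := mf (true, true).
rewrite /corner/=; under eq_fun do rewrite !addn1.
move=> m11; under eq_fun do rewrite addn0 addn1.
move=> m01; under eq_fun do rewrite addn0 addn1.
move=> m10; under eq_fun do rewrite !addn0.
move=> m00; rewrite /bilinear_interp.
have mM (a b c : X -> RT) : measurable_fun setT a -> measurable_fun setT b ->
    measurable_fun setT c -> measurable_fun setT (fun x => a x * b x * c x).
  by move=> ma mb mc; apply: measurable_funM => //; exact: measurable_funM.
have mV1' := m1 _ mV1; have mV2' := m1 _ mV2.
apply: measurable_funD; last exact: mM.
apply: measurable_funD; last exact: mM.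
by apply: measurable_funD; exact: mM.
Qed.

End interpolation_measurability.

Section clamp.
Context {R : realType}.

(** It agrees with chi K on [0, +oo), and is [0, K]-valued everywhere, so that
    processes that are nonnegative only almost surely give points of the square. *)
Definition clamp (K x : R) : R := chi K (Num.max x 0).

Lemma minr_lip (K x y : R) : `|Num.min x K - Num.min y K| <= `|x - y|.
Proof.
have h1 := ler_norm (x - y); have := ler_norm (y - x); rewrite distrC => h2.
by case: (leP x K) => a; case: (leP y K) => b; rewrite ler_norml;
  apply/andP; split; lra.
Qed.

Lemma maxr_lip (x y : R) : `|Num.max x 0 - Num.max y 0| <= `|x - y|.
Proof.
have h1 := ler_norm (x - y); have := ler_norm (y - x); rewrite distrC => h2.
by case: (leP x 0) => a; case: (leP y 0) => b; rewrite ler_norml;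
  apply/andP; split; lra.
Qed.

Lemma clamp_lip (K x y : R) : `|clamp K x - clamp K y| <= `|x - y|.
Proof. exact: le_trans (minr_lip _ _ _) (maxr_lip _ _). Qed.

Lemma clamp_itv (K x : R) : 0 < K -> 0 <= clamp K x <= K.
Proof.
by move=> K0; rewrite /clamp /chi le_min ge_min lexx orbT andbT le_max lexx orbT ltW.
Qed.

Lemma clampE (K x : R) : 0 <= x -> clamp K x = chi K x.
Proof. by move=> x0; rewrite /clamp max_l. Qed.

Lemma measurable_clamp (K : R) :
  measurable_fun setT (clamp K : measurableTypeR R -> measurableTypeR R).
Proof. by apply: measurable_minr => //; exact: measurable_maxr. Qed.

End clamp.

Section subordinator_versions.
Context {R : realType} d (T : measurableType d) (P : probability T R).
Local Notation RT := (measurableTypeR R).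
Variables (D : R) (D0 : 0 < D) (l : R -> {RV P >-> R}) (g : R).
Variables (nu : {measure set RT -> \bar R}).
Hypothesis l_sub : levy_subordinator D l g nu.

Lemma subordinator_ge0 : {ae P, forall w x, 0 <= x <= D -> 0 <= l x w}.
Proof.
have [[l0 _ _ _] _ mono] := l_sub.
near=> w => x /andP[x0 xD].
have <- : l 0 w = 0 by near: w.
by apply: (near mono w) => //; near: w.
Unshelve. all: by end_near. Qed.

(** The exceptional event of [subordinator_sandwich] depends on the time; by
    [ae_null_sections] almost every path differs from the version on a null set of
    points only. The map pi is one of the two coordinates of the square. *)
Lemma subordinator_version : exists2 lo : RT * T -> R, measurable_fun setT lo &
  (forall x, 0 <= x <= D -> {ae P, forall w, lo (x, w) = l x w}) /\
  forall pi : (RT * RT)%type -> RT, measurable_fun setT pi ->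
    {ae P, forall w, {ae leb2, forall p, 0 <= pi p <= D ->
       lo (pi p, w) = l (pi p) w}}.
Proof.
have [[_ _ _ l_cont] _ mono] := l_sub.
have [lo [up [mlo mup lou loE]]] := subordinator_sandwich D0 l_cont mono.
exists lo => //; split=> [x xD|pi mpi].
  by apply: filterS (loE x xD) => w [].
have mpiT (q : RT * T -> R) : measurable_fun setT q ->
    measurable_fun setT (fun z : (RT * RT) * T => q (pi z.1, z.2)).
  move=> mq; apply: (measurableT_comp mq).
  by apply: measurable_fun_pair => //; exact: measurableT_comp.
pose N : set ((RT * RT) * T) :=
  [set z | 0 <= pi z.1 <= D] `&` [set z | lo (pi z.1, z.2) < up (pi z.1, z.2)].
have mN : measurable N.
  apply: measurableI.
    rewrite (_ : [set z | _] = setT `&` (fun z : (RT * RT) * T => pi z.1) @^-1` `[0, D]).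
      have : measurable_fun setT (fun z : (RT * RT) * T => pi z.1).
        exact: measurableT_comp.
      exact.
    by rewrite setTI; apply/seteqP; split => z /=; rewrite in_itv.
  rewrite (_ : [set z | _] = setT `&` (fun z : (RT * RT) * T =>
      up (pi z.1, z.2) - lo (pi z.1, z.2)) @^-1` `]0, +oo[).
    have : measurable_fun setT (fun z : (RT * RT) * T =>
      up (pi z.1, z.2) - lo (pi z.1, z.2)).
      by apply: measurable_funB; exact: mpiT.
    exact.
  by rewrite setTI; apply/seteqP; split => z /=; rewrite in_itv/= andbT subr_gt0.
have NP p : P [set w | N (p, w)] = 0%E.
  have mNp : measurable [set w | N (p, w)].
    have := measurable_xsection p mN; congr (measurable _).
    by apply/seteqP; split => w; rewrite /xsection /= inE.
  apply: (measure_negligible mNp).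
  have [pD|pD] := pselect (0 <= pi p <= D); last first.
    by exists set0; split => // w [].
  have [M [mM M0 sM]] := loE _ pD.
  exists M; split => // w [_ /= lu]; apply: sM => -[a b].
  by move: lu; rewrite a b ltxx.
have := @ae_null_sections _ _ _ _ _ (@leb2_sf R) P N mN NP.
move=> nN; apply: filterS2 lou nN => w lup [M [mM M0 sM]].
exists M; split => // p /= h; apply: sM; apply: contrapT => Nw; apply: h => pD.
have /andP[a b] := lup _ pD.
have [lu|ul] := ltP (lo (pi p, w)) (up (pi p, w)); first by exfalso; apply: Nw.
by apply/eqP; rewrite eq_le a (le_trans b ul).
Qed.

End subordinator_versions.

Lemma ae_imply d (X : measurableType d) (R : realType)
    (mu : {measure set X -> \bar R}) (A B : X -> Prop) :
  (forall x, A x -> B x) -> {ae mu, forall x, A x} -> {ae mu, forall x, B x}.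
Proof.
move=> AB [N [mN N0 sN]]; exists N; split => // x nB; apply: sN => Ax.
by apply: nB; exact: AB.
Qed.

Lemma ae_and d (X : measurableType d) (R : realType)
    (mu : {measure set X -> \bar R}) (A B : X -> Prop) :
  {ae mu, forall x, A x} -> {ae mu, forall x, B x} ->
  {ae mu, forall x, A x /\ B x}.
Proof. by move=> aA aB; apply: filterS2 aA aB => x; split. Qed.

(** The eigenvalues of both fields are nonnegative, so each of the two series is
    bounded by their sum. *)
Lemma partial_sums_le {R : realType} (lam1 lam2 v : nat -> R) (C : R) :
  (forall i, 0 <= lam1 i) -> (forall i, 0 <= lam2 i) -> (forall i, 0 <= v i) ->
  (\sum_(0 <= i <oo) ((lam1 i + lam2 i) * v i)%:E <= C%:E)%E ->
  forall n, \sum_(i < n) lam1 i * v i <= C /\ \sum_(i < n) lam2 i * v i <= C.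
Proof.
move=> l1 l2 v0 sC n.
have : ((\sum_(i < n) (lam1 i + lam2 i) * v i)%:E <= C%:E)%E.
  rewrite (le_trans _ sC)// -sumEFin -(big_mkord xpredT (fun i => ((lam1 i + lam2 i) * v i)%:E)).
  apply: nneseries_lim_ge => i _ _.
  by rewrite lee_fin mulr_ge0 ?addr_ge0.
rewrite lee_fin => h; split; apply: le_trans h; apply: ler_sum => i _.
- by rewrite ler_wpM2r// lerDl.
- by rewrite ler_wpM2r// lerDr.
Qed.

Lemma coefficient_lip {R : realType} (K A : R) (abar : R * R -> R)
    (Phi1 Phi2 : R -> R) (c : R) (w1 w2 v1 v2 : R * R -> R) (l1 l2 k1 k2 : R -> R) p :
  (forall x y, `|Phi2 x - Phi2 y| <= c * `|x - y|) ->
  `|coefficient K A abar Phi1 Phi2 w1 w2 l1 l2 p -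
    coefficient K A abar Phi1 Phi2 v1 v2 k1 k2 p| <=
  `|Phi1 (w1 p) - Phi1 (v1 p)| +
  c * `|w2 (chi K (l1 p.1), chi K (l2 p.2)) - v2 (chi K (k1 p.1), chi K (k2 p.2))|.
Proof.
move=> lip; rewrite /coefficient; apply: le_trans (minr_lip _ _ _) _.
set x := w2 _; set y := v2 _.
rewrite (_ : _ - _ = (Phi1 (w1 p) - Phi1 (v1 p)) + (Phi2 x - Phi2 y)); last by ring.
by rewrite (le_trans (ler_normD _ _))// lerD2l.
Qed.

Section coefficient_error.
Context {R : realType} d (T : measurableType d) (P : probability T R).
Local Notation RT := (measurableTypeR R).
Variables (L : R) (L0 : 0 < L) (W : R * R -> {RV P >-> R}).
Variables (Om : set T) (gOm : good_set L W Om).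
Local Notation Z := (version L W Om).

(** The two integrands agree on the event Om of full measure. *)
Lemma version_transform_le (F : R -> R) (n : nat) p (s : R) : (0 < n)%N ->
  csquare L p -> measurable_fun setT (F : RT -> RT) ->
  (\int[P]_w (`|F (Z (p, w)) -
      F (bilinear_interp L n (fun p => Z (p, w)) p)| `^ s)%:E <=
   \int[P]_w (`|F (W p w) -
      F (bilinear_interp L n (fun p => W p w) p)| `^ s)%:E)%E.
Proof.
move=> n0 Lp mF; apply: le_integral_outer.
- by move=> w; rewrite lee_fin powR_ge0.
- by move=> w; rewrite lee_fin powR_ge0.
- apply/measurable_EFinP; apply: (measurableT_comp (measurable_powR _)).
  apply: measurableT_comp => //; apply: measurable_funB.
    exact: (measurableT_comp mF (measurable_funP (W p))).
  apply: (measurableT_comp mF).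
  by apply: (@measurable_bilinear_interp _ _ _ L n (fun w p => W p w) (fun=> p)).
- have [mO O0 _] := gOm; exists (~` Om); split => //; first exact: measurableC.
  move=> w /= h Ow; apply: h; rewrite (versionE W Lp Ow).
  rewrite (bilinear_interp_eq (g := fun p => W p w) L0 n0 Lp)// => z Lz.
  exact: versionE.
Qed.

End coefficient_error.

(** * Convergence of the approximated coefficient *)

Theorem theorem4p8 (R : realType)
  (d : measure_display) (T : measurableType d) (P : probability T R)
  (P_complete : measure_is_complete P)
  (D K A : R) (D_gt0 : 0 < D) (K_gt0 : 0 < K) (A_gt0 : 0 < A)
  (Gamma1 Gamma2 : set (R * R))
  (Gamma_cover : Gamma1 `|` Gamma2 = square_boundary D)
  (Gamma_disj : Gamma1 `&` Gamma2 = set0)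
  (Gamma1_mfd : one_manifold Gamma1) (Gamma2_mfd : one_manifold Gamma2)
  (Gamma2_normal : normal_derivative_defined D Gamma2)
  (W1 W2 : R * R -> {RV P >-> R})
  (W1_gauss : gaussian_field (csquare D) W1)
  (W2_gauss : gaussian_field (csquare K) W2)
  (W1_mean0 : forall p : R * R, csquare D p -> ('E_P[W1 p] = 0)%E)
  (W2_mean0 : forall p : R * R, csquare K p -> ('E_P[W2 p] = 0)%E)
  (W1_cont : {ae P, forall w, {within csquare D, continuous (fun p => W1 p w)}})
  (W2_cont : {ae P, forall w, {within csquare K, continuous (fun p => W2 p w)}})
  (lam1 lam2 : nat -> R) (e1 e2 : nat -> R * R -> R)
  (eig1 : eigenpairs D W1 lam1 e1) (eig2 : eigenpairs K W2 lam2 e2)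
  (alpha beta Ce Clam : R)
  (alpha_gt0 : 0 < alpha) (beta_gt0 : 0 < beta)
  (Ce_gt0 : 0 < Ce) (Clam_gt0 : 0 < Clam)
  (e1_bounds : eigenfunction_bounds D e1 alpha Ce)
  (e2_bounds : eigenfunction_bounds K e2 alpha Ce)
  (lam_sum : (\sum_(0 <= i <oo) ((lam1 i + lam2 i) * i.+1%:R `^ beta)%:E
                <= Clam%:E)%E)
  (Phi1 Phi2 : R -> R)
  (Phi1_ge0 : forall x : R, 0 <= Phi1 x) (Phi2_ge0 : forall x : R, 0 <= Phi2 x)
  (Phi1_cont : continuous Phi1) (Phi2_cont : continuous Phi2)
  (Phi1_derivable : forall x : R, derivable Phi1 x 1)
  (Phi1_C1 : continuous Phi1^`()%classic)
  (phi psi Clip : R) (phi_gt0 : 0 < phi) (psi_gt0 : 0 < psi)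
  (Clip_gt0 : 0 < Clip)
  (Phi1_growth : forall x : R, `|Phi1^`()%classic x| <= phi * expR (psi * `|x|))
  (Phi2_lip : forall x y : R, `|Phi2 x - Phi2 y| <= Clip * `|x - y|)
  (q : R) (q_gt1 : 1 < q)
  (f g : T -> R * R -> R)
  (f_Lq : in_bochner leb2 (osquare D) P q%:E 2%:E f)
  (g_Lq : in_bochner (boundary_measure D) Gamma2 P q%:E 2%:E g)
  (abar : R * R -> R) (abar_lo abar_hi : R)
  (abar_cont : {within osquare D, continuous abar})
  (abar_lo_gt0 : 0 < abar_lo) (abar_hi_gt0 : 0 < abar_hi)
  (abar_bounds : forall p : R * R, osquare D p -> abar_lo <= abar p <= abar_hi)
  (l1 l2 : R -> {RV P >-> R}) (gam1 gam2 : R)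
  (nu1 nu2 : {measure set (measurableTypeR R) -> \bar R})
  (l1_sub : levy_subordinator D l1 gam1 nu1)
  (l2_sub : levy_subordinator D l2 gam2 nu2)
  (lapp1 lapp2 : R -> R -> T -> R)
  (lapp1_meas : forall el : R, 0 < el ->
     measurable_fun (`[0, D] `*` [set: T])
       (fun z : R * T => lapp1 el z.1 z.2))
  (lapp2_meas : forall el : R, 0 < el ->
     measurable_fun (`[0, D] `*` [set: T])
       (fun z : R * T => lapp2 el z.1 z.2))
  (lapp1_ge0 : forall el : R, 0 < el ->
     {ae P, forall w (x : R), 0 <= x <= D -> 0 <= lapp1 el x w})
  (lapp2_ge0 : forall el : R, 0 < el ->
     {ae P, forall w (x : R), 0 <= x <= D -> 0 <= lapp2 el x w})
  (l_indep : forall el : R, 0 < el ->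
     independent_families P
       (process_events (I := R) `[0, D] l1 `|`
        process_events (I := R) `[0, D] l2 `|`
        process_events (I := R) `[0, D] (lapp1 el) `|`
        process_events (I := R) `[0, D] (lapp2 el))
       (process_events (csquare D) W1 `|` process_events (csquare K) W2))
  (eta Cl : R) (eta_gt0 : 0 < eta) (Cl_gt0 : 0 < Cl)
  (lapp1_err : forall r el x : R,
     1 <= r -> r < eta - 1 -> 0 < el -> 0 <= x <= D ->
     ('E_P[fun w => (`|l1 x w - lapp1 el x w| `^ r)%R] <= (Cl * el)%:E)%E)
  (lapp2_err : forall r el x : R,
     1 <= r -> r < eta - 1 -> 0 < el -> 0 <= x <= D ->
     ('E_P[fun w => (`|l2 x w - lapp2 el x w| `^ r)%R] <= (Cl * el)%:E)%E)
  (N1 N2 : R -> nat) (N1_grid : grid_sizes D N1) (N2_grid : grid_sizes K N2)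
  (t s gamma : R) (t_ge1 : 1 <= t) (t_le_s : t <= s) (s_lt_eta : s < eta - 1)
  (gamma_gt0 : 0 < gamma) (gamma_lt : gamma < Num.min 1 (beta / (2 * alpha)))
  (s_gamma : 2 <= s * gamma) :
  exists2 C : R, 0 < C &
    forall eW el : R, 0 < eW -> 0 < el ->
      let a w := coefficient K A abar Phi1 Phi2
        (fun p => W1 p w) (fun p => W2 p w)
        (fun x => l1 x w) (fun x => l2 x w) in
      let a_app w := coefficient K A abar Phi1 Phi2
        (bilinear_interp D (N1 eW) (fun p => W1 p w))
        (bilinear_interp K (N2 eW) (fun p => W2 p w))
        (fun x => lapp1 el x w) (fun x => lapp2 el x w) in
      (bochner_norm leb2 (osquare D) P s%:E t%:E
         (fun w p => (a w p - a_app w p)%R)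
         <= (C * (eW `^ gamma + el `^ s^-1))%:E)%E.
Proof.
pose RT := measurableTypeR R.
have s1 : 1 <= s by exact: le_trans t_le_s.
have s0 : 0 < s by exact: lt_le_trans s1.
have /andP[gamma1 gamma_ab] : (gamma < 1) && (gamma < beta / (2 * alpha)).
  by rewrite -lt_min.
have g01 : 0 < gamma < 1 by rewrite gamma_gt0.
have ag : alpha * (2 * gamma) <= beta.
  move: gamma_ab; rewrite ltr_pdivlMr ?mulr_gt0// => /ltW.
  by apply: le_trans; rewrite le_eqVlt; apply/orP; left; apply/eqP; ring.
pose r := s * gamma.
have r1 : 1 <= r by rewrite (le_trans _ s_gamma)// ler1n.
have r0 : 0 < r by exact: lt_le_trans r1.
have r_eta : r < eta - 1.
  by apply: le_lt_trans s_lt_eta; rewrite ler_piMr ?(ltW s0) ?(ltW gamma1).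
have [Om1 gOm1] := ex_good_set W1_cont.
have [Om2 gOm2] := ex_good_set W2_cont.
have lam1_ge0 i := field_eigenvalue_ge0 D_gt0 W1_gauss W1_cont W1_mean0 eig1 gOm1 i.
have lam2_ge0 i := field_eigenvalue_ge0 K_gt0 W2_gauss W2_cont W2_mean0 eig2 gOm2 i.
have sums := partial_sums_le lam1_ge0 lam2_ge0 (fun i => powR_ge0 _ _) lam_sum.
have s20 : 0 < 2 * s by rewrite mulr_gt0.
have [A1 A10 inc1] := field_increment_moment D_gt0 W1_gauss W1_cont W1_mean0 eig1
  Ce_gt0 e1_bounds Clam_gt0 (fun n => (sums n).1) g01 ag s20.
have [A2 A20 inc2] := field_increment_moment K_gt0 W2_gauss W2_cont W2_mean0 eig2
  Ce_gt0 e2_bounds Clam_gt0 (fun n => (sums n).2) g01 ag s0.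
have Phi1_lip := exp_growth_lipschitz phi_gt0 psi_gt0 Phi1_derivable Phi1_cont
  Phi1_growth.
have [B1 B10 err1] := field_transform_error D_gt0 s0 gamma_gt0 A10
  (fun k k0 => field_expR_bounded D_gt0 W1_gauss W1_cont k0) inc1 phi_gt0 psi_gt0
  Phi1_lip.
pose H := process_events (csquare D) W1 `|` process_events (csquare K) W2.
have WH2 : process_events (csquare K) (fun p => W2 p : T -> R) `<=` H.
  by move=> E WE; right.
have [B2 B20 err2] := random_interpolation_moment K_gt0 gOm2 WH2 s0 r0 A20 inc2.
have [lo1 mlo1 [lo1E lo1_ae]] := subordinator_version D_gt0 l1_sub.
have [lo2 mlo2 [lo2E lo2_ae]] := subordinator_version D_gt0 l2_sub.
have mSq := @measurable_osquare R D.
have msub : (leb2 (osquare D) <= (D ^+ 2)%:E)%E.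
  rewrite -(csquare_measure D_gt0); apply: le_measure; rewrite ?inE//.
    exact: measurable_csquare.
  exact: osquare_csquare.
pose m := fine (leb2 (osquare D)).
have mE : leb2 (osquare D) = m%:E.
  by rewrite fineK// ge0_fin_numE// (le_lt_trans msub)// ltry.
have m0 : 0 <= m by rewrite fine_ge0.
have m1 : 0 < m + 1 by rewrite ltr_wpDl.
pose C0 := 2 `^ s * (B1 + Clip `^ s * (B2 * (2 `^ r * (2 * Cl) + 1))).
have C00 : 0 < C0.
  by rewrite mulr_gt0 ?powR_gt0// addr_gt0// !mulr_gt0 ?powR_gt0// addr_gt0// !mulr_gt0 ?powR_gt0.
exists ((m + 1) `^ t^-1 * (((m + 1) * C0) `^ s^-1 * 2 `^ s^-1)).
  by rewrite !mulr_gt0 ?powR_gt0// mulr_gt0.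
move=> eW el eW0 el0.
pose a w := coefficient K A abar Phi1 Phi2 (fun p => W1 p w) (fun p => W2 p w)
  (fun x => l1 x w) (fun x => l2 x w).
pose a_app w := coefficient K A abar Phi1 Phi2
  (bilinear_interp D (N1 eW) (fun p => W1 p w))
  (bilinear_interp K (N2 eW) (fun p => W2 p w))
  (fun x => lapp1 el x w) (fun x => lapp2 el x w).
change (bochner_norm leb2 (osquare D) P s%:E t%:E (fun w p => (a w p - a_app w p)%R)
  <= ((m + 1) `^ t^-1 * (((m + 1) * C0) `^ s^-1 * 2 `^ s^-1) *
      (eW `^ gamma + el `^ s^-1))%:E)%E.
have [n10 n1W] := N1_grid eW eW0; have [n20 n2W] := N2_grid eW eW0.
set n1 := N1 eW in a_app n10 n1W *; set n2 := N2 eW in a_app n20 n2W *.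
have eWr0 : 0 < eW `^ r by rewrite powR_gt0.
pose Kb := C0 * (eW `^ r + el).
have Kb0 : 0 < Kb by rewrite mulr_gt0// addr_gt0.
pose Z1 := version D W1 Om1; pose Z2 := version K W2 Om2.
have mZ1 : measurable_fun setT Z1 by exact: measurable_version.
have mZ2 : measurable_fun setT Z2 by exact: measurable_version.
(* extension by 0 outside [0, D], to have a measurable function on the whole space *)
pose ext (h : R -> R -> T -> R) : RT * T -> R :=
  (fun z : R * T => h el z.1 z.2) \_ (`[0, D] `*` setT).
have extE h x w : 0 <= x <= D -> ext h (x, w) = h el x w.
  by move=> xD; rewrite /ext patchE mem_set//=; split => //=; rewrite in_itv.
have mdom : measurable (`[0, D] `*` setT : set (RT * T)) by exact: measurableX.
have mla1 : measurable_fun setT (ext lapp1).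
  exact: (measurable_restrictT _ mdom).1 (lapp1_meas _ el0).
have mla2 : measurable_fun setT (ext lapp2).
  exact: (measurable_restrictT _ mdom).1 (lapp2_meas _ el0).
pose pt (q1 q2 : RT * T -> R) (z : (RT * RT) * T) : R * R :=
  (clamp K (q1 (z.1.1, z.2)), clamp K (q2 (z.1.2, z.2))).
have mpt q1 q2 : measurable_fun setT q1 -> measurable_fun setT q2 ->
    measurable_fun setT (pt q1 q2 : (RT * RT) * T -> (RT * RT)%type).
  move=> mq1 mq2.
  have m11 : measurable_fun setT (fun z : (RT * RT) * T => (z.1.1, z.2)).
    by apply: measurable_fun_pair => //; exact: measurableT_comp.
  have m12 : measurable_fun setT (fun z : (RT * RT) * T => (z.1.2, z.2)).
    by apply: measurable_fun_pair => //; exact: measurableT_comp.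
  apply: measurable_fun_pair; apply: (measurableT_comp (@measurable_clamp R K)).
    exact: measurableT_comp mq1 m11.
  exact: measurableT_comp mq2 m12.
have ptK q1 q2 z : csquare K (pt q1 q2 z) by split; exact: clamp_itv.
pose U := pt lo1 lo2; pose V := pt (ext lapp1) (ext lapp2).
have mU := mpt _ _ mlo1 mlo2; have mV := mpt _ _ mla1 mla2.
(* gg dominates the error almost everywhere and is jointly measurable; G1 and G2 are
   the errors due to the first and to the second field *)
pose G1 z := `|Phi1 (Z1 z) - Phi1 (bilinear_interp D n1 (fun p => Z1 (p, z.2)) z.1)|.
pose G2 z := `|Z2 (U z, z.2) - bilinear_interp K n2 (fun p => Z2 (p, z.2)) (V z)|.
have mPhi1 : measurable_fun setT (Phi1 : RT -> RT) by exact: continuous_measurable_fun.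
have mat (Z : (RT * RT) * T -> R) (Q : (RT * RT) * T -> R * R) :
    measurable_fun setT Z -> measurable_fun setT (Q : (RT * RT) * T -> (RT * RT)%type) ->
    measurable_fun setT (fun z => Z (Q z, z.2)).
  move=> mZ mQ; apply: (measurableT_comp mZ).
  exact: (measurable_fun_pair (f := (Q : _ -> (RT * RT)%type)) mQ measurable_snd).
have mbil (Z : (RT * RT) * T -> R) (Q : (RT * RT) * T -> R * R) L n :
    measurable_fun setT Z -> measurable_fun setT (Q : (RT * RT) * T -> (RT * RT)%type) ->
    measurable_fun setT (fun z => bilinear_interp L n (fun p => Z (p, z.2)) (Q z)).
  move=> mZ mQ; apply: (@measurable_bilinear_interp _ _ _ L n (fun z p => Z (p, z.2)) Q) => // b.
  apply: (mat Z (fun z => corner L n b (Q z))) => //.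
  exact: measurableT_comp (@measurable_corner _ L n b) mQ.
have mG1 : measurable_fun setT G1.
  apply: measurableT_comp => //; apply: measurable_funB; apply: (measurableT_comp mPhi1) => //.
  by apply: mbil => //; exact: measurable_fst.
have mG2 : measurable_fun setT G2.
  apply: measurableT_comp => //; apply: measurable_funB; first exact: mat.
  exact: mbil.
pose gg z := G1 z + Clip * G2 z.
have mgg : measurable_fun setT gg.
  by apply: measurable_funD => //; exact: measurable_funM.
have gg0 z : 0 <= gg z by rewrite addr_ge0 ?mulr_ge0 ?normr_ge0 ?(ltW Clip_gt0).
have dom : {ae P, forall w, {ae leb2, forall p, osquare D p ->
    `|a w p - a_app w p| <= gg (p, w)}}.
  have ae_good L (W : R * R -> {RV P >-> R}) Om : good_set L W Om -> {ae P, forall w, Om w}.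
    by case=> mO O0 _; exists (~` Om); split => //; exact: measurableC.
  have aeOm : {ae P, forall w, Om1 w /\ Om2 w}.
    by apply: filterS2 (ae_good _ _ _ gOm1) (ae_good _ _ _ gOm2).
  have pos1 : {ae P, forall w x, 0 <= x <= D -> 0 <= l1 x w /\ 0 <= lapp1 el x w}.
    apply: filterS2 (subordinator_ge0 l1_sub) (lapp1_ge0 _ el0) => w h1 h2 x xD.
    by split; [exact: h1|exact: h2].
  have pos2 : {ae P, forall w x, 0 <= x <= D -> 0 <= l2 x w /\ 0 <= lapp2 el x w}.
    apply: filterS2 (subordinator_ge0 l2_sub) (lapp2_ge0 _ el0) => w h1 h2 x xD.
    by split; [exact: h1|exact: h2].
  have pos : {ae P, forall w, (forall x, 0 <= x <= D -> 0 <= l1 x w /\ 0 <= lapp1 el x w) /\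
      (forall x, 0 <= x <= D -> 0 <= l2 x w /\ 0 <= lapp2 el x w)}.
    by apply: filterS2 pos1 pos2 => w.
  have ae12 : {ae P, forall w, {ae leb2, forall p, osquare D p ->
      lo1 (p.1, w) = l1 p.1 w /\ lo2 (p.2, w) = l2 p.2 w}}.
    apply: filterS2 (lo1_ae _ measurable_fst) (lo2_ae _ measurable_snd) => w.
    move=> h1 h2; apply: ae_imply (ae_and h1 h2) => p [{}h1 {}h2] /osquare_csquare[p1 p2].
    by split; [exact: h1|exact: h2].
  apply: filterS3 aeOm pos ae12 => w -[ow1 ow2] [pos1w pos2w].
  apply: ae_imply => p loE Op; have [loE1 loE2] := loE Op.
  have Dp := osquare_csquare Op; have [p1 p2] := Dp.
  have [l1p k1p] := pos1w _ p1; have [l2p k2p] := pos2w _ p2.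
  apply: (le_trans (coefficient_lip _ _ _ _ _ _ _ _ _ _ _ _ _ Phi2_lip)).
  have UE : U (p, w) = (chi K (l1 p.1 w), chi K (l2 p.2 w)).
    by rewrite /U /pt /= loE1 loE2 !clampE.
  have VE : V (p, w) = (chi K (lapp1 el p.1 w), chi K (lapp2 el p.2 w)).
    by rewrite /V /pt /= !extE// !clampE.
  have UK : csquare K (U (p, w)) by exact: ptK.
  have VK : csquare K (V (p, w)) by exact: ptK.
  rewrite -UE -VE /gg /G1 /G2 /Z1 /Z2 /= (versionE W1 Dp ow1) (versionE W2 UK ow2).
  rewrite (bilinear_interp_eq (g := fun p => W1 p w) D_gt0 n10 Dp); last first.
    by move=> z Dz; exact: versionE.
  rewrite (bilinear_interp_eq (f := fun p => version K W2 Om2 (p, w))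
    (g := fun p => W2 p w) K_gt0 n20 VK)//.
  by move=> z Kz; exact: versionE.
have mom p : osquare D p -> (\int[P]_w (gg (p, w) `^ s)%:E <= Kb%:E)%E.
  move=> /osquare_csquare Dp; have [p1 p2] := Dp.
  have mpow (X : T -> R) c : measurable_fun setT X -> measurable_fun setT (fun w => X w `^ c).
    by move=> mX; exact: (measurableT_comp (measurable_powR _) mX).
  have i1 : (\int[P]_w (G1 (p, w) `^ s)%:E <= (B1 * eW `^ r)%:E)%E.
    apply: (le_trans (version_transform_le D_gt0 gOm1 s n10 Dp mPhi1)).
    exact: err1.
  have i2 : (\int[P]_w (G2 (p, w) `^ s)%:E <=
      (B2 * (2 `^ r * (2 * (Cl * el)) + eW `^ r))%:E)%E.
    (* at a fixed point the processes themselves have to be used: lo1 and lo2 are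
       modified on a null event, which need not be in the sigma-algebra to which
       independence refers *)
    pose U' w : R * R := (clamp K (l1 p.1 w), clamp K (l2 p.2 w)).
    pose V' w : R * R := (clamp K (lapp1 el p.1 w), clamp K (lapp2 el p.2 w)).
    have U'K w : csquare K (U' w) by split; exact: clamp_itv.
    have V'K w : csquare K (V' w) by split; exact: clamp_itv.
    have mk1 : measurable_fun setT (lapp1 el p.1).
      by have := measurable_fun_pair2 (p.1 : RT) mla1; under eq_fun do rewrite extE//.
    have mk2 : measurable_fun setT (lapp2 el p.2).
      by have := measurable_fun_pair2 (p.2 : RT) mla2; under eq_fun do rewrite extE//.
    have mU' : measurable_fun setT (U' : T -> (RT * RT)%type).
      apply: measurable_fun_pair.
        exact: (measurableT_comp (@measurable_clamp R K) (measurable_funP (l1 p.1))).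
      exact: (measurableT_comp (@measurable_clamp R K) (measurable_funP (l2 p.2))).
    have mV' : measurable_fun setT (V' : T -> (RT * RT)%type).
      apply: measurable_fun_pair.
        exact: (measurableT_comp (@measurable_clamp R K) mk1).
      exact: (measurableT_comp (@measurable_clamp R K) mk2).
    have dist' : (\int[P]_w (dist1 (U' w) (V' w) `^ r)%:E <= (2 `^ r * (2 * (Cl * el)))%:E)%E.
      pose d1 w := `|l1 p.1 w - lapp1 el p.1 w|; pose d2 w := `|l2 p.2 w - lapp2 el p.2 w|.
      have md1 : measurable_fun setT d1.
        by apply: measurableT_comp => //; exact: measurable_funB.
      have md2 : measurable_fun setT d2.
        by apply: measurableT_comp => //; exact: measurable_funB.
      have e1r : (\int[P]_w (d1 w `^ r)%:E <= (Cl * el)%:E)%E.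
        by have := lapp1_err _ _ _ r1 r_eta el0 p1; rewrite expectation.unlock.
      have e2r : (\int[P]_w (d2 w `^ r)%:E <= (Cl * el)%:E)%E.
        by have := lapp2_err _ _ _ r1 r_eta el0 p2; rewrite expectation.unlock.
      have pd1 w : 0 <= d1 w `^ r by exact: powR_ge0.
      have pd2 w : 0 <= d2 w `^ r by exact: powR_ge0.
      have md12 : measurable_fun setT (fun w => d1 w `^ r + d2 w `^ r).
        by apply: measurable_funD; exact: mpow.
      apply: (@le_trans _ _ (\int[P]_w (2 `^ r * (d1 w `^ r + d2 w `^ r))%:E)%E).
        apply: le_integral_outer.
        - by move=> w; rewrite lee_fin powR_ge0.
        - by move=> w; rewrite lee_fin mulr_ge0 ?powR_ge0// addr_ge0.
        - by apply/measurable_EFinP; exact: measurable_funM.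
        - apply: aeW => w; rewrite lee_fin.
          apply: le_trans (powR_add_le r0 (normr_ge0 _) (normr_ge0 _)).
          apply: (ge0_ler_powR (ltW r0)); rewrite ?nnegrE ?dist1_ge0 ?addr_ge0//.
          by apply: lerD; exact: clamp_lip.
      apply: integral_scale_le; rewrite ?powR_ge0//; first by move=> w; rewrite addr_ge0.
      rewrite mulr_natl mulr2n; apply: integral_add_le => //; exact: mpow.
    have mZ2U' : measurable_fun setT (fun w => Z2 (U' w, w)).
      apply: (measurableT_comp mZ2).
      exact: (measurable_fun_pair (f := (U' : T -> (RT * RT)%type)) mU' (@measurable_id _ T setT)).
    have mbil' : measurable_fun setT
        (fun w => bilinear_interp K n2 (fun p => Z2 (p, w)) (V' w)).
      apply: (@measurable_bilinear_interp _ _ _ K n2 (fun w p => Z2 (p, w)) V') => // b.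
      apply: (measurableT_comp mZ2).
      have mc : measurable_fun setT ((fun w => corner K n2 b (V' w)) : T -> (RT * RT)%type).
        exact: measurableT_comp (@measurable_corner _ K n2 b) mV'.
      exact: (measurable_fun_pair (f := ((fun w => corner K n2 b (V' w)) : T -> (RT * RT)%type))
        mc (@measurable_id _ T setT)).
    apply: (@le_trans _ _ (\int[P]_w (`|Z2 (U' w, w) -
        bilinear_interp K n2 (fun p => Z2 (p, w)) (V' w)| `^ s)%:E)%E).
      apply: le_integral_outer.
      - by move=> w; rewrite lee_fin powR_ge0.
      - by move=> w; rewrite lee_fin powR_ge0.
      - apply/measurable_EFinP; apply: mpow; apply: measurableT_comp => //.
        exact: measurable_funB.
      - apply: filterS2 (lo1E _ p1) (lo2E _ p2) => w e1w e2w.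
        have -> : U' w = U (p, w) by rewrite /U /pt /= e1w e2w.
        by have -> : V' w = V (p, w) by rewrite /V /pt /= !extE.
    have sub (F : set (set T)) (J : set R) (X : R -> T -> R) x : J x ->
        process_events J X `<=` F -> sub_measurable F (fun w => clamp K (X x w)).
      move=> Jx XF; apply: (sub_measurable_comp (@measurable_clamp R K)) => B mB.
      apply: sub_sigma_algebra; apply: XF; exists x => //; exists B => //.
      by rewrite setTI.
    have p1' : `[0, D]%classic p.1 by rewrite /= in_itv.
    have p2' : `[0, D]%classic p.2 by rewrite /= in_itv.
    apply: (err2 _ (l_indep _ el0)) => //.
    - by rewrite !mulr_ge0 ?powR_ge0 ?(ltW Cl_gt0) ?(ltW el0).
    - by apply: (sub _ _ (fun x w => l1 x w) _ p1') => E XE; left; left; left.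
    - by apply: (sub _ _ (fun x w => l2 x w) _ p2') => E XE; left; left; right.
    - by apply: (sub _ _ _ _ p1') => E XE; left; right.
    - by apply: (sub _ _ _ _ p2') => E XE; right.
  have mG1p : measurable_fun setT (fun w => G1 (p, w)) := measurable_fun_pair2 (p : RT * RT) mG1.
  have mG2p : measurable_fun setT (fun w => G2 (p, w)) := measurable_fun_pair2 (p : RT * RT) mG2.
  have m12 : measurable_fun setT (fun w => Clip `^ s * G2 (p, w) `^ s).
    by apply: measurable_funM => //; exact: mpow.
  have q1 w : 0 <= G1 (p, w) `^ s by exact: powR_ge0.
  have q2 w : 0 <= G2 (p, w) `^ s by exact: powR_ge0.
  have q12 w : 0 <= Clip `^ s * G2 (p, w) `^ s by rewrite mulr_ge0 ?powR_ge0.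
  apply: (@le_trans _ _ (\int[P]_w
      (2 `^ s * (G1 (p, w) `^ s + Clip `^ s * G2 (p, w) `^ s))%:E)%E).
    apply: le_integral_outer.
    - by move=> w; rewrite lee_fin powR_ge0.
    - by move=> w; rewrite lee_fin mulr_ge0 ?powR_ge0// addr_ge0.
    - apply/measurable_EFinP; apply: measurable_funM => //.
      by apply: measurable_funD => //; exact: mpow.
    - apply: aeW => w; rewrite lee_fin -powRM ?normr_ge0 ?(ltW Clip_gt0)//.
      exact: (powR_add_le s0 (normr_ge0 _) (mulr_ge0 (ltW Clip_gt0) (normr_ge0 _))).
  apply: (@le_trans _ _ (2 `^ s * (B1 * eW `^ r +
      Clip `^ s * (B2 * (2 `^ r * (2 * (Cl * el)) + eW `^ r))))%:E).
    apply: integral_scale_le; rewrite ?powR_ge0//.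
    - by apply: measurable_funD => //; exact: mpow.
    - by move=> w; rewrite addr_ge0.
    apply: integral_add_le => //; first exact: mpow.
    by apply: integral_scale_le; rewrite ?powR_ge0//; exact: mpow.
  rewrite lee_fin /Kb /C0 -mulrA ler_wpM2l ?powR_ge0//.
  rewrite -subr_ge0.
  have -> : (B1 + Clip `^ s * (B2 * (2 `^ r * (2 * Cl) + 1))) * (eW `^ r + el) -
      (B1 * eW `^ r + Clip `^ s * (B2 * (2 `^ r * (2 * (Cl * el)) + eW `^ r))) =
      B1 * el + Clip `^ s * (B2 * (2 `^ r * (2 * Cl) * eW `^ r + el)) by ring.
  by rewrite !(addr_ge0, mulr_ge0) ?powR_ge0 ?(ltW B10) ?(ltW B20) ?(ltW Cl_gt0) ?(ltW el0).
apply: (le_trans (@bochner_norm_le _ _ _ _ _ (@leb2_sf R) P _ mSq _ m0 mE _ _ t_ge1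
  t_le_s (fun w p => a w p - a_app w p) gg Kb Kb0 mgg gg0 dom mom)).
rewrite lee_fin -!mulrA ler_wpM2l ?powR_ge0//.
rewrite /Kb mulrA powRM ?(mulr_ge0 (ltW m1) (ltW C00)) ?(addr_ge0 (ltW eWr0) (ltW el0))//.
rewrite ler_wpM2l ?powR_ge0//.
have si0 : 0 < s^-1 by rewrite invr_gt0.
apply: (le_trans (powR_add_le si0 (ltW eWr0) (ltW el0))).
by rewrite -powRrM /r mulrAC mulfV ?gt_eqF// mul1r.
Qed.
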